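(* Let $M$ be a smooth manifold with boundary, let $H$ and $g:\partial M\to(0,\infty)$ be the data of a Hamilton–Jacobi boundary value problem with dual Finsler metric $\varphi$, let $u$ be its viscosity solution, let $(N,\varphi)$ be an extension of $(M,\varphi)$ along backward characteristics, and let $\tilde u:N\to\mathbb{R}$ be the extension of $u$ to $N$ by characteristics (all as defined in the context). Let $\Lambda=\tilde u^{-1}(0)$. Then the following identity holds at all points $p$ of $\{\tilde u\ge 0\}$: $$\tilde u(p)=d(\Lambda,p),$$ where $d$ is the distance induced by the Finsler metric on $N$.
   Context: Hamilton–Jacobi data: $M$ is a $C^\infty$ manifold with (possibly non-compact) boundary $\partial M$; $H:T^*M\to\mathbb{R}$ is smooth away from the zero section and, on each fibre $T_p^*M$, positively $1$-homogeneous and subadditive with $H^{-1}(1)\cap T^*_pM$ strictly convex. The dual Finsler metric is $\varphi_p(v)=\sup\{\langle v,\alpha\rangle:\alpha\in T_p^*M,\ H(p,\alpha)=1\}$; $d(q,p)$ is the infimum of the $\varphi$-lengths of curves from $q$ to $p$, and $d(\Lambda,p)=\inf_{q\in\Lambda}d(q,p)$. The function $g:\partial M\to\mathbb{R}$ is smooth, satisfies the compatibility condition $|g(p)-g(q)|<k\,d(p,q)$ for all distinct $p,q\in\partial M$ and some $k<1$, and $g>0$. The problem is $H(p,du(p))=1$ in $M$, $u=g$ on $\partial M$; its unique viscosity solution is $u(p)=\inf_{q\in\partial M}\{d(q,p)+g(q)\}$ (distance in $M$). Dual one-form: for $v\in T_pM$, $\widehat v\in T_p^*M$ is the covector with $\widehat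 v(v)=\varphi(v)^2$ vanishing on the hyperplane tangent at $v$ to $\{v':\varphi(v')=\varphi(v)\}$. Characteristic vector field: for $p\in\partial M$, $X_p\in T_pM$ is the vector with $\varphi_p(X_p)=1$, $\widehat{X_p}|_{T_p(\partial M)}=dg$, and $X_p$ pointing into $M$. Extension along backward characteristics: $N\supset M$ is a larger manifold with a smooth Finsler metric extending $\varphi$ (same notation) such that, for $q\in\partial M$, the geodesic $\tilde\alpha_q$ with $\tilde\alpha_q(0)=q$, $\tilde\alpha_q'(0)=X_q$ can be continued backward for all $t\in(-\infty,0]$, these backward geodesics do not intersect each other, and every point of $N\setminus M$ is $\tilde P(q,t):=\tilde\alpha_q(t)$ for a unique $(q,t)$, $q\in\partial M$, $t<0$ (smoothly). The extended function is $\tilde u(p)=g(q)+t$ if $p=\tilde P(q,t)\in N\setminus M$, and $\tilde u(p)=u(p)$ if $p\in M$; it is smooth across $\partial M$. *)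

(* Defs.v *)
From HB Require Import structures.
From mathcomp Require Export all_boot all_order all_algebra.
From mathcomp Require Export all_classical all_reals all_analysis.
Export numFieldNormedType.Exports.

Set Implicit Arguments.
Unset Strict Implicit.
Unset Printing Implicit Defensive.

Import Order.TTheory GRing.Theory Num.Theory.
Local Open Scope classical_set_scope.
Local Open Scope ring_scope.

Section SmoothEuclidean.
Context {R : realType} {E F : normedModType R}.

Fixpoint Ck (k : nat) (U : set E) (f : E -> F) : Prop :=
  match k with
  | 0 => forall x, U x -> {for x, continuous f}
  | k'.+1 => (forall x, U x -> differentiable f x) /\
             (forall v, Ck k' U ('D_v f))
  end.

(* A need not be open: f is smooth on A when it has a C^oo extension near each
   point of A (one-sided derivatives at the end of an interval, smoothness up
   to the boundary on a half-space, smoothness on a slice). *)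
Definition smooth_on (A : set E) (f : E -> F) :=
  forall x, A x -> exists (U : set E) (G : E -> F),
    [/\ open U, U x, forall k, Ck k U G & forall y, A y -> U y -> G y = f y].

End SmoothEuclidean.

Section Manifold.
Context {R : realType} {n : nat} {N : topologicalType}.

(* The values of cmap outside cdom, and of cinv outside the image of cdom,
   are irrelevant. *)
Record chart := Chart {
  cdom : set N;
  cmap : N -> 'rV[R]_n;
  cinv : 'rV[R]_n -> N;
  _ : open cdom;
  _ : open (cmap @` cdom);
  _ : forall p, cdom p -> cinv (cmap p) = p;
  _ : forall p, cdom p -> {for p, continuous cmap};
  _ : forall x, (cmap @` cdom) x -> {for x, continuous cinv} }.

Definition smooth_transition (c c' : chart) :=
  smooth_on (cmap c @` (cdom c `&` cdom c')) (cmap c' \o cinv c).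

End Manifold.
Arguments chart : clear implicits.

(* A maximal C^oo atlas. The chosen chart chart_at p around p only serves to
   represent tangent vectors and covectors: T_pN is 'rV[R]_n and T*_pN is
   'cV[R]_n, in the coordinates of chart_at p, with pairing v *m a. *)
Record smooth_structure (R : realType) (n : nat) (N : topologicalType) :=
  SmoothStructure {
  atlas : set (chart R n N);
  chart_at : N -> chart R n N;
  _ : forall p, atlas (chart_at p) /\ cdom (chart_at p) p;
  _ : forall c c', atlas c -> atlas c' -> smooth_transition c c';
  _ : forall c, (forall c', atlas c' ->
                   smooth_transition c c' /\ smooth_transition c' c) ->
        atlas c }.

Section Tangent.
Context {R : realType} {n : nat} {N : topologicalType}.
Variable S : smooth_structure R n N.
Implicit Types (p q : N) (c : chart R n N) (M A : set N).

Definition from_at p c : 'M[R]_n :=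
  jacobian (cmap c \o cinv (chart_at S p)) (cmap (chart_at S p) p).

Definition to_at p c : 'M[R]_n :=
  jacobian (cmap (chart_at S p) \o cinv c) (cmap c p).

(* f is smooth from the subset A of N to a normed space *)
Definition smooth_from {F : normedModType R} A (f : N -> F) :=
  forall c, atlas S c -> smooth_on (cmap c @` (cdom c `&` A)) (f \o cinv c).

(* f is smooth from the subset A of a normed space to N *)
Definition smooth_into {E : normedModType R} (A : set E) (f : E -> N) :=
  {within A, continuous f} /\
  forall c, atlas S c -> smooth_on (A `&` f @^-1` cdom c) (cmap c \o f).

Definition velocity (y : R -> N) (t : R) : 'rV[R]_n :=
  derive1 (cmap (chart_at S (y t)) \o y) t.

Definition differential (f : N -> R) p : 'cV[R]_n :=
  \col_i 'D_(delta_mx 0 i) (f \o cinv (chart_at S p)) (cmap (chart_at S p) p).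

Definition boundary_chart M p c (i : 'I_n) :=
  [/\ atlas S c, cdom c p, cmap c p 0 i = 0 &
      forall x, cdom c x -> (M x <-> 0 <= cmap c x 0 i)].

Definition mboundary M : set N :=
  [set p | exists c i, boundary_chart M p c i].

(* M is a manifold with boundary of the same dimension as N, with the smooth
   structure induced by N; then T_pM = T_pN for every p in M. *)
Definition regular_domain M :=
  closed M /\ forall p, M p -> M° p \/ mboundary M p.

(* The reading of H : T*N -> R (resp. phi : TN -> R) in a chart. *)
Definition cotangent_reading (H : N -> 'cV[R]_n -> R) c
    (z : 'rV[R]_n * 'cV[R]_n) : R :=
  H (cinv c z.1) (from_at (cinv c z.1) c *m z.2).

Definition tangent_reading (phi : N -> 'rV[R]_n -> R) c
    (z : 'rV[R]_n * 'rV[R]_n) : R :=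
  phi (cinv c z.1) (z.2 *m to_at (cinv c z.1) c).

Definition hamiltonian M (H : N -> 'cV[R]_n -> R) :=
  [/\ forall c, atlas S c ->
        smooth_on [set z | (cmap c @` (cdom c `&` M)) z.1 /\ z.2 != 0]
                  (cotangent_reading H c),
      forall p a (s : R), M p -> 0 < s -> H p (s *: a) = s * H p a,
      forall p a b, M p -> H p (a + b) <= H p a + H p b &
      forall p a b (s : R), M p -> H p a = 1 -> H p b = 1 -> a != b ->
        0 < s < 1 -> H p (s *: a + (1 - s) *: b) < 1].

Definition finsler_metric (phi : N -> 'rV[R]_n -> R) :=
  [/\ forall c, atlas S c ->
        smooth_on [set z | (cmap c @` cdom c) z.1 /\ z.2 != 0]
                  (tangent_reading phi c),
      forall p v, v != 0 -> 0 < phi p v,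
      forall p v (s : R), 0 <= s -> phi p (s *: v) = s * phi p v &
      forall p v w, v != 0 -> w != 0 ->
        0 < 'D_w ('D_w (fun x => phi p x ^+ 2)) v].

Definition dual_metric M (H : N -> 'cV[R]_n -> R) (phi : N -> 'rV[R]_n -> R) :=
  forall p v, M p ->
    (phi p v)%:E =
    ereal_sup [set ((v *m a) 0 0)%:E | a in [set a | H p a = 1]].

Section Metric.
Variable phi : N -> 'rV[R]_n -> R.

Definition piecewise_smooth (y : R -> N) :=
  exists s : seq R, itv_partition 0 1 s /\
    forall i, (i < size s)%N ->
      smooth_into `[nth 1 (0 :: s) i, nth 1 s i] y.

Definition curve_length (y : R -> N) : \bar R :=
  \int[lebesgue_measure]_(t in `[0, 1]) (phi (y t) (velocity y t))%:E.

(* Infimum of the lengths of the curves from q to p that stay in A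
   (+oo if there are none). *)
Definition finsler_dist A q p : \bar R :=
  ereal_inf [set curve_length y | y in
    [set y | [/\ piecewise_smooth y, y 0 = q, y 1 = p &
                 forall t, 0 <= t <= 1 -> A (y t)]]].

Definition finsler_dist_from A L p : \bar R :=
  ereal_inf [set finsler_dist A q p | q in L].

(* w is the dual one-form of v; the tangent hyperplane at v to the level set
   of phi is the kernel of the differential of phi_p at v. *)
Definition dual_form p (v : 'rV[R]_n) (w : 'cV[R]_n) :=
  (v *m w) 0 0 = phi p v ^+ 2 /\
  forall z, 'D_z (phi p) v = 0 -> (z *m w) 0 0 = 0.

(* Euler-Lagrange equation of the energy phi^2, in every chart. *)
Definition geodesic (I : set R) (y : R -> N) :=
  smooth_into I y /\
  forall t c w, I t -> atlas S c -> cdom c (y t) ->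
    let L z := tangent_reading phi c z ^+ 2 in
    let x := cmap c \o y in
    is_derive t 1 (fun s => 'D_((0 : 'rV[R]_n), w) L (x s, derive1 x s))
                  ('D_(w, (0 : 'rV[R]_n)) L (x t, derive1 x t)).

Definition boundary_data M (g : N -> R) :=
  [/\ smooth_from (mboundary M) g,
      exists2 k : R, k < 1 & forall p q, mboundary M p -> mboundary M q ->
        p <> q -> (`|g p - g q|%:E < k%:E * finsler_dist M p q)%E &
      forall q, mboundary M q -> 0 < g q].

Definition viscosity_solution M (H : N -> 'cV[R]_n -> R) (g u : N -> R) :=
  [/\ {within M, continuous u},
      forall q, mboundary M q -> u q = g q,
      forall p U (f : N -> R), M° p -> open U -> U p -> smooth_from U f ->
        (\forall x \near p, u x - f x <= u p - f p) ->
        H p (differential f p) <= 1 &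
      forall p U (f : N -> R), M° p -> open U -> U p -> smooth_from U f ->
        (\forall x \near p, u p - f p <= u x - f x) ->
        1 <= H p (differential f p)].

(* Lax-Oleinik representation, which singles out the viscosity solution. *)
Definition value_function M (g u : N -> R) :=
  forall p, M p ->
    (u p)%:E =
    ereal_inf [set (finsler_dist M q p + (g q)%:E)%E | q in mboundary M].

(* Vectors tangent to the boundary are velocities of curves in it. A vector
   points into M when its coordinate transverse to the boundary is positive. *)
Definition characteristic_vector M (g : N -> R) p (v : 'rV[R]_n) :=
  [/\ phi p v = 1,
      exists2 w, dual_form p v w &
        forall y : R -> N, smooth_into `](-1 : R), 1[ y ->
          (forall t, -1 < t < 1 -> mboundary M (y t)) -> y 0 = p ->
          (velocity y 0 *m w) 0 0 = derive1 (g \o y) 0 &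
      forall c i, boundary_chart M p c i -> 0 < (v *m from_at p c) 0 i].

(* P q is the geodesic with initial velocity X q, continued backward;
   (q, t) |-> P q t is a diffeomorphism from mboundary M * ]-oo, 0[ onto the
   complement of M, with inverse (foot, time). *)
Definition backward_extension M (X : N -> 'rV[R]_n) (P : N -> R -> N) :=
  [/\ forall q, mboundary M q ->
        [/\ exists2 e : R, 0 < e & geodesic `]-oo, e[ (P q),
            P q 0 = q & velocity (P q) 0 = X q],
      forall c, atlas S c ->
        smooth_into
          [set z : 'rV[R]_n * R |
             (cmap c @` (cdom c `&` mboundary M)) z.1 /\ z.2 <= 0]
          (fun z => P (cinv c z.1) z.2) &
      exists (foot : N -> N) (time : N -> R),
        [/\ forall q (t : R), mboundary M q -> t < 0 ->
              [/\ ~ M (P q t), foot (P q t) = q & time (P q t) = t],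
            forall p, ~ M p ->
              [/\ mboundary M (foot p), time p < 0 & P (foot p) (time p) = p],
            forall c, atlas S c ->
              smooth_into (cmap c @` (cdom c `&` ~` M)) (foot \o cinv c) &
            smooth_from (~` M) time]].

Definition extended_solution M (g u : N -> R) (P : N -> R -> N)
    (ut : N -> R) :=
  (forall p, M p -> ut p = u p) /\
  (forall q (t : R), mboundary M q -> t < 0 -> ut (P q t) = g q + t).

End Metric.
End Tangent.

(* Main.v *)
Require Import Defs.
From mathcomp Require Import all_boot all_order all_algebra.
From mathcomp Require Import all_classical all_reals all_analysis.
From mathcomp Require Import measurable_realfun ring lra.

(** Both inequalities rest on the fact that the extended solution [ut] grows at
  rate at most [phi] along curves, with equality along the characteristics.

  Upper bound.  By conservation of energy the backward characteristics have
  unit speed, so the one issued from [q] reaches the level [0] after length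
  [g q]; following it up to [q] and then an almost minimizing curve of [M]
  gives [dist Lambda p <= g q + dist_M q p].

  Lower bound.  A piecewise smooth curve may cross the boundary infinitely
  often, and [ut] is not assumed to be differentiable across it, so the growth
  of [ut] along a curve [y] is controlled through right Dini derivatives.
  Outside [M] the first variation formula (Gauss lemma) shows that [d ut] is
  the dual form of the characteristic direction, because this holds on the
  boundary and the characteristics all have unit speed; the convexity of [phi]
  then gives [d ut (v) <= phi v].  From a point of [M] to a nearby point of
  [M], the Lax-Oleinik formula bounds the increment of [u] by the length of the
  straight segment in a half-space chart, which stays in [M].  Finally an
  excursion outside [M] is split at its last point in [M]. *)

Set Implicit Arguments.
Unset Strict Implicit.
Unset Printing Implicit Defensive.

Import Order.TTheory GRing.Theory Num.Theory.
Local Open Scope classical_set_scope.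
Local Open Scope ring_scope.

(** * Calculus *)

Section Generic.
Context {R : realType}.

(** The continuity of [ut] across the boundary is a step of its own. The hypotheses make [foot] and
    [time] smooth on the open complement of [M] and say nothing of their limits at the boundary: a
    priori, points outside [M] could converge to a boundary point [p] while their feet stay away
    from [p] or their times from [0]. This is excluded in [foot_time_near], by compactness of a rim
    around [(p, 0)] and connectedness of the outer half of a small chart ball. Continuity then
    allows the mean value theorem on an excursion closed up at its last point in [M].

    A second constraint is that [velocity] is a two-sided derivative, which at the end of a smooth
    piece also sees the next piece. Lengths are therefore compared through speeds on open intervals,
    and the growth bound is proved strictly inside a piece before being pushed to its ends by
    continuity.

    In the Gauss lemma the conserved quantity is [gauss_form]: the Euler-Lagrange equation turns its
    time derivative into the derivative of the energy across the family of characteristics. *)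

Lemma Ck_comp_affine (E1 E2 F : normedModType R) (a L : E1 -> E2) k
    (U : set E2) (f : E2 -> F) :
  (forall x h v, a (h *: v + x) = h *: L v + a x) ->
  (forall x, differentiable a x) ->
  Ck k U f -> Ck k (a @^-1` U) (f \o a).
Proof.
move=> aL da; elim: k U f => [|k IH] U f /=.
  move=> fc x Ux; apply: continuous_comp; last exact: fc.
  exact: differentiable_continuous.
move=> [df Df]; split=> [x Ux|v]; first by apply: differentiable_comp => //; exact: df.
suff -> : 'D_v (f \o a) = 'D_(L v) f \o a by exact: IH.
by apply/funext => x; rewrite /derive /=; under eq_fun do rewrite aL.
Qed.

Lemma CkS (E F : normedModType R) k (U V : set E) (f : E -> F) :
  V `<=` U -> Ck k U f -> Ck k V f.
Proof.
move=> VU; elim: k f => [|k IH] f /=; first by move=> h x /VU; exact: h.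
by move=> [df Df]; split=> [x /VU|v]; [exact: df|exact: IH].
Qed.

(** After subtraction of a small slope [e], the last time at which the tilted function is at most
    its initial value can be pushed further to the right by the Dini condition, unless it is [b].
    Continuity ensures that this supremum is attained. *)
Lemma dini_le (f : R -> R) (a b : R) : a <= b ->
  {within `[a, b], continuous f} ->
  (forall t e, a <= t < b -> 0 < e -> exists2 d, 0 < d &
     forall h, 0 < h < d -> t + h <= b -> f (t + h) <= f t + e * h) ->
  f b <= f a.
Proof.
move=> ab fc fD; apply/ler_addgt0Pr => e0 e0_gt0.
(* The [+ 1] keeps the denominator positive when [a = b]. *)
pose e := e0 / (b - a + 1).
have ba1 : 0 < b - a + 1 by lra.
have e_gt0 : 0 < e by rewrite divr_gt0.
suff : f b <= f a + e * (b - a).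
  have : e * (b - a) <= e0.
    rewrite /e mulrAC -mulrA; apply: ler_piMr; first exact: ltW.
    by rewrite ler_pdivrMr// mul1r; lra.
  lra.
pose g x := f x - e * (x - a).
have gc : {within `[a, b], continuous g}.
  move=> x; apply: cvgB; first exact: fc.
  apply: cvgM; first exact: cvg_cst.
  apply: cvgB; last exact: cvg_cst.
  by apply: continuous_subspaceT => z; exact: cvg_id.
suff : g b <= g a by rewrite /g subrr mulr0 subr0; lra.
pose A := [set t | a <= t <= b /\ g t <= g a].
have Aa : A a by split; rewrite ?lexx.
have Aub : ubound A b by move=> t [/andP[]].
have supA : has_sup A by split; [exists a|exists b].
pose s := sup A.
have as_ : a <= s by apply: sup_upper_bound.
have sb : s <= b by apply: sup_le_ub => //; exists a.
have As : A s.
  split; first by rewrite as_.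
  rewrite leNgt; apply/negP => gs.
  have sab : `[a, b]%classic s by rewrite /= in_itv /= as_ sb.
  have /subspace_continuousP/(_ s sab)/cvgr_gt/(_ _ gs) := gc.
  move=> [d /= d0 H].
  have [t At] := sup_adherent d0 supA; rewrite -/s => st.
  have ts : t <= s by apply: sup_upper_bound.
  have : g a < g t.
    have [/andP[? ?] _] := At.
    by apply: H; rewrite /= ?in_itv/= ?ger0_norm; [lra|lra|apply/andP].
  by have [_] := At; lra.
have [sb'|] := ltP s b; last first.
  by move=> bs; have -> : b = s; [lra|case: As].
have [|d d0 H] := fD s e _ e_gt0; first by rewrite as_ sb'.
pose h := Num.min (d / 2) (b - s).
have h0 : 0 < h by rewrite lt_min; apply/andP; split; lra.
have hd : h < d by rewrite gt_min; apply/orP; left; lra.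
have hb : h <= b - s by rewrite ge_min lexx orbT.
have fh : f (s + h) <= f s + e * h by apply: H; [rewrite h0|lra].
have : A (s + h).
  split; first by apply/andP; split; lra.
  by have [_] := As; rewrite /g; nra.
by move/(sup_upper_bound supA); rewrite -/s; lra.
Qed.


Lemma derivative0_eq (f : R -> R) (a b : R) : a <= b ->
  {within `[a, b], continuous f} ->
  (forall x, x \in `]a, b[ -> is_derive x 1 f 0) -> f a = f b.
Proof.
rewrite le_eqVlt => /predU1P[->//|ab] fc f0.
have [c _] := MVT ab f0 fc.
by rewrite mul0r => /eqP; rewrite subr_eq0 => /eqP.
Qed.

(** The rescaled push-forward of the Lebesgue measure agrees with it on half-open intervals, hence
    everywhere by uniqueness. The integrand is merely measurable because the speed of a curve may
    fail to be continuous at the ends of a piece. *)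
Lemma integral_affine (k c : R) (D : set R) (f : R -> \bar R) : 0 < k ->
  measurable D -> measurable_fun D f -> (forall x, D x -> 0 <= f x)%E ->
  (\int[lebesgue_measure]_(x in D) f x =
   k%:E * \int[lebesgue_measure]_(x in (fun x => k * x + c)%R @^-1` D) f (k * x + c)%R)%E.
Proof.
move=> k0 mD mf f0.
pose a := (fun x => k * x + c) : measurableTypeR R -> measurableTypeR R.
have ma : measurable_fun setT a.
  by apply: measurable_funD => //; exact: measurable_funM.
pose m := mscale (NngNum (ltW k0)) (pushforward (@lebesgue_measure R) a).
have mE A : measurable A -> m ma A = lebesgue_measure A.
  move=> mA; apply/esym/lebesgue_measure_unique => //= _ [[x y]] _ <-.
  have pre : a @^-1` `]x, y]%classic = `](x - c) / k, (y - c) / k]%classic.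
    apply/seteqP; split => z /=; rewrite !in_itv /= /a;
      by rewrite ltr_pdivrMr// ler_pdivlMr// ltrBlDr lerBrDr mulrC.
  transitivity (k%:E * (@lebesgue_measure R) (`]((x - c) / k)%R, ((y - c) / k)%R]%classic))%E; last by rewrite -pre.
  rewrite !lebesgue_measure_itv /= !lte_fin ltr_pM2r ?invr_gt0// ltrD2r.
  case: ifP => _; last by rewrite mule0.
  by rewrite -EFinB -EFinM; congr EFin; field; rewrite gt_eqF.
transitivity (\int[m ma]_(x in D) f x)%E.
  by apply: eq_measure_integral => A mA _; exact/esym/mE.
rewrite ge0_integral_mscale //=.
congr (_ * _)%E.
by apply: (ge0_integral_pushforward ma) => // x; rewrite inE; exact: f0.
Qed.

End Generic.

(** * Symmetry of second derivatives, and locality of smoothness *)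

Section Differential.
Context {R : realType}.

Lemma is_derive_line (E F : normedModType R) (f : E -> F) x u (s : R) df :
  is_derive (x + s *: u) u f df -> is_derive s 1 (fun s => f (x + s *: u)) df.
Proof.
move=> [fd fE].
have e : (fun h : R => h^-1 *: ((fun s => f (x + s *: u)) (h *: 1 + s) - f (x + s *: u)))
   = (fun h : R => h^-1 *: (f (h *: u + (x + s *: u)) - f (x + s *: u))).
  by apply/funext => h; rewrite scalerDl [h *: 1]mulr1 addrCA.
by apply: DeriveDef; rewrite /derivable /derive e.
Qed.

Lemma differentiable_line (E F : normedModType R) (f : E -> F) x u (s : R) :
  differentiable f (x + s *: u) ->
  is_derive s 1 (fun s => f (x + s *: u)) ('D_u f (x + s *: u)).
Proof. by move=> df; apply: is_derive_line; apply: derivableP; exact: diff_derivable. Qed.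

Lemma derive_linear (E F : normedModType R) (f : E -> F) x u v (a : R) :
  differentiable f x -> 'D_(u + a *: v) f x = 'D_u f x + a *: 'D_v f x.
Proof. by move=> df; rewrite !deriveE// linearD linearZ. Qed.

Lemma differentiable_eps (E F : normedModType R) (f : E -> F) x (e : R) :
  0 < e -> differentiable f x ->
  \forall w \near 0, `|f (x + w) - f x - 'd f x w| <= e * `|w|.
Proof.
move=> e0 /diff_locally /eqaddoP /(_ e e0); apply: filterS => w.
by rewrite /= -[X in `|X|]/(f (w + x) - (f x + 'd f x w)) opprD addrA [w + x]addrC.
Qed.

Lemma near_eq_differentiable (E F : normedModType R) (f g : E -> F) x :
  (\near x, f x = g x) -> differentiable f x -> differentiable g x.
Proof.
move=> fg df.
have [dc fE] := (diff_locallyP x f).1 df.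
have gE : g \o shift x = cst (g x) + 'd f x +o_ 0 id.
  apply/eqaddoP => e e0.
  have h1 := (eqaddoP _ _ _ _).1 fE e e0.
  have h2 : \forall w \near 0, f (w + x) = g (w + x).
    by move: fg; rewrite (near_shift 0) subr0.
  near=> w.
  rewrite /= -[X in `|X| <= _]/(g (w + x) - (g x + 'd f x w)).
  by rewrite -(nbhs_singleton fg) -(near h2 w) //; exact: (near h1 w).
apply/diff_locallyP; have -> : 'd g x = 'd f x :> (E -> F) by exact: diff_unique.
by [].
Unshelve. all: by end_near. Qed.

(* Both mixed derivatives are limits of [second_difference f x u v h / h ^ 2],
   which is symmetric in [u] and [v]. *)
Definition second_difference (E : normedModType R) (f : E -> R) x u v (h : R) :=
  f (x + h *: u + h *: v) - f (x + h *: u) - (f (x + h *: v) - f x).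

Lemma second_difference_sym (E : normedModType R) (f : E -> R) x u v h :
  second_difference f x u v h = second_difference f x v u h.
Proof.
rewrite /second_difference [x + h *: u + h *: v]addrAC.
by lra.
Qed.

(** The mean value theorem along [u] turns the second difference into [h] times an increment of
    ['D_u f], which the first order expansion of ['D_u f] at [x] evaluates. *)
Lemma second_difference_le (E : normedModType R) (f : E -> R) x u v (e : R) :
  0 < e -> (\forall y \near x, differentiable f y) ->
  differentiable ('D_u f) x ->
  \forall h \near 0^'+,
    `|second_difference f x u v h - h ^+ 2 * 'D_v ('D_u f) x| <= e * h ^+ 2.
Proof.
move=> e0 df ddf.
(* The displacements used below have norm at most [h * C - h]; the [+ 1] provides the margin [h]
   that puts them inside open balls. *)
pose C := `|u| + `|v| + 1.
have C0 : 0 < C by rewrite /C; have := normr_ge0 u; have := normr_ge0 v; lra.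
(* Two expansions are used, each with error at most [eta * (h * C)]; together they cost [e * h]. *)
pose eta := e / (2 * C).
have eta0 : 0 < eta by rewrite divr_gt0// mulr_gt0.
have [d1 /= d10 H1] := (nbhs_ballP _ _).1 df.
have [d2 /= d20 H2] := (nbhs_ballP _ _).1 (differentiable_eps eta0 ddf).
near=> h.
have h0 : 0 < h by near: h; exact: nbhs_right_gt.
have hC1 : h * C < d1.
  by rewrite -ltr_pdivlMr//; near: h; apply: nbhs_right_lt; rewrite divr_gt0.
have hC2 : h * C < d2.
  by rewrite -ltr_pdivlMr//; near: h; apply: nbhs_right_lt; rewrite divr_gt0.
have bnd (s t : R) : 0 <= s <= h -> 0 <= t <= h -> `|s *: u + t *: v| <= h * C - h.
  move=> /andP[s0 sh] /andP[t0 th]; apply: (le_trans (ler_normD _ _)).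
  rewrite !normrZ !ger0_norm// /C -[X in _ - X]mulr1 -mulrBr addrK mulrDr.
  by rewrite lerD// ler_wpM2r.
have fd (s t : R) : 0 <= s <= h -> 0 <= t <= h -> differentiable f (x + t *: v + s *: u).
  move=> hs ht; apply: H1; rewrite -ball_normE /= -addrA opprD addNKr normrN addrC.
  by apply: le_lt_trans (bnd _ _ hs ht) _; lra.
pose k s := f (x + h *: v + s *: u) - f (x + s *: u).
have hh : 0 <= h <= h by rewrite lexx ltW.
have h00 : (0 : R) <= 0 <= h by rewrite lexx ltW.
pose dk s := 'D_u f (x + h *: v + s *: u) - 'D_u f (x + s *: u).
have dkP s : 0 <= s <= h -> is_derive s 1 k (dk s).
  move=> hs; apply: is_deriveB; apply: is_derive_line; apply: derivableP; apply: diff_derivable.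
    exact: fd.
  by have := fd _ _ hs h00; rewrite scale0r addr0.
have dkP' s : s \in `]0, h[ -> is_derive s 1 k (dk s).
  by rewrite in_itv /= => /andP[/ltW ? /ltW ?]; apply: dkP; apply/andP.
have kc : {within `[0, h], continuous k}.
  apply: derivable_within_continuous => s; rewrite in_itv /= => hs.
  by have [] := dkP s hs.
have [c] := MVT h0 dkP' kc; rewrite in_itv /= subr0 => /andP[/ltW c0 /ltW ch] kE.
have hc : 0 <= c <= h by rewrite c0.
have -> : second_difference f x u v h = dk c * h.
  by rewrite -kE /k /second_difference scale0r !addr0 [x + h *: v + _]addrAC.
have Ec w : `|w| <= h * C - h -> `|'D_u f (x + w) - 'D_u f x - 'd ('D_u f) x w| <= eta * (h * C).
  move=> hw; apply: le_trans (H2 w _) _.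
    by rewrite -ball_normE /= sub0r normrN; lra.
  by rewrite ler_pM2l//; lra.
have E1 := Ec _ (bnd _ _ hc hh).
have E2 := Ec _ (bnd _ _ hc h00).
rewrite scale0r addr0 in E2.
rewrite deriveE//; set D := 'd ('D_u f) x v.
have -> : dk c * h - h ^+ 2 * D = h * (dk c - h * D) by ring.
rewrite normrM [`|h|]gtr0_norm// expr2 mulrCA ler_pM2l//.
rewrite linearD [X in _ - (_ + X)]linearZ /= in E1.
have -> : dk c - h * D = ('D_u f (x + (c *: u + h *: v)) - 'D_u f x - ('d ('D_u f) x (c *: u) + h *: D)) - ('D_u f (x + c *: u) - 'D_u f x - 'd ('D_u f) x (c *: u)).
  have e1 : x + h *: v + c *: u = x + (c *: u + h *: v).
    by rewrite -addrA [h *: v + _]addrC.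
  rewrite /dk e1 -[h *: D]/(h * D); ring.
apply: le_trans (ler_normB _ _) _; apply: le_trans (lerD E1 E2) _.
by rewrite -mulr2n -mulr_natl /eta le_eqVlt; apply/orP; left; apply/eqP; field; lra.
Unshelve. all: by end_near. Qed.

Lemma schwarz (E : normedModType R) (f : E -> R) x u v :
  (\forall y \near x, differentiable f y) ->
  differentiable ('D_u f) x -> differentiable ('D_v f) x ->
  'D_v ('D_u f) x = 'D_u ('D_v f) x.
Proof.
move=> df du dv; apply/eqP; rewrite -subr_eq0 -normr_le0; apply/ler_addgt0Pr => e e0.
have e2 : 0 < e / 2 by rewrite divr_gt0.
have n1 := second_difference_le v e2 df du.
have n2 := second_difference_le u e2 df dv.
have [h [[h0 H1] H2]] := filter_ex (filterI (filterI (nbhs_right_gt 0) n1) n2).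
rewrite second_difference_sym in H1.
have h2 : 0 < h ^+ 2 by rewrite exprn_gt0.
rewrite add0r -(ler_pM2l h2) -[X in X * `|_|]gtr0_norm// -normrM mulrBr.
move: ('D_v ('D_u f) x) ('D_u ('D_v f) x) H1 H2 => A B.
move: (second_difference _ _ _ _ _) => S.
rewrite !ler_norml => /andP[? ?] /andP[? ?]; apply/andP; split; lra.
Qed.

Lemma schwarz_rV (E : normedModType R) n (f : E -> 'rV[R]_n) x u v :
  (\forall y \near x, differentiable f y) ->
  differentiable ('D_u f) x -> differentiable ('D_v f) x ->
  'D_v ('D_u f) x = 'D_u ('D_v f) x.
Proof.
move=> df du dv; apply/rowP => j.
have coord w y : differentiable f y -> 'D_w f y 0 j = 'D_w (fun z => f z 0 j) y.
  by move=> dfy; rewrite derive_mx ?mxE//; exact: diff_derivable.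
have coord2 w w' : differentiable ('D_w f) x ->
    'D_w' ('D_w f) x 0 j = 'D_w' ('D_w (fun z => f z 0 j)) x.
  move=> dw; rewrite derive_mx ?mxE//; last exact: diff_derivable.
  by apply: near_eq_derive; near do apply: coord.
have dcoord w : differentiable ('D_w f) x -> differentiable ('D_w (fun z => f z 0 j)) x.
  move=> dw; apply: (@near_eq_differentiable _ _ (fun y => 'D_w f y 0 j)).
    by near do apply: coord.
  apply: (@differentiable_comp _ _ _ _ _ (fun M : 'rV[R]_n => M 0 j)) => //.
  exact: differentiable_coord.
apply: (etrans (coord2 _ _ du)); apply: (etrans _ (esym (coord2 _ _ dv))).
apply: (schwarz _ (dcoord _ du) (dcoord _ dv)).
near=> y; apply: (@differentiable_comp _ _ _ _ f (fun M : 'rV[R]_n => M 0 j)).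
  by near: y.
exact: differentiable_coord.
Unshelve. all: by end_near. Qed.

(** The extensions given by [smooth_on] are local and vary with the point. Since directional
    derivatives depend on germs only, they may nevertheless be used one point at a time. *)
Lemma local_Ck (E F : normedModType R) k (A : set E) (f : E -> F) :
  (forall x, A x -> exists (U : set E) (G : E -> F),
     [/\ open U, U x, Ck k U G & {in U, G =1 f}]) ->
  Ck k A f.
Proof.
elim: k f => [|k IH] f H /=.
  move=> x /H[U [G [oU Ux Gc GE]]].
  have nfg : \forall z \near x, G z = f z.
    by near=> z; apply: GE; rewrite inE; near: z; exact: open_nbhs_nbhs.
  have Gx : G @ x --> G x := Gc _ Ux; rewrite (nbhs_singleton nfg) in Gx.
  by apply: cvg_trans Gx; exact: near_eq_cvg.
split=> [x /H[U [G [oU Ux [dG _] GE]]]|v].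
  apply: near_eq_differentiable (dG _ Ux).
  by near=> z; apply: GE; rewrite inE; near: z; exact: open_nbhs_nbhs.
apply: IH => x /H[U [G [oU Ux [_ DG] GE]]]; exists U, ('D_v G).
split; [by []|by []|exact: DG|move=> y]; rewrite inE => Uy; apply: near_eq_derive.
by near=> z; apply: GE; rewrite inE; near: z; exact: open_nbhs_nbhs.
Unshelve. all: by end_near. Qed.

Lemma smooth_on_Ck (E F : normedModType R) k (A : set E) (f : E -> F) :
  open A -> smooth_on A f -> Ck k A f.
Proof.
move=> oA sf; apply: local_Ck => x Ax; have [U [G [oU Ux Gk GE]]] := sf _ Ax.
exists (U `&` A), G; split; [exact: openI|by []| |].
  by apply: CkS (Gk k); exact: subIsetl.
by move=> y; rewrite inE => -[Uy Ay]; exact: GE.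
Qed.

End Differential.

(** * Minkowski norms *)

Section MinkowskiNorm.
Context {R : realType} {n : nat}.
Variable F : 'rV[R]_n -> R.
Hypothesis F_gt0 : forall v, v != 0 -> 0 < F v.
Hypothesis FZ : forall v (s : R), 0 <= s -> F (s *: v) = s * F v.
Hypothesis F_hess : forall v w, v != 0 -> w != 0 ->
  0 < 'D_w ('D_w (fun x => F x ^+ 2)) v.
Hypothesis F_smooth : forall k, Ck k [set v | v != 0] F.

Let F2 := fun x => F x ^+ 2.

Let F2E : F2 = F ^+ 2. Proof. by rewrite exprfctE. Qed.

Lemma minkowski0 : F 0 = 0.
Proof. by rewrite -(scale0r 0) FZ// mul0r. Qed.

Lemma minkowski_ge0 v : 0 <= F v.
Proof. by have [->|/F_gt0/ltW//] := eqVneq v 0; rewrite minkowski0. Qed.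

Lemma minkowski_differentiable v : v != 0 -> differentiable F v.
Proof. by move=> v0; have [+ _] := F_smooth 1; exact. Qed.

Let dF2 v : v != 0 -> differentiable F2 v.
Proof. by move=> v0; rewrite F2E; apply: differentiableX; exact: minkowski_differentiable. Qed.

Let DF2 v w : v != 0 -> 'D_w F2 v = 2 * F v * 'D_w F v.
Proof.
move=> v0; rewrite F2E deriveX; first by rewrite expr1.
by apply: diff_derivable; exact: minkowski_differentiable.
Qed.

Let neq0_open : open [set v : 'rV[R]_n | v != 0].
Proof.
rewrite (_ : [set v | _] = ~` [set 0]); last by apply/seteqP; split=> v /= /eqP.
apply: closed_openC; apply: accessible_closed_set1.
exact/hausdorff_accessible/norm_hausdorff.
Qed.

Let dDF2 v w : v != 0 -> differentiable ('D_w F2) v.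
Proof.
move=> v0; have [_ /(_ w)[dDF _]] := F_smooth 2.
apply: (@near_eq_differentiable _ _ _ (2 *: (F * 'D_w F))).
  near=> z; rewrite DF2; last by near: z; exact: open_nbhs_nbhs.
  by rewrite -mulrA.
apply: differentiableZ; apply: differentiableM; last exact: dDF.
exact: minkowski_differentiable.
Unshelve. all: by end_near. Qed.

(** The functions [F (s *: v)] and [s * F v] of [s] agree near [s = 1], so their derivatives there
    are equal. *)
Lemma minkowski_euler v : v != 0 -> 'D_v F v = F v.
Proof.
move=> v0.
have Fv : is_derive (0 + 1 *: v) v F ('D_v F v).
  rewrite add0r scale1r; apply: derivableP; apply: diff_derivable.
  exact: minkowski_differentiable.
have [_ <-] := is_derive_line Fv.
have [_ <-] : is_derive (1 : R) (1 : R) (fun s : R => 0 + s *: F v) (F v).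
  exact: (@is_derive_line _ _ _ id 0 (F v) 1 (F v)).
apply: near_eq_derive; near=> s.
rewrite !add0r FZ//; apply: ltW; near: s; exact: lt_nbhsr.
Unshelve. all: by end_near. Qed.

(** Gradient inequality for [F ^ 2], from two uses of the mean value theorem and the positivity of
    the Hessian. The segment must avoid the origin, where the hypotheses give no derivatives. *)
Let F2_segment v w : (forall s, 0 <= s <= 1 -> v + s *: w != 0) -> w != 0 ->
  F2 v + 'D_w F2 v <= F2 (v + w).
Proof.
move=> vw w0.
have v_neq0 : v != 0 by have := vw 0; rewrite scale0r addr0; apply; rewrite lexx ler01.
have vwo s : s \in `]0, 1[ -> v + s *: w != 0.
  by rewrite in_itv /= => /andP[? ?]; apply: vw; rewrite !ltW.
have d1 (s : R) : 0 <= s <= 1 -> is_derive s 1 (fun s => F2 (v + s *: w)) ('D_w F2 (v + s *: w)).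
  by move=> s01; exact: (differentiable_line (dF2 (vw s s01))).
have d2 (s : R) : 0 <= s <= 1 -> is_derive s 1 (fun s => 'D_w F2 (v + s *: w)) ('D_w ('D_w F2) (v + s *: w)).
  by move=> s01; exact: (differentiable_line (dDF2 w (vw s s01))).
have d1' (s : R) : s \in `]0, 1[ -> is_derive s 1 (fun s => F2 (v + s *: w)) ('D_w F2 (v + s *: w)).
  by rewrite in_itv /= => /andP[? ?]; apply: d1; rewrite !ltW.
have c1 : {within `[0, 1], continuous (fun s : R => F2 (v + s *: w))}.
  by apply: derivable_within_continuous => s; rewrite in_itv /= => /d1[].
have [c c01 cE] := MVT ltr01 d1' c1.
have /andP[c0 c_lt1] : 0 < c < 1 by move: c01; rewrite in_itv.
have d2' (s : R) : s \in `]0, c[ -> is_derive s 1 (fun s => 'D_w F2 (v + s *: w)) ('D_w ('D_w F2) (v + s *: w)).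
  by rewrite in_itv /= => /andP[? ?]; apply: d2; apply/andP; split; lra.
have c2 : {within `[0, c], continuous (fun s : R => 'D_w F2 (v + s *: w))}.
  apply: derivable_within_continuous => s; rewrite in_itv /= => /andP[? ?].
  by have /d2[] : 0 <= s <= 1 by apply/andP; split; lra.
have [e e01 eE] := MVT c0 d2' c2.
have He : 0 < 'D_w ('D_w F2) (v + e *: w).
  apply: F_hess => //; apply: vw; move: e01; rewrite in_itv /= => /andP[? ?].
  by apply/andP; split; lra.
move: cE eE; rewrite !scale0r !addr0 scale1r.
move: ('D_w ('D_w F2) _) He ('D_w F2 (v + c *: w)) => A A0 B; nra.
Qed.

(** Rescale [z] to [l *: z] on the level of [v]: the gradient inequality for [F ^ 2] then shows that
    the derivative of [F] at [v] in the direction [l *: z - v] is nonpositive, and Euler's identity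
    gives its part along [v]. *)
Lemma minkowski_derive_le v z : v != 0 -> 'D_z F v <= F z.
Proof.
move=> v0; have dF := minkowski_differentiable v0.
have [->|z0] := eqVneq z 0; first by rewrite derive0 minkowski0.
have Fv := F_gt0 v0; have Fz := F_gt0 z0.
pose l := F v / F z; have l0 : 0 < l by rewrite divr_gt0.
have Flz : F (l *: z) = F v by rewrite FZ ?ltW// /l divfK// gt_eqF.
have DZ (a : R) y : 'D_(a *: y) F v = a * 'D_y F v by rewrite !deriveE// linearZ.
have DD x y : 'D_(x + y) F v = 'D_x F v + 'D_y F v by rewrite !deriveE// linearD.
suff : 'D_(l *: z) F v <= F v.
  by rewrite DZ -[leRHS]Flz FZ ?(ltW l0)// ler_pM2l.
(* If the segment from [v] to [l *: z] meets the origin, then [l *: z] is a nonpositive multiple of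
   [v], and Euler's identity gives the sign directly. *)
have [[s /andP[s0 s1] sE]|nz] := pselect (exists2 s, 0 <= s <= 1 & v + s *: (l *: z - v) = 0).
  have s_neq0 : s != 0.
    by apply: contra_eqN sE => /eqP ->; rewrite scale0r addr0.
  have -> : l *: z = - ((1 - s) / s) *: v.
    apply: (scalerI s_neq0); rewrite [RHS]scalerA.
    have -> : s * - ((1 - s) / s) = s - 1 by field.
    move/eqP: sE; rewrite scalerBr addrCA addr_eq0 => /eqP ->.
    by rewrite opprB scalerBl scale1r.
  rewrite DZ minkowski_euler// mulNr; apply: (@le_trans _ _ 0); last exact: ltW.
  rewrite oppr_le0; apply: mulr_ge0; last exact: ltW.
  by apply: divr_ge0 => //; rewrite subr_ge0.
have [e|w0] := eqVneq (l *: z - v) 0.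
  by move/eqP: e; rewrite subr_eq0 => /eqP ->; rewrite minkowski_euler.
have vw : v + (l *: z - v) = l *: z by rewrite addrC subrK.
have H : F v ^+ 2 + 2 * F v * 'D_(l *: z - v) F v <= F v ^+ 2.
  rewrite -[leRHS](congr1 (fun r => r ^+ 2) Flz) -[in leRHS]vw -DF2//.
  by apply: F2_segment => // s s01; apply/eqP => sE; apply: nz; exists s.
rewrite -[in leLHS]vw DD minkowski_euler//; nra.
Qed.

(** Euler's identity at [v + w] splits by linearity of the differential into derivatives along [v]
    and [w], each bounded by the previous lemma. *)
Lemma minkowski_triangle v w : F (v + w) <= F v + F w.
Proof.
have [->|vw] := eqVneq (v + w) 0; first by rewrite minkowski0 addr_ge0 ?minkowski_ge0.
have dF := minkowski_differentiable vw.
rewrite -[X in X <= _]minkowski_euler// deriveE// linearD -!deriveE//.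
by rewrite lerD ?minkowski_derive_le.
Qed.

End MinkowskiNorm.

(** * Charts and the Finsler metric *)

Section Charts.
Context {R : realType} {n : nat} {N : topologicalType}.
Implicit Types (c : chart R n N) (p : N) (x : 'rV[R]_n) (A : set N).

Definition cimg c : set 'rV[R]_n := cmap c @` cdom c.

Lemma cdom_open c : open (cdom c). Proof. by case: c. Qed.

Lemma cimg_open c : open (cimg c). Proof. by case: c. Qed.

Lemma cmapK c p : cdom c p -> cinv c (cmap c p) = p.
Proof. by case: c p => /= *; auto. Qed.

Lemma cmap_continuous c p : cdom c p -> {for p, continuous (cmap c)}.
Proof. by case: c p => /= *; auto. Qed.

Lemma cinv_continuous c x : cimg c x -> {for x, continuous (cinv c)}.
Proof. by case: c x => /= *; auto. Qed.

Lemma cimg_cmap c p : cdom c p -> cimg c (cmap c p).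
Proof. by exists p. Qed.

Lemma cdom_cinv c x : cimg c x -> cdom c (cinv c x).
Proof. by move=> [p cp <-]; rewrite cmapK. Qed.

Lemma cinvK c x : cimg c x -> cmap c (cinv c x) = x.
Proof. by move=> [p cp <-]; rewrite cmapK. Qed.

Lemma near_cdom c p : cdom c p -> \forall q \near p, cdom c q.
Proof. by move=> cp; apply: open_nbhs_nbhs; split=> //; exact: cdom_open. Qed.

Lemma near_cimg c x : cimg c x -> \forall z \near x, cimg c z.
Proof. by move=> cx; apply: open_nbhs_nbhs; split=> //; exact: cimg_open. Qed.

Lemma image_cdomI c A :
  cmap c @` (cdom c `&` A) = [set x | cimg c x /\ A (cinv c x)].
Proof.
apply/seteqP; split=> [_ [p [cp Ap] <-]|x [cx Ax]] /=.
  by split; [exact: cimg_cmap|rewrite cmapK].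
by exists (cinv c x); [split=> //; exact: cdom_cinv|exact: cinvK].
Qed.

Lemma image_cdomI_open c A : open A -> open (cmap c @` (cdom c `&` A)).
Proof.
move=> oA; rewrite image_cdomI openE => x [cx Ax].
apply: filterI; first exact: near_cimg.
by apply: (cinv_continuous cx); exact: open_nbhs_nbhs.
Qed.

End Charts.

Section Smooth.
Context {R : realType}.

Lemma derive1_comp_rV (E F : normedModType R) (f : R -> E) (h : E -> F) t :
  derivable f t 1 -> differentiable h (f t) ->
  is_derive t 1 (h \o f) ('D_(derive1 f t) h (f t)).
Proof.
move=> df dh; have dft := (derivable1_diffP _ _).1 df.
have dhf : differentiable (h \o f) t by exact: differentiable_comp.
apply: DeriveDef; first exact: diff_derivable.
by rewrite deriveE// diff_comp//= -deriveE// -[X in _ = 'D_X _ _]/(f^`()%classic t) derive1E -deriveE.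
Qed.

Lemma cvg_to_pair (T : Type) (E F : normedModType R) (G : set_system T) (f : T -> E)
    (h : T -> F) (l : E) (m : F) : Filter G -> f @ G --> l -> h @ G --> m ->
  (fun x => (f x, h x)) @ G --> ((l, m) : (E * F)%type).
Proof. by move=> FG fl hm; exact: (@cvg_pair _ _ _ G (nbhs l) (nbhs m) FG _ _ f h fl hm). Qed.

End Smooth.

Section Structure.
Context {R : realType} {n : nat} {N : topologicalType}.
Variable S : smooth_structure R n N.
Implicit Types (c : chart R n N) (p : N) (x v : 'rV[R]_n) (A : set N).

Lemma atlas_chart_at p : atlas S (chart_at S p).
Proof. by case: S p => ? k /= H _ _ p; case: (H p). Qed.

Lemma cdom_chart_at p : cdom (chart_at S p) p.
Proof. by case: S p => ? k /= H _ _ p; case: (H p). Qed.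

Lemma transition_smooth c c' : atlas S c -> atlas S c' -> smooth_transition c c'.
Proof. by case: S => ? ? /= _ H _; exact: H. Qed.

Lemma transition_Ck k c c' : atlas S c -> atlas S c' ->
  Ck k (cmap c @` (cdom c `&` cdom c')) (cmap c' \o cinv c).
Proof.
move=> ac ac'; apply: smooth_on_Ck; last exact: transition_smooth.
by apply: image_cdomI_open; exact: cdom_open.
Qed.

Lemma transition_differentiable c c' p : atlas S c -> atlas S c' ->
  cdom c p -> cdom c' p -> differentiable (cmap c' \o cinv c) (cmap c p).
Proof.
move=> ac ac' cp c'p; have [+ _] := transition_Ck 1 ac ac'; apply.
by exists p.
Qed.

Lemma mul_to_at p c v : atlas S c -> cdom c p ->
  v *m to_at S p c = 'D_v (cmap (chart_at S p) \o cinv c) (cmap c p).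
Proof.
move=> ac cp; rewrite /to_at deriveEjacobian//.
by apply: transition_differentiable => //; [exact: atlas_chart_at|exact: cdom_chart_at].
Qed.

Lemma to_at_chart_at p v : v *m to_at S p (chart_at S p) = v.
Proof.
rewrite mul_to_at; [|exact: atlas_chart_at|exact: cdom_chart_at].
rewrite -[RHS](derive_id (cmap (chart_at S p) p)); apply: near_eq_derive.
near=> x; apply: cinvK; near: x; apply: near_cimg; apply: cimg_cmap.
exact: cdom_chart_at.
Unshelve. all: by end_near. Qed.

Lemma derivable_chart c c' (y : R -> N) t : atlas S c -> atlas S c' ->
  cdom c (y t) -> cdom c' (y t) -> {for t, continuous y} ->
  derivable (cmap c \o y) t 1 ->
  is_derive t 1 (cmap c' \o y)
    ('D_(derive1 (cmap c \o y) t) (cmap c' \o cinv c) (cmap c (y t))).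
Proof.
move=> ac ac' ct c't yc dy.
apply: (near_eq_is_derive _ (derive1_comp_rV dy (transition_differentiable ac ac' ct c't))).
near=> s; rewrite /= cmapK//; near: s; apply: yc; exact: near_cdom.
Unshelve. all: by end_near. Qed.

Lemma velocity_chart c (y : R -> N) t : atlas S c ->
  cdom c (y t) -> {for t, continuous y} -> derivable (cmap c \o y) t 1 ->
  velocity S y t = derive1 (cmap c \o y) t *m to_at S (y t) c.
Proof.
move=> ac ct yc dy; apply: (etrans _ (esym (mul_to_at _ ac ct))).
have [_ <-] := derivable_chart ac (atlas_chart_at (y t)) ct (cdom_chart_at (y t)) yc dy.
by rewrite /velocity derive1E.
Qed.

Section Finsler.
Variable phi : N -> 'rV[R]_n -> R.
Hypothesis phi_finsler : finsler_metric S phi.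

Lemma finsler_gt0 p v : v != 0 -> 0 < phi p v.
Proof. by case: phi_finsler => _ + _ _; exact. Qed.

Lemma finslerZ p v (s : R) : 0 <= s -> phi p (s *: v) = s * phi p v.
Proof. by case: phi_finsler => _ _ + _; exact. Qed.

Lemma tangent_reading_open c :
  open [set z : 'rV[R]_n * 'rV[R]_n | cimg c z.1 /\ z.2 != 0].
Proof.
rewrite (_ : [set z | _] = (fst @^-1` cimg c) `&` (snd @^-1` ~` [set 0])); last first.
  by apply/seteqP; split=> -[x v] /= [cx v0]; split=> //; exact/eqP.
apply: openI.
  by apply: open_comp; [move=> *; exact: cvg_fst|exact: cimg_open].
apply: open_comp; first by move=> *; exact: cvg_snd.
apply: closed_openC; apply: accessible_closed_set1.
exact/hausdorff_accessible/norm_hausdorff.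
Qed.

Lemma tangent_reading_Ck k c : atlas S c ->
  Ck k [set z : 'rV[R]_n * 'rV[R]_n | cimg c z.1 /\ z.2 != 0]
    (tangent_reading S phi c).
Proof.
move=> ac; apply: smooth_on_Ck; first exact: tangent_reading_open.
by case: phi_finsler => + _ _ _; exact.
Qed.

Lemma tangent_reading_chart_at p v :
  tangent_reading S phi (chart_at S p) (cmap (chart_at S p) p, v) = phi p v.
Proof.
by rewrite /tangent_reading /= cmapK ?to_at_chart_at//; exact: cdom_chart_at.
Qed.

Lemma finsler_Ck p k : Ck k [set v | v != 0] (phi p).
Proof.
set c := chart_at S p; set x := cmap c p.
have -> : phi p = tangent_reading S phi c \o (fun v => (x, v)).
  by apply/funext => v /=; rewrite tangent_reading_chart_at.
have -> : [set v | v != 0] = (fun v : 'rV[R]_n => (x, v)) @^-1`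
    [set z : 'rV[R]_n * 'rV[R]_n | cimg c z.1 /\ z.2 != 0].
  apply/seteqP; split=> v /=; last by case.
  by split=> //; apply: cimg_cmap; exact: cdom_chart_at.
apply: (@Ck_comp_affine _ _ _ _ _ (fun v => (0, v))).
- by move=> v h w; rewrite -[RHS]/(h *: 0 + x, h *: w + v) scaler0 add0r.
- move=> v; apply: differentiable_pair; [exact: differentiable_cst|].
  by apply: ex_diff.
- by apply: tangent_reading_Ck; exact: atlas_chart_at.
Qed.

Lemma finsler0 p : phi p 0 = 0.
Proof. by rewrite -(scale0r 0) finslerZ// mul0r. Qed.

Lemma finsler_ge0 p v : 0 <= phi p v.
Proof. by have [->|/finsler_gt0 //] := eqVneq v 0; [rewrite finsler0|move=> h; exact/ltW/h]. Qed.

Lemma finsler_differentiable p v : v != 0 -> differentiable (phi p) v.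
Proof. by move=> v0; have [+ _] := finsler_Ck p 1; exact. Qed.

Let hess p v w : v != 0 -> w != 0 -> 0 < 'D_w ('D_w (fun x => phi p x ^+ 2)) v.
Proof. by case: phi_finsler => _ _ _; exact. Qed.

Lemma finsler_euler p v : v != 0 -> 'D_v (phi p) v = phi p v.
Proof.
exact: (minkowski_euler (@finslerZ p) (finsler_Ck p)).
Qed.

Lemma finsler_derive_le p v z : v != 0 -> 'D_z (phi p) v <= phi p z.
Proof.
exact: (minkowski_derive_le (@finsler_gt0 p) (@finslerZ p) (@hess p) (finsler_Ck p)).
Qed.

Lemma finsler_triangle p v w : phi p (v + w) <= phi p v + phi p w.
Proof.
exact: (minkowski_triangle (@finsler_gt0 p) (@finslerZ p) (@hess p) (finsler_Ck p)).
Qed.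

Local Notation TR := (tangent_reading S phi).

Lemma tangent_reading_ge0 c z : 0 <= TR c z.
Proof. exact: finsler_ge0. Qed.

Lemma tangent_readingZ c x v (s : R) : 0 <= s -> TR c (x, s *: v) = s * TR c (x, v).
Proof. by move=> s0; rewrite /tangent_reading /= -scalemxAl finslerZ. Qed.

Lemma tangent_readingD c x v w : TR c (x, v + w) <= TR c (x, v) + TR c (x, w).
Proof. by rewrite /tangent_reading /= mulmxDl finsler_triangle. Qed.

Lemma tangent_reading0 c x : TR c (x, 0) = 0.
Proof. by rewrite /tangent_reading /= mul0mx finsler0. Qed.

Lemma tangent_reading_sum c x (I : Type) (r : seq I) (f : I -> 'rV[R]_n) :
  TR c (x, \sum_(i <- r) f i) <= \sum_(i <- r) TR c (x, f i).
Proof.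
elim/big_rec2: _ => [|i b v _ IH]; first by rewrite tangent_reading0.
by apply: le_trans (tangent_readingD _ _ _ _) _; rewrite lerD2l.
Qed.

(** Both signs of each basis vector enter because [phi] is only positively homogeneous. *)
Let bound c x := \sum_i (TR c (x, delta_mx 0 i) + TR c (x, - delta_mx 0 i)).

Let le_bound c x v : TR c (x, v) <= `|v| * bound c x.
Proof.
rewrite {1}[v]row_sum_delta; apply: le_trans (tangent_reading_sum _ _ _ _) _.
rewrite mulr_sumr; apply: ler_sum => i _.
have vi : `|v 0 i| <= `|v|.
  by rewrite [leRHS]/Num.Def.normr/= mx_normrE; exact: (le_bigmax _ (fun ij => `|v ij.1 ij.2|) (0, i)).
have [vi0|vi0] := leP 0 (v 0 i).
  rewrite tangent_readingZ// mulrDr.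
  rewrite -[X in X <= _]addr0; apply: lerD; last exact: mulr_ge0 (normr_ge0 _) (tangent_reading_ge0 _ _).
  by rewrite ler_wpM2r ?tangent_reading_ge0// (le_trans _ vi)// ler_norm.
rewrite -[v 0 i]opprK scaleNr -scalerN tangent_readingZ; last by rewrite oppr_ge0 ltW.
rewrite mulrDr -[X in X <= _]add0r; apply: lerD; first exact: mulr_ge0 (normr_ge0 _) (tangent_reading_ge0 _ _).
by rewrite ler_wpM2r ?tangent_reading_ge0// (le_trans _ vi)// -normrN ler_norm.
Qed.

Let delta_neq0 (i : 'I_n) : (delta_mx 0 i : 'rV[R]_n) != 0.
Proof.
apply/eqP => /rowP /(_ i); rewrite !mxE !eqxx /= => /eqP.
by rewrite oner_eq0.
Qed.

(** Controls the metric near zero vectors, where it is not assumed smooth. The bound is a sum of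
    readings at nonzero vectors, hence continuous in the base point. *)
Lemma tangent_reading_bound c x : atlas S c -> cimg c x ->
  exists C : R, \forall z \near x, forall v, TR c (z, v) <= C * `|v|.
Proof.
move=> ac cx; exists (bound c x + 1).
have bc : bound c @ x --> bound c x.
  have cts w : w != 0 -> (fun z => TR c (z, w)) @ x --> TR c (x, w).
    move=> w0; apply: (@cvg_comp _ _ _ (fun z : 'rV[R]_n => (z, w)) (TR c) _ (nbhs (x, w))).
      have cid : (fun z : 'rV[R]_n => z) @ x --> x by exact: cvg_id.
      have cc : (fun z : 'rV[R]_n => w) @ x --> w by exact: (@cvg_cst _ w _ (nbhs x)).
      exact: (cvg_to_pair _ cid cc).
    by have := @tangent_reading_Ck 0 c ac (x, w); apply.
  apply: (cvg_big (F := nbhs x) add_continuous) => i _.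
  by apply: (cvgD (F := nbhs x)); apply: cts; rewrite ?oppr_eq0.
near=> z => v; rewrite mulrC; apply: le_trans (le_bound _ _ _) _.
apply: ler_wpM2l => //; apply: ltW; near: z.
by move/cvgr_lt : bc; apply; rewrite ltrDl.
Unshelve. all: by end_near. Qed.

Lemma tangent_reading_continuous c z : atlas S c -> cimg c z.1 ->
  {for z, continuous (TR c)}.
Proof.
move=> ac cz; have [z20|z20] := eqVneq z.2 0; last first.
  by have := @tangent_reading_Ck 0 c ac z; apply.
have [C HC] := tangent_reading_bound ac cz.
have f1 : fst @ z --> z.1 by exact: (@cvg_fst _ _ (nbhs z.1) (nbhs z.2)).
have HC' : \forall w \near z, forall v, TR c (w.1, v) <= C * `|v| := f1 _ HC.
have TRz : TR c z = 0 by rewrite (surjective_pairing z) z20 tangent_reading0.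
apply/cvgrPdist_lt => e e0; rewrite TRz.
(* Nothing is known of the sign of [C], hence the absolute value; the [+ 1] keeps the denominator
   positive. *)
pose d := e / (`|C| + 1).
have d0 : 0 < d by rewrite divr_gt0// ltr_wpDl.
near=> w; rewrite sub0r normrN ger0_norm ?tangent_reading_ge0//.
rewrite (surjective_pairing w).
have w1 : TR c (w.1, w.2) <= C * `|w.2|.
  by have := near HC' w; apply.
apply: le_lt_trans w1 _; apply: (@le_lt_trans _ _ ((`|C| + 1) * `|w.2|)).
  by apply: ler_wpM2r => //; rewrite (le_trans (ler_norm _))// lerDl.
rewrite mulrC -ltr_pdivlMr ?ltr_wpDl// -/d.
near: w; have /cvgr0Pnorm_lt : snd @ z --> (0 : 'rV[R]_n) by rewrite -z20; exact: cvg_snd.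
exact.
Unshelve. all: by end_near. Qed.

End Finsler.
End Structure.

(** * Length and distance *)

Section SmoothInto.
Context {R : realType} {n : nat} {N : topologicalType}.
Variable S : smooth_structure R n N.
Implicit Types (c : chart R n N).

Lemma smooth_into_continuous (E : normedModType R) (A : set E) (f : E -> N) x :
  smooth_into S A f -> A° x -> {for x, continuous f}.
Proof.
move=> [/subspace_continuousP fc _] Ax.
by have := fc x (nbhs_singleton Ax); rewrite (within_interior Ax).
Qed.

Lemma smooth_into_open (E : normedModType R) (A : set E) (f : E -> N) c :
  smooth_into S A f -> open (A° `&` f @^-1` cdom c).
Proof.
move=> sf; rewrite openE => x [Ax cx]; apply: filterI.
  exact: open_nbhs_nbhs (conj (open_interior A) Ax).
exact: smooth_into_continuous sf Ax _ (near_cdom cx).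
Qed.

Lemma smooth_into_Ck (E : normedModType R) k (A : set E) (f : E -> N) c :
  smooth_into S A f -> atlas S c ->
  Ck k (A° `&` f @^-1` cdom c) (cmap c \o f).
Proof.
move=> sf ac; apply: local_Ck => x [Ax cx].
have [_ /(_ c ac x)[]] := sf; first by split=> //; exact: nbhs_singleton.
move=> U [G [oU Ux Gk GE]]; exists (U `&` (A° `&` f @^-1` cdom c)), G; split.
- by apply: openI => //; exact: smooth_into_open.
- by [].
- by apply: CkS (Gk k); exact: subIsetl.
- by move=> z; rewrite inE => -[Uz [Az cz]]; apply: GE => //; split=> //; exact: nbhs_singleton.
Qed.

Lemma eq_smooth_into (E : normedModType R) (A : set E) (f g : E -> N) :
  {in A, f =1 g} -> smooth_into S A f -> smooth_into S A g.
Proof.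
move=> fg [/subspace_continuousP fc fs]; split.
  apply/subspace_continuousP => x Ax.
  have e : g x = f x by rewrite fg ?inE.
  suff : g @ within A (nbhs x) --> f x by rewrite -e; exact.
  apply: cvg_trans (fc x Ax); apply: near_eq_cvg; rewrite near_withinE.
  by apply/nearW => z Az; exact: (fg z (mem_set Az)).
move=> c ac x [Ax cx]; have [|U [G [oU Ux Gk GE]]] := fs c ac x.
  by split=> //=; rewrite fg ?inE.
exists U, G; split=> // z [Az cz] Uz; rewrite GE//=; first by rewrite fg ?inE.
by split=> //=; rewrite fg ?inE.
Qed.

Lemma smooth_intoW (E : normedModType R) (A B : set E) (f : E -> N) :
  A `<=` B -> smooth_into S B f -> smooth_into S A f.
Proof.
move=> AB [fc fs]; split; first exact: continuous_subspaceW fc.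
move=> c ac x [Ax cx]; have [|U [G [oU Ux Gk GE]]] := fs c ac x.
  by split=> //; exact: AB.
exists U, G; split=> // z [Az cz] Uz; apply: GE => //.
by split=> //; exact: AB.
Qed.

Lemma smooth_into_affine (E1 E2 : normedModType R) (a L : E1 -> E2) (A : set E2)
    (f : E2 -> N) :
  (forall x h v, a (h *: v + x) = h *: L v + a x) ->
  (forall x, differentiable a x) ->
  smooth_into S A f -> smooth_into S (a @^-1` A) (f \o a).
Proof.
move=> aL da [/subspace_continuousP fc fs].
have ac x : {for x, continuous a} by exact: differentiable_continuous.
split.
  apply/subspace_continuousP => x Ax B fB.
  exact: (ac x _ (fc (a x) Ax B fB)).
move=> c cat x [Ax cx]; have [|U [G [oU Ux Gk GE]]] := fs c cat (a x); first by split.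
exists (a @^-1` U), (G \o a); split=> //.
- by apply: open_comp => // z _; exact: ac.
- by move=> k; apply: (Ck_comp_affine aL da); exact: Gk.
- by move=> z [Az cz] Uz; apply: GE.
Qed.

End SmoothInto.

Section Length.
Context {R : realType} {n : nat} {N : topologicalType}.
Variable S : smooth_structure R n N.
Variable phi : N -> 'rV[R]_n -> R.
Hypothesis phi_finsler : finsler_metric S phi.
Implicit Types (c : chart R n N) (y : R -> N) (I : set R).

Local Notation TR := (tangent_reading S phi).

Definition speed y t : R := phi (y t) (velocity S y t).

Lemma speed_ge0 y t : 0 <= speed y t.
Proof. exact: (finsler_ge0 phi_finsler). Qed.

Lemma near_eq_velocity y z t : (\forall s \near t, y s = z s) ->
  velocity S y t = velocity S z t.
Proof.
move=> yz; rewrite /velocity !derive1E (nbhs_singleton yz).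
by apply: near_eq_derive; near=> s; rewrite /= (near yz s).
Unshelve. all: by end_near. Qed.

Lemma near_eq_speed y z t : (\forall s \near t, y s = z s) ->
  speed y t = speed z t.
Proof.
by move=> yz; rewrite /speed (near_eq_velocity yz) (nbhs_singleton yz).
Qed.

Lemma curve_derivable I y t c : smooth_into S I y -> I° t -> atlas S c ->
  cdom c (y t) -> derivable (cmap c \o y) t 1.
Proof.
move=> sy It ac ct; apply: diff_derivable.
by have [+ _] := smooth_into_Ck 1 sy ac; apply.
Qed.

Lemma velocity_smooth I y t c : smooth_into S I y -> I° t -> atlas S c ->
  cdom c (y t) ->
  velocity S y t = derive1 (cmap c \o y) t *m to_at S (y t) c.
Proof.
move=> sy It ac ct; apply: velocity_chart => //.
  exact: smooth_into_continuous sy It.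
exact: curve_derivable sy It ac ct.
Qed.

Lemma speed_chart I y t c : smooth_into S I y -> I° t -> atlas S c ->
  cdom c (y t) -> speed y t = TR c (cmap c (y t), derive1 (cmap c \o y) t).
Proof.
move=> sy It ac ct; rewrite /speed (velocity_smooth sy It ac ct).
by rewrite /tangent_reading /= cmapK.
Qed.

Lemma curve_derive1_continuous I y t c : smooth_into S I y -> I° t -> atlas S c ->
  cdom c (y t) -> {for t, continuous (derive1 (cmap c \o y))}.
Proof.
move=> sy It ac ct; have [_ /(_ 1)] := smooth_into_Ck 1 sy ac.
move=> /(_ t (conj It ct)); have -> : 'D_(1 : R) (cmap c \o y) = derive1 (cmap c \o y) by apply/funext => s; rewrite derive1E.
exact.
Qed.

Lemma speed_continuous I y t : smooth_into S I y -> I° t ->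
  {for t, continuous (speed y)}.
Proof.
move=> sy It; pose c := chart_at S (y t).
have ac : atlas S c by exact: atlas_chart_at.
have ct : cdom c (y t) by exact: cdom_chart_at.
have yc := smooth_into_continuous sy It.
have spE : \forall s \near t, TR c (cmap c (y s), derive1 (cmap c \o y) s) = speed y s.
  near=> s; apply/esym; apply: (@speed_chart I) => //; near: s.
    exact: open_nbhs_nbhs (conj (open_interior I) It).
  exact: yc (near_cdom ct).
rewrite /prop_for /continuous_at -(nbhs_singleton spE).
apply: cvg_trans (near_eq_cvg spE) _.
have c1 : (fun s => cmap c (y s)) @ t --> cmap c (y t).
  exact: (continuous_cvg (nbhs_filter t) (cmap_continuous ct) yc).
have c2 := curve_derive1_continuous sy It ac ct.
have c12 := cvg_to_pair (nbhs_filter t) c1 c2.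
have cz : cimg c (cmap c (y t), derive1 (cmap c \o y) t).1 by exact: cimg_cmap.
have cTR := tangent_reading_continuous phi_finsler ac cz.
exact: (continuous_cvg (nbhs_filter t) cTR c12).
Unshelve. all: by end_near. Qed.

Lemma interior_cc (a b t : R) : a < t < b -> (`[a, b]%classic)° t.
Proof.
move=> /andP[at_ tb]; apply: (@filterS _ _ _ `]a, b[%classic).
  by move=> s /=; rewrite !in_itv /= => /andP[/ltW -> /ltW ->].
by apply: near_in_itvoo; rewrite in_itv /= at_.
Qed.

Lemma speed_measurable_oo y (a b : R) : smooth_into S `[a, b] y ->
  measurable_fun `]a, b[ (EFin \o speed y).
Proof.
move=> sy; apply/measurable_EFinP; apply: open_continuous_measurable_fun.
  exact: interval_open.
move=> t; rewrite inE /= in_itv /= => tab.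
exact: speed_continuous sy (interior_cc tab).
Qed.

Lemma speed_measurable_cc y (a b : R) : smooth_into S `[a, b] y ->
  measurable_fun `[a, b] (EFin \o speed y).
Proof.
by move=> /speed_measurable_oo /emeasurable_fun_itv_cc.
Qed.

Definition arc_length y (a b : R) : \bar R :=
  (\int[lebesgue_measure]_(t in `[a, b]) (speed y t)%:E)%E.

(** Measurability on the union is part of the conclusion so that it propagates along a partition.
    The shared point [b] has measure zero. *)
Lemma len_split y (a b c : R) : a <= b -> b <= c ->
  measurable_fun `[a, b] (EFin \o speed y) ->
  measurable_fun `[b, c] (EFin \o speed y) ->
  measurable_fun `[a, c] (EFin \o speed y) /\
  arc_length y a c = (arc_length y a b + arc_length y b c)%E.
Proof.
move=> ab bc m1 m2.
have e : `[a, c]%classic = `[a, b]%classic `|` `[b, c]%classic :> set R.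
  apply/seteqP; split=> t /=; rewrite !in_itv /=.
    by move=> /andP[-> ->]; rewrite andbT; case: (leP t b) => [|/ltW]; [left|right].
  by move=> [|] /andP[h1 h2]; apply/andP; split=> //; [exact: le_trans h2 bc|exact: le_trans ab h1].
have m : measurable_fun `[a, c] (EFin \o speed y).
  by rewrite e; apply/measurable_funU.
split=> //.
have e' : `[a, c]%classic = `[a, b[%classic `|` `[b, c]%classic :> set R.
  apply/seteqP; split=> t /=; rewrite !in_itv /=.
    by move=> /andP[-> ->]; rewrite andbT; case: (ltP t b); [left|right].
  by move=> [|] /andP[h1 h2]; apply/andP; split=> //; [exact: ltW (lt_le_trans h2 bc)|exact: le_trans ab h1].
rewrite /arc_length e' ge0_integral_setU//=.
- congr (_ + _)%E; apply: integral_itv_bndo_bndc.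
  by apply: measurable_funS m1 => //; apply: subset_itvl; rewrite bnd_simp.
- by rewrite -e'.
- by move=> t _; rewrite lee_fin speed_ge0.
- apply/disj_setPS => t [] /=; rewrite !in_itv /= => /andP[_ h1] /andP[h2 _].
  by move: (lt_le_trans h1 h2); rewrite ltxx.
Qed.

(** The speeds are compared on the open interval because at an end point [velocity] also depends on
    the curve outside [[a, b]]. *)
Lemma eq_len y z (a b : R) : smooth_into S `[a, b] y ->
  (forall t, a < t < b -> speed y t = speed z t) -> arc_length y a b = arc_length z a b.
Proof.
move=> sy yz; have my := speed_measurable_oo sy.
have mz : measurable_fun `]a, b[ (EFin \o speed z).
  apply: eq_measurable_fun my => t.
  by rewrite inE /= in_itv /= => /yz ->.
apply: (etrans (integral_itv_bndoo true false my)).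
apply: (etrans _ (esym (integral_itv_bndoo true false mz))).
by apply: eq_integral => t; rewrite inE /= in_itv /= => /yz ->.
Qed.

(** For [a = 0] and [b = 1] this unfolds to [piecewise_smooth], so the curves in the definition of
    the distance can be used as they are. *)
Definition pw_smooth y (a b : R) :=
  exists s : seq R, itv_partition a b s /\
    forall i, (i < size s)%N ->
      smooth_into S `[nth b (a :: s) i, nth b s i] y.

Lemma pw_ind y (Q : R -> R -> Prop) (a b : R) :
  (forall a b : R, a < b -> smooth_into S `[a, b] y -> Q a b) ->
  (forall a b c : R, a < b -> b < c -> Q a b -> Q b c -> Q a c) ->
  a < b -> pw_smooth y a b -> Q a b.
Proof.
move=> Q1 Qt + [s [+ +]]; elim: s a => [|x s IH] a ab sP sy.
  by move/itv_partition_nil : sP ab => ->; rewrite ltxx.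
have ax : a < x by case: sP => /= /andP[].
have Qax : Q a x by apply: Q1 => //; exact: (sy 0%N isT).
have sP' := itv_partition_cons sP.
have sy' i : (i < size s)%N -> smooth_into S `[nth b (x :: s) i, nth b s i] y.
  by move=> si; exact: (sy i.+1 si).
case: s IH sP sy sP' sy' => [|z s] IH sP sy sP' sy'.
  by move/itv_partition_nil : sP' => <-.
have xb : x < b by apply: itv_partition_size_neq0 sP'.
exact: Qt ax xb Qax (IH x xb sP' sy').
Qed.

Lemma pw1 y (a b : R) : a < b -> smooth_into S `[a, b] y -> pw_smooth y a b.
Proof.
move=> ab sy; exists [:: b]; split; first exact: itv_partition1.
by case.
Qed.

Lemma pw_cat y (a b c : R) : pw_smooth y a b -> pw_smooth y b c -> pw_smooth y a c.
Proof.
move=> [s [sP sy]] [t [tP ty]]; exists (s ++ t); split.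
  exact: itv_partition_cat sP tP.
move=> i; rewrite size_cat => ist.
have [is_|si] := ltnP i (size s).
  have := sy i is_.
  have -> : nth b (a :: s) i = nth c (a :: s ++ t) i.
    rewrite -cat_cons nth_cat /= ltnS (ltnW is_).
    by apply: set_nth_default; rewrite /= ltnS ltnW.
  have -> : nth b s i = nth c (s ++ t) i.
    by rewrite nth_cat is_; exact: set_nth_default.
  by [].
(* The last break point of the first partition is [b], which heads the second list of break
   points. *)
have -> : nth c (a :: s ++ t) i = nth c (b :: t) (i - size s).
  rewrite -cat_cons lastI cat_rcons nth_cat size_belast ltnNge si /=.
  by case: sP => _ /eqP ->.
rewrite nth_cat ltnNge si /=; apply: ty.
by rewrite ltn_subLR.
Qed.

Lemma pw_lt_measurable y (a b : R) : a < b -> pw_smooth y a b ->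
  measurable_fun `[a, b] (EFin \o speed y).
Proof.
apply: (@pw_ind y (fun a b => measurable_fun `[a, b] (EFin \o speed y))) => [d e _|d e f de ef m1 m2].
  exact: speed_measurable_cc.
by have [] := len_split (ltW de) (ltW ef) m1 m2.
Qed.

Lemma len_cat y (a b c : R) : a < b -> b < c -> pw_smooth y a b -> pw_smooth y b c ->
  arc_length y a c = (arc_length y a b + arc_length y b c)%E.
Proof.
move=> ab bc pab pbc.
by have [] := len_split (ltW ab) (ltW bc) (pw_lt_measurable ab pab) (pw_lt_measurable bc pbc).
Qed.

(** * Invariance of length under increasing affine reparametrization *)

Section Affine.
Variables (k d : R).
Hypothesis k0 : 0 < k.
Let f (t : R) := k * t + d.
Let g (t : R) := (t - d) / k.

Let f_affine (x h v : R) : f (h *: v + x) = h *: (k * v) + f x.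
Proof. by rewrite /f /GRing.scale /=; ring. Qed.

Let f_derive (x : R) : is_derive x 1 f k.
Proof.
have : is_derive x 1 (fun t => d + t *: k) k by apply: (is_derive_line (f := id)).
by rewrite (_ : (fun t => _) = f)//; apply/funext => t; rewrite /f /GRing.scale /= addrC mulrC.
Qed.

Let f_diff (x : R) : differentiable f x.
Proof. by apply/derivable1_diffP; case: (f_derive x). Qed.

Let f_itv (a b : R) : f @^-1` `[a, b]%classic = `[g a, g b]%classic.
Proof.
apply/seteqP; split=> t /=; rewrite !in_itv /= /f /g;
  by rewrite ler_pdivrMr// ler_pdivlMr// lerBlDr lerBrDr mulrC.
Qed.

Lemma smooth_into_reparam y (a b : R) : smooth_into S `[a, b] y ->
  smooth_into S `[g a, g b] (y \o f).
Proof. by move=> sy; rewrite -f_itv; exact: smooth_into_affine f_affine f_diff sy. Qed.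

Let g_lt a b : a < b -> g a < g b.
Proof. by move=> ab; rewrite /g ltr_pM2r ?invr_gt0// ltrD2r. Qed.

Lemma velocity_reparam y t : derivable (cmap (chart_at S (y (f t))) \o y) (f t) 1 ->
  velocity S (y \o f) t = k *: velocity S y (f t).
Proof.
move=> dy; rewrite /velocity /=.
set h := cmap _ \o y.
have fd : derivable f t 1 by case: (f_derive t).
have hd : differentiable h (f t) by apply/derivable1_diffP.
have [_ e] := derive1_comp_rV fd hd.
have f' : derive1 f t = k by rewrite derive1E; case: (f_derive t).
rewrite -[LHS]/(derive1 (h \o f) t) derive1E e f' derive1E !deriveE// -linearZ.
by congr ('d h (f t) _); rewrite /GRing.scale /= mulr1.
Qed.

Let speed_reparam y (a b t : R) : smooth_into S `[a, b] y -> g a < t < g b ->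
  speed (y \o f) t = k * speed y (f t).
Proof.
move=> sy tab; have fab : a < f t < b.
  by move: tab; rewrite /f /g ltr_pdivrMr// ltr_pdivlMr// ltrBlDr ltrBrDr mulrC.
rewrite /speed velocity_reparam ?(finslerZ phi_finsler) ?ltW//.
apply: (curve_derivable sy (interior_cc fab)); first exact: atlas_chart_at.
exact: cdom_chart_at.
Qed.

Let len_reparam y (a b : R) : smooth_into S `[a, b] y ->
  arc_length (y \o f) (g a) (g b) = arc_length y a b.
Proof.
move=> sy; have my := speed_measurable_oo (smooth_into_reparam sy).
have k1 : 0 <= k^-1 by rewrite invr_ge0 ltW.
have E t : t \in `]g a, g b[%classic -> ((k^-1)%:E * (speed (y \o f) t)%:E = (speed y (f t))%:E)%E.
  rewrite inE /= in_itv /= => tab; rewrite (speed_reparam sy tab) -EFinM mulrA mulVf ?mul1r//.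
  by rewrite gt_eqF.
have mz : measurable_fun `]g a, g b[ (fun t => (speed y (f t))%:E).
  apply: (eq_measurable_fun (fun t => ((k^-1)%:E * (speed (y \o f) t)%:E)%E)); first exact: E.
  exact: measurable_funeM.
have pos x : (`[a, b]%classic x -> 0 <= (speed y x)%:E)%E by move=> _; rewrite lee_fin speed_ge0.
have I : arc_length y a b = (k%:E * \int[lebesgue_measure]_(x in `[g a, g b]) (speed y (f x))%:E)%E.
  rewrite -f_itv; exact: (integral_affine d k0 (measurable_itv _) (speed_measurable_cc sy) pos).
apply: (etrans (integral_itv_bndoo true false my)); apply: (etrans _ (esym I)).
rewrite (integral_itv_bndoo true false mz).
have swap (A B : \bar R) : (B = (k^-1)%:E * A -> A = k%:E * B)%E.
  by move=> ->; rewrite muleA -EFinM divff ?mul1e// gt_eqF.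
apply: swap; apply: (etrans (eq_integral _ _ _)); first by move=> x xi; exact/esym/E.
apply: ge0_integralZl_EFin; [exact: measurable_itv| |exact: my|exact: k1].
by move=> x _; rewrite lee_fin speed_ge0.
Qed.

Lemma pw_reparam y (a b : R) : a < b -> pw_smooth y a b ->
  pw_smooth (y \o f) (g a) (g b) /\ arc_length (y \o f) (g a) (g b) = arc_length y a b.
Proof.
move=> ab yab.
(* The piecewise smoothness of both curves is carried along because additivity of length requires
   it. *)
pose Q (a b : R) := [/\ pw_smooth (y \o f) (g a) (g b), pw_smooth y a b & arc_length (y \o f) (g a) (g b) = arc_length y a b].
have [h1 _ h3] : Q a b; last by split; [exact: h1|exact: h3].
apply: (@pw_ind y Q a b _ _ ab yab) => [p q pq sy|p q r pq qr [h1 h2 h3] [h4 h5 h6]].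
  split; [apply: pw1; [exact: g_lt|exact: smooth_into_reparam]|exact: pw1|exact: len_reparam].
split; [exact: pw_cat h1 h4|exact: pw_cat h2 h5|].
by rewrite (len_cat (g_lt pq) (g_lt qr) h1 h4) (len_cat pq qr h2 h5) h3 h6.
Qed.

End Affine.

Lemma eq_pw y z (a b : R) : a < b -> {in `[a, b], y =1 z} -> pw_smooth y a b ->
  pw_smooth z a b /\ arc_length y a b = arc_length z a b.
Proof.
move=> ab yz yab.
pose Q (p q : R) := a <= p -> q <= b -> [/\ pw_smooth y p q, pw_smooth z p q & arc_length y p q = arc_length z p q].
have [//|//|_ h2 h3] : Q a b; last by split; [exact: h2|exact: h3].
apply: (@pw_ind y Q a b _ _ ab yab) => [p q pq sy ap qb|p q r pq qr Q1 Q2 ap rb].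
  have e : {in `[p, q], y =1 z}.
    move=> t; rewrite in_itv /= => /andP[pt tq]; apply: yz; rewrite in_itv /=.
    by rewrite (le_trans ap)// (le_trans tq).
  have sz : smooth_into S `[p, q] z.
    by apply: eq_smooth_into sy => t; rewrite inE /=; exact: e.
  split; [exact: pw1|exact: pw1|apply: (eq_len sy) => t tpq].
  apply: near_eq_speed; near=> s; apply: e.
  by near: s; exact: (@interior_cc p q t).
have [h1 h2 h3] := Q1 ap (le_trans (ltW qr) rb).
have [h4 h5 h6] := Q2 (le_trans ap (ltW pq)) rb.
split; [exact: pw_cat h1 h4|exact: pw_cat h2 h5|].
by rewrite (len_cat pq qr h1 h4) (len_cat pq qr h2 h5) h3 h6.
Unshelve. all: by end_near. Qed.

Lemma dist_le_len (A : set N) y (a b : R) : a < b -> pw_smooth y a b ->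
  (forall t, a <= t <= b -> A (y t)) ->
  (finsler_dist S phi A (y a) (y b) <= arc_length y a b)%E.
Proof.
move=> ab yab yA; have k0 : 0 < b - a by rewrite subr_gt0.
have kn : b - a != 0 by rewrite gt_eqF.
have [pf lf] := pw_reparam a k0 ab yab.
rewrite subrr mul0r (divff kn) in pf lf.
apply: ereal_inf_lbound; exists (y \o (fun t => (b - a) * t + a)).
  split=> [||/=|t /andP[t0 t1]]; first exact: pf.
  - by rewrite /= mulr0 add0r.
  - by rewrite mulr1 subrK.
  - by apply: yA; apply/andP; split; nra.
exact: lf.
Qed.

Lemma dist_cat (A : set N) y z (a b c d : R) : a < b -> c < d ->
  pw_smooth y a b -> pw_smooth z c d -> y b = z c ->
  (forall t, a <= t <= b -> A (y t)) -> (forall t, c <= t <= d -> A (z t)) ->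
  (finsler_dist S phi A (y a) (z d) <= arc_length y a b + arc_length z c d)%E.
Proof.
move=> ab cd yab zcd yz yA zA.
have [pz' lz'] := pw_reparam (c - b) ltr01 cd zcd.
rewrite !divr1 in pz' lz'.
set z' := z \o _ in pz' lz'.
have e1 : c - (c - b) = b by ring.
have e2 : d - (c - b) = b + (d - c) by ring.
rewrite e1 e2 in pz' lz'.
have b' : b < b + (d - c) by rewrite ltrDl subr_gt0.
(* At the junction both formulas give [y b = z c], so [x] agrees with the translated curve on all of
   [[b, b + (d - c)]]. *)
pose x t := if t <= b then y t else z' t.
have [px lx] : pw_smooth x a b /\ arc_length y a b = arc_length x a b.
  by apply: (eq_pw ab _ yab) => t; rewrite in_itv /= /x => /andP[_ ->].
have [px' lx'] : pw_smooth x b (b + (d - c)) /\ arc_length z' b (b + (d - c)) = arc_length x b (b + (d - c)).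
  apply: (eq_pw b' _ pz') => t; rewrite in_itv /= /x => /andP[bt _].
  case: (leP t b) => [tb|_]; last by [].
  have -> : t = b by apply/le_anti; rewrite tb.
  rewrite yz /z' /=; congr z; ring.
rewrite lx -lz' lx' -(len_cat ab b' px px').
have -> : z d = x (b + (d - c)).
  rewrite /x leNgt b' /= /z' /=; congr z; ring.
have -> : y a = x a by rewrite /x ltW.
apply: dist_le_len; [exact: lt_trans b'|exact: pw_cat px'|].
move=> t /andP[at_ tb]; rewrite /x; case: (leP t b) => [tb'|bt]; first by apply: yA; rewrite at_.
by apply: zA; apply/andP; split; lra.
Qed.

Lemma constant_smooth (A : set R) p : smooth_into S A (fun _ : R => p).
Proof.
split; first by apply: continuous_subspaceT => x; exact: cvg_cst.
move=> c ac x _; exists setT, (fun _ => cmap c p); split=> //; first exact: openT.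
by move=> k; elim: k (cmap c p) => [|k IH] w /=;
  [move=> ? _; exact: cvg_cst|split=> [? _|v]; [exact: differentiable_cst|]];
  have -> : 'D_v (fun _ : R => w) = (fun _ => 0) by (apply/funext => ?; exact: derive_cst).
Qed.

End Length.

Section DistanceExtension.
Context {R : realType} {n : nat} {N : topologicalType}.
Variable S : smooth_structure R n N.
Variable phi : N -> 'rV[R]_n -> R.
Hypothesis phi_finsler : finsler_metric S phi.
Local Notation arc_length := (arc_length S phi).
Local Notation dist := (finsler_dist S phi).

(** Prolonging an arbitrary curve from [p] by [y] gives the bound. The length of [y] is bounded by a
    real [l], which can be moved across inequalities of extended reals. *)
Lemma dist_extend_r (A : set N) p y (a b l : R) : a < b ->
  pw_smooth S y a b -> (forall t, a <= t <= b -> A (y t)) -> (arc_length y a b <= l%:E)%E ->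
  (dist A p (y b) <= dist A p (y a) + l%:E)%E.
Proof.
move=> ab yab yA yl; rewrite -leeBlDr//; apply/ereal_infP => _ [z [pz z0 z1 zA] <-].
rewrite leeBlDr//; rewrite -z0.
apply: le_trans (dist_cat phi_finsler ltr01 ab pz yab z1 zA yA) _.
exact: leeD.
Qed.

Lemma dist_extend_l (A : set N) p y (a b l : R) : a < b ->
  pw_smooth S y a b -> (forall t, a <= t <= b -> A (y t)) -> (arc_length y a b <= l%:E)%E ->
  (dist A (y a) p <= l%:E + dist A (y b) p)%E.
Proof.
move=> ab yab yA yl; rewrite addeC -leeBlDr//; apply/ereal_infP => _ [z [pz z0 z1 zA] <-].
rewrite leeBlDr//; rewrite -z1 addeC.
apply: le_trans (dist_cat phi_finsler ab ltr01 yab pz (esym z0) yA zA) _.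
exact: leeD.
Qed.

Lemma le_dist (A B : set N) p q : A `<=` B -> (dist B p q <= dist A p q)%E.
Proof.
move=> AB; apply/ereal_infP => _ [z [pz z0 z1 zA] <-].
by apply: ereal_inf_lbound; exists z => //; split=> // t /zA /AB.
Qed.

End DistanceExtension.

(** * Energy conservation and first variation *)

Section Partial.
Context {R : realType}.

Lemma derive_snd (E F G : normedModType R) (f : E * F -> G) x v w :
  'D_(0, w) f (x, v) = 'D_w (fun v => f (x, v)) v.
Proof.
have e : (fun h : R => h^-1 *: ((f \o shift (x, v)) (h *: (0, w)) - f (x, v))) =
    (fun h : R => h^-1 *: (((fun v => f (x, v)) \o shift v) (h *: w) - f (x, v))).
  apply/funext => h; rewrite /= -[h *: (0, w) + (x, v)]/(h *: 0 + x, h *: w + v).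
  by rewrite scaler0 add0r.
by rewrite /derive e.
Qed.

Lemma derive_pair0_sum n (E : normedModType R) (f : E * 'rV[R]_n -> R) z v :
  differentiable f z ->
  'D_(0, v) f z = \sum_j v 0 j * 'D_(0, delta_mx 0 j) f z.
Proof.
move=> df; rewrite deriveE//.
have -> : ((0, v) : E * 'rV[R]_n) = \sum_j v 0 j *: ((0, delta_mx 0 j) : E * 'rV[R]_n).
  rewrite {1}[v]row_sum_delta.
  elim/big_rec2: _ => [//|j a b _ <-].
  by rewrite -[RHS]/(v 0 j *: 0 + 0, v 0 j *: delta_mx 0 j + b) scaler0 addr0.
by rewrite linear_sum; apply: eq_bigr => j _; rewrite linearZ /= deriveE.
Qed.

Lemma derive_0pair_sum n (E : normedModType R) (f : 'rV[R]_n * E -> R) z v :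
  differentiable f z ->
  'D_(v, 0) f z = \sum_j v 0 j * 'D_(delta_mx 0 j, 0) f z.
Proof.
move=> df; rewrite deriveE//.
have -> : ((v, 0) : 'rV[R]_n * E) = \sum_j v 0 j *: ((delta_mx 0 j, 0) : 'rV[R]_n * E).
  rewrite {1}[v]row_sum_delta.
  elim/big_rec2: _ => [//|j a b _ <-].
  by rewrite -[RHS]/(v 0 j *: delta_mx 0 j + b, v 0 j *: 0 + 0) scaler0 addr0.
by rewrite linear_sum; apply: eq_bigr => j _; rewrite linearZ /= deriveE.
Qed.

Lemma derive_pair (E F G : normedModType R) (f : E * F -> G) z v w :
  differentiable f z -> 'D_(v, w) f z = 'D_(v, 0) f z + 'D_(0, w) f z.
Proof.
move=> df; rewrite !deriveE// -linearD.
by congr ('d f z _); rewrite -[RHS]/(v + 0, 0 + w) addr0 add0r.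
Qed.

Lemma is_derive_to_pair (E F : normedModType R) (f : R -> E) (h : R -> F) (t : R) df dh :
  is_derive t 1 f df -> is_derive t 1 h dh ->
  is_derive t 1 (fun s => (f s, h s)) (df, dh).
Proof.
move=> [fd fE] [hd hE].
have dp : differentiable (fun s => (f s, h s)) t.
  by apply: differentiable_pair; exact/derivable1_diffP.
apply: DeriveDef; first exact: diff_derivable.
rewrite deriveE// diff_pair /=; [|exact/derivable1_diffP..].
by rewrite -fE -hE !deriveE//; exact/derivable1_diffP.
Qed.

Lemma is_derive_square (f : R -> R) (t K : R) :
  (\forall w \near (0 : R), `|f (t + w) - f t| <= K * w ^+ 2) ->
  is_derive t 1 f 0.
Proof.
move=> H.
have c0 : (fun h : R => h^-1 *: (f (h *: 1 + t) - f t)) @ 0^' --> (0 : R).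
  apply/cvgr0Pnorm_lt => e e0.
  have K0 : 0 < `|K| + 1 by rewrite ltr_wpDl.
  near=> h.
  have h0 : h != 0 by near: h; exact: nbhs_dnbhs_neq.
  have hh : 0 < `|h| by rewrite normr_gt0.
  have hs : `|h| < e / (`|K| + 1).
    by near: h; apply: dnbhs0_lt; rewrite divr_gt0.
  rewrite normrM normrV ?unitfE// mulrC ltr_pdivrMr//.
  rewrite [h *: 1]mulr1 [h + t]addrC; apply: (@le_lt_trans _ _ (K * h ^+ 2)).
    by near: h; apply: cvg_within; exact: H.
  rewrite -[h ^+ 2]real_normK ?num_real// expr2 mulrA ltr_pM2r//.
  apply: (@le_lt_trans _ _ ((`|K| + 1) * `|h|)).
    by rewrite ler_wpM2r// (le_trans (ler_norm _))// lerDl.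
  by rewrite mulrC -ltr_pdivlMr.
apply: DeriveDef; first by apply/cvg_ex; exists 0.
exact: cvg_lim c0.
Unshelve. all: by end_near. Qed.

Lemma derive_snd_scale (E G : normedModType R) (f : E * R -> G) z (a : R) :
  differentiable f z -> 'D_(0, a) f z = a *: 'D_(0, 1) f z.
Proof.
move=> df; rewrite !deriveE// -linearZ; congr ('d f z _).
by rewrite -[RHS]/(a *: 0, a * 1) scaler0 mulr1.
Qed.

(** Concludes the conservation of energy, where the derivative of the energy is found equal to its
    double. *)
Lemma double_fixed (a : R) : 2 * a = a -> a = 0.
Proof. lra. Qed.

End Partial.

Section Geodesic.
Context {R : realType} {n : nat} {N : topologicalType}.
Variable S : smooth_structure R n N.
Variable phi : N -> 'rV[R]_n -> R.
Hypothesis phi_finsler : finsler_metric S phi.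
Implicit Types (c : chart R n N) (y : R -> N) (x v w : 'rV[R]_n).

Local Notation TR := (tangent_reading S phi).
Local Notation speed := (speed S phi).

Definition energy c (z : 'rV[R]_n * 'rV[R]_n) : R := TR c z ^+ 2.

Lemma energyE c : energy c = TR c ^+ 2. Proof. by rewrite exprfctE. Qed.

Lemma tangent_reading_differentiable c x v : atlas S c -> cimg c x -> v != 0 ->
  differentiable (TR c) (x, v).
Proof.
by move=> ac cx v0; have [+ _] := tangent_reading_Ck phi_finsler 1 ac; exact.
Qed.

Lemma energy_differentiable c x v : atlas S c -> cimg c x -> v != 0 ->
  differentiable (energy c) (x, v).
Proof.
move=> ac cx v0; rewrite energyE; apply: differentiableX.
exact: tangent_reading_differentiable.
Qed.

Lemma tangent_reading_euler c x v : atlas S c -> cimg c x -> v != 0 ->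
  'D_(0, v) (TR c) (x, v) = TR c (x, v).
Proof.
move=> ac cx v0; rewrite derive_snd.
apply: (@minkowski_euler R n (fun v => TR c (x, v))) => //.
  by move=> w s s0; rewrite tangent_readingZ.
move=> k; have -> : [set v | v != 0] = (fun v : 'rV[R]_n => (x, v)) @^-1`
    [set z : 'rV[R]_n * 'rV[R]_n | cimg c z.1 /\ z.2 != 0].
  by apply/seteqP; split=> w /=; [split|case].
apply: (@Ck_comp_affine _ _ _ _ _ (fun v => (0, v)) k _ (TR c)).
- by move=> z h w; rewrite -[RHS]/(h *: 0 + x, h *: w + z) scaler0 add0r.
- move=> w; apply: differentiable_pair; [exact: differentiable_cst|].
  by apply: ex_diff.
- exact: tangent_reading_Ck.
Qed.

Lemma derive_energy c x v (w : 'rV[R]_n * 'rV[R]_n) : atlas S c -> cimg c x -> v != 0 ->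
  'D_w (energy c) (x, v) = 2 * TR c (x, v) * 'D_w (TR c) (x, v).
Proof.
move=> ac cx v0; rewrite energyE deriveX; first by rewrite expr1.
by apply: diff_derivable; exact: tangent_reading_differentiable.
Qed.

Lemma energy_euler c x v : atlas S c -> cimg c x -> v != 0 ->
  'D_(0, v) (energy c) (x, v) = 2 * energy c (x, v).
Proof.
by move=> ac cx v0; rewrite derive_energy// tangent_reading_euler// -mulrA.
Qed.

Section Curve.
Variables (I : set R) (y : R -> N) (t : R) (c : chart R n N).
Hypotheses (gy : geodesic S phi I y) (It : I° t).
Hypotheses (ac : atlas S c) (ct : cdom c (y t)).
Let x := cmap c \o y.
Let sy := gy.1.

Let x_Ck k : Ck k (I° `&` y @^-1` cdom c) x.
Proof. exact: (smooth_into_Ck k sy ac). Qed.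

Let near_I : \forall s \near t, (I° `&` y @^-1` cdom c) s.
Proof. by apply: open_nbhs_nbhs; split=> //; exact: (smooth_into_open c sy). Qed.

Lemma curve_derive : is_derive t 1 x (derive1 x t).
Proof.
rewrite derive1E; apply: derivableP; apply: diff_derivable.
by have [+ _] := x_Ck 1; apply.
Qed.

Lemma curve_derive1 : is_derive t 1 (derive1 x) (derive1 (derive1 x) t).
Proof.
rewrite derive1E; apply: derivableP; apply: diff_derivable.
have [_ /(_ (1 : R))[+ _]] := x_Ck 2; move=> /(_ t (conj It ct)).
by have -> : 'D_(1 : R) x = derive1 x by apply/funext => s; rewrite derive1E.
Qed.

Let x't_continuous : derive1 x @ t --> derive1 x t.
Proof.
have [d _] := curve_derive1.
exact: (differentiable_continuous ((derivable1_diffP _ _).1 d)).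
Qed.

Let near_neq0 : derive1 x t != 0 -> \forall s \near t, derive1 x s != 0.
Proof. by move=> x'0; move/cvgr_neq0 : x't_continuous; apply. Qed.

(* Euler-Lagrange paired with a vector field [J] along the curve. *)
Lemma first_variation (J : R -> 'rV[R]_n) J' : derive1 x t != 0 ->
  is_derive t 1 J J' ->
  is_derive t 1 (fun s => 'D_(0, J s) (energy c) (x s, derive1 x s))
    ('D_(J t, J') (energy c) (x t, derive1 x t)).
Proof.
move=> x'0 dJ.
(* [B j] is the momentum conjugate to the [j]-th coordinate; the Euler-Lagrange equation says that
   its derivative is [B' j], and the product rule for the sum of [J j * B j] does the rest. *)
pose B j s := 'D_((0 : 'rV[R]_n), (delta_mx 0 j : 'rV[R]_n)) (energy c) (x s, derive1 x s).
pose B' j := 'D_((delta_mx 0 j : 'rV[R]_n), (0 : 'rV[R]_n)) (energy c) (x t, derive1 x t).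
have dB j : is_derive t 1 (B j) (B' j).
  by case: gy => _ /(_ t c (delta_mx 0 j) (nbhs_singleton It) ac ct).
have dJj j : is_derive t 1 (fun s => J s 0 j) (J' 0 j).
  case: dJ => Jd <-; apply: DeriveDef.
    by move/derivable_mxP : Jd; exact.
  by rewrite derive_mx// mxE.
have dE : differentiable (energy c) (x t, derive1 x t).
  exact: (energy_differentiable ac (cimg_cmap ct) x'0).
have H : is_derive t 1 (\sum_j ((fun s => J s 0 j) * B j))
    (\sum_j (J t 0 j *: B' j + B j t *: J' 0 j)).
  by apply: is_derive_sum => j; exact: is_deriveM.
have -> : 'D_(J t, J') (energy c) (x t, derive1 x t) =
    \sum_j (J t 0 j *: B' j + B j t *: J' 0 j).
  rewrite derive_pair// derive_0pair_sum// derive_pair0_sum// -big_split /=.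
  by apply: eq_bigr => j _; rewrite [B j t *: _]mulrC.
apply: near_eq_is_derive H; near=> s.
have dEs : differentiable (energy c) (x s, derive1 x s); last first.
  rewrite fct_sumE; apply: (etrans _ (esym (derive_pair0_sum _ dEs))).
  by apply: eq_bigr.
apply: energy_differentiable; [exact: ac| |by near: s; exact: near_neq0].
apply: cimg_cmap.
by have [] : (I° `&` y @^-1` cdom c) s by near: s; exact: near_I.
Unshelve. all: by end_near. Qed.

(** The first variation with [J] the velocity itself differentiates the fibre derivative of the
    energy along the velocity, which is twice the energy by Euler, and its right-hand side is the
    derivative of the energy by the chain rule. Where the velocity vanishes, a quadratic estimate
    replaces this. *)
Lemma energy_derive : is_derive t 1 (fun s => energy c (x s, derive1 x s)) 0.
Proof.
have [x'0|x'0] := eqVneq (derive1 x t) 0.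
  have [C HC] := tangent_reading_bound phi_finsler ac (cimg_cmap ct).
  have xc : x @ t --> x t.
    have [d _] := curve_derive.
    exact: (differentiable_continuous ((derivable1_diffP _ _).1 d)).
  have [d1 _] := curve_derive1.
  have dx' := (derivable1_diffP _ _).1 d1.
  have e1 := differentiable_eps ltr01 dx'.
  (* The expansion of the velocity with error [1 * |w|] gives norm at most [K * |w|] at [t + w]; the
     local bound on the metric contributes [C]. *)
  pose K := `|derive1 (derive1 x) t| + 1.
  apply: (@is_derive_square _ _ _ ((`|C| * K) ^+ 2)).
  have HC' : \forall w \near (0 : R), forall v, TR c (x (t + w), v) <= C * `|v|.
    have : \forall s \near t, forall v, TR c (x s, v) <= C * `|v| := xc _ HC.
    rewrite (near_shift 0 t) subr0.
    by apply: filterS => w /=; rewrite addrC.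
  near=> w.
  rewrite x'0 /energy tangent_reading0// expr0n subr0 ger0_norm ?sqr_ge0//.
  rewrite -[w ^+ 2]real_normK ?num_real// -exprMn lerXn2r ?nnegrE//.
  - exact: tangent_reading_ge0.
  - by rewrite !mulr_ge0// addr_ge0.
  have H1 := near HC' w; apply: le_trans (H1 _ _) _ => //.
  rewrite -mulrA; apply: (@le_trans _ _ (`|C| * `|derive1 x (t + w)|)).
    by rewrite ler_wpM2r// ler_norm.
  rewrite ler_wpM2l//.
  have : `|derive1 x (t + w) - derive1 x t - 'd (derive1 x) t w| <= 1 * `|w|.
    by near: w.
  rewrite x'0 subr0 mul1r => H2.
  rewrite -[derive1 x _](subrK ('d (derive1 x) t w)).
  apply: le_trans (ler_normD _ _) _; rewrite /K mulrDl mul1r addrC lerD//.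
  rewrite -[w in X in `|X|]mulr1 -[w * 1]/(w *: (1 : R)) linearZ /= normrZ mulrC.
  by rewrite derive1E deriveE.
have d1 := first_variation x'0 curve_derive1.
have E2 : is_derive t 1 (fun s => 2 * energy c (x s, derive1 x s))
    ('D_(derive1 x t, derive1 (derive1 x) t) (energy c) (x t, derive1 x t)).
  apply: near_eq_is_derive d1; near=> s.
  have ns : derive1 x s != 0 by near: s; exact: near_neq0.
  have [_ cs] : (I° `&` y @^-1` cdom c) s by near: s; exact: near_I.
  exact: (energy_euler ac (cimg_cmap cs) ns).
have dE : differentiable (energy c) (x t, derive1 x t).
  exact: (energy_differentiable ac (cimg_cmap ct) x'0).
have dp := is_derive_to_pair curve_derive curve_derive1.
have [dpd dpE] := dp.
have := derive1_comp_rV dpd dE.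
rewrite (etrans (derive1E _ _) dpE) => E1.
have [E1d E1E] := E1.
have [_ E2E] := E2.
apply: DeriveDef; first exact: E1d.
pose h s := energy c (x s, derive1 x s).
pose X := 'D_(derive1 x t, derive1 (derive1 x) t) (energy c) (x t, derive1 x t).
have e1' : 'D_1 h t = X by exact: E1E.
have e2 : 'D_1 (fun s => 2 * h s) t = 2 * 'D_1 h t by exact: (deriveZ 2 E1d).
have e3 : 'D_1 (fun s => 2 * h s) t = X by exact: E2E.
rewrite -/h -[LHS]/('D_1 h t) e1'.
rewrite e2 e1' in e3.
exact: (double_fixed e3).
Unshelve. all: by end_near. Qed.

End Curve.

Lemma geodesic_speed_derive (I : set R) y t : geodesic S phi I y -> I° t ->
  is_derive t 1 (fun s => speed y s ^+ 2) 0.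
Proof.
move=> gy It; have ct := cdom_chart_at S (y t); have ac := atlas_chart_at S (y t).
apply: near_eq_is_derive (energy_derive gy It ac ct); near=> s.
have [Is cs] : (I° `&` y @^-1` cdom (chart_at S (y t))) s.
  by near: s; apply: open_nbhs_nbhs; split=> //; exact: smooth_into_open gy.1.
by rewrite (speed_chart phi gy.1 Is ac cs).
Unshelve. all: by end_near. Qed.

Lemma geodesic_speed (e : R) y (s t : R) : geodesic S phi `]-oo, e[ y -> s < e -> t < e ->
  speed y s = speed y t.
Proof.
move=> gy.
have int r : r < e -> (`]-oo, e[%classic)° r.
  by move=> re; apply: open_nbhs_nbhs; split; [exact: interval_open|rewrite /= in_itv].
wlog : s t / s <= t.
  by move=> H; case: (leP s t) => [/H//|/ltW/H h] se te; rewrite h.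
move=> st _ te.
have c2 : {within `[s, t], continuous (fun s => speed y s ^+ 2)}.
  apply: derivable_within_continuous => r; rewrite in_itv /= => /andP[_ rt].
  by have [] := geodesic_speed_derive gy (int r (le_lt_trans rt te)).
have d2 r : r \in `]s, t[ -> is_derive r 1 (fun s => speed y s ^+ 2) 0.
  rewrite in_itv /= => /andP[_ rt].
  exact: geodesic_speed_derive gy (int r (lt_trans rt te)).
have e2 := derivative0_eq st c2 d2.
have sp r := speed_ge0 phi_finsler y r.
by apply/eqP; rewrite -(@eqrXn2 _ 2 _ _ isT (sp s) (sp t)); apply/eqP; exact: e2.
Qed.

End Geodesic.

(** * The Gauss lemma for the backward characteristics *)

Section Boundary.
Context {R : realType} {n : nat} {N : topologicalType}.
Variable S : smooth_structure R n N.
Variable M : set N.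
Implicit Types (c : chart R n N) (p q : N).

Local Notation bd := (mboundary S M).

Lemma mboundary_sub q : bd q -> M q.
Proof. by move=> [c [i [ac cq q0 cM]]]; apply/cM => //; rewrite q0. Qed.

Lemma near_cinv c x (A : set N) : cimg c x -> nbhs (cinv c x) A ->
  \forall z \near x, A (cinv c z).
Proof. by move=> cx; exact: (cinv_continuous cx). Qed.

Lemma coord_continuous i : continuous (fun x : 'rV[R]_n => x 0 i).
Proof.
by move=> x; apply: differentiable_continuous; exact: differentiable_coord.
Qed.

(** Moving from [q] against the transverse coordinate leaves [M] at once. *)
Lemma mboundary_not_interior q : bd q -> ~ M° q.
Proof.
move=> [c [i [ac cq q0 cM]]] Mq.
have cx := cimg_cmap cq.
have qE := cmapK cq.
have H : \forall z \near cmap c q, M (cinv c z).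
  by apply: near_cinv => //; rewrite qE.
have H2 := near_cimg cx.
have line : (fun s : R => cmap c q - s *: delta_mx 0 i) @ (0 : R) --> cmap c q.
  have -> : cmap c q = cmap c q - (0 : R) *: delta_mx 0 i by rewrite scale0r subr0.
  apply: cvgB; first by rewrite scale0r subr0; exact: (@cvg_cst _ _ _ (nbhs (0 : R))).
  by apply: cvgZr_tmp; exact: cvg_id.
have H3 := line _ H; have H4 := line _ H2.
near (0 : R)^'+ => s.
have s0 : 0 < s by near: s; exact: nbhs_right_gt.
have Ms : M (cinv c (cmap c q - s *: delta_mx 0 i)).
  by near: s; apply: cvg_within; exact: H3.
have cs : cimg c (cmap c q - s *: delta_mx 0 i).
  by near: s; apply: cvg_within; exact: H4.
move: Ms => /(cM _ (cdom_cinv cs)); rewrite cinvK// !mxE q0 !eqxx /= mulr1 sub0r.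
by rewrite oppr_ge0 leNgt s0.
Unshelve. all: by end_near. Qed.

(** A boundary point comes with a boundary chart of its own, unrelated to [c]. A positive coordinate
    in [c] would nevertheless make it an interior point of [M], which is impossible. *)
Lemma mboundary_chartE p c i q : boundary_chart S M p c i -> cdom c q ->
  bd q <-> cmap c q 0 i = 0.
Proof.
move=> [ac cp p0 cM] cq; split=> [bq|q0]; last by exists c, i.
have : 0 <= cmap c q 0 i by apply/cM => //; exact: mboundary_sub.
rewrite le_eqVlt => /predU1P[//|q0].
exfalso; apply: (mboundary_not_interior bq).
have h : (fun z => cmap c z 0 i) @ q --> cmap c q 0 i.
  exact: (continuous_cvg (nbhs_filter q) (@coord_continuous i (cmap c q)) (cmap_continuous cq)).
have nq := cvgr_gt (cmap c q 0 i) h 0 q0.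
near=> z; apply/cM; first by near: z; exact: near_cdom.
by apply: ltW; near: z; exact: nq.
Unshelve. all: by end_near. Qed.

End Boundary.

Section Lines.
Context {R : realType}.

Lemma derive_mulmx n m (F : normedModType R) (f : 'rV[R]_m -> F) (T : 'M[R]_(n, m)) v w :
  'D_(w *m T) f (v *m T) = 'D_w (fun v => f (v *m T)) v.
Proof.
have e : (fun h : R => h^-1 *: ((f \o shift (v *m T)) (h *: (w *m T)) - f (v *m T))) =
    (fun h : R => h^-1 *: (((fun v => f (v *m T)) \o shift v) (h *: w) - f (v *m T))).
  by apply/funext => h; rewrite /= mulmxDl scalemxAl.
by rewrite /derive e.
Qed.

Lemma is_derive_line0 (E F : normedModType R) (f : E -> F) x u :
  differentiable f x -> is_derive (0 : R) 1 (fun s => f (x + s *: u)) ('D_u f x).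
Proof.
move=> df; have := @differentiable_line R E F f x u 0.
by rewrite scale0r addr0; apply.
Qed.

Lemma is_derive_fst_line (E F G : normedModType R) (f : E * F -> G) x t u :
  differentiable f (x, t) ->
  is_derive (0 : R) 1 (fun s : R => f (x + s *: u, t)) ('D_(u, 0) f (x, t)).
Proof.
move=> df; have := is_derive_line0 ((u, 0) : E * F) df.
rewrite (_ : (fun s => _) = (fun s : R => f (x + s *: u, t)))//.
apply/funext => s; rewrite -[(x, t) + _]/(x + s *: u, t + s *: 0).
by rewrite scaler0 addr0.
Qed.

Lemma is_derive_snd_line (E G : normedModType R) (f : E * R -> G) x (t : R) :
  differentiable f (x, t) ->
  is_derive t 1 (fun t : R => f (x, t)) ('D_(0, 1) f (x, t)).
Proof.
have E1 (s : R) : (x, 0) + s *: (0, 1) = (x, s) :> E * R.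
  by rewrite -[LHS]/(x + s *: 0, 0 + s * 1) scaler0 addr0 add0r mulr1.
move=> df; have := @differentiable_line R _ _ f (x, 0) (0, 1) t.
rewrite E1 => /(_ df).
by rewrite (_ : (fun s : R => _) = (fun t : R => f (x, t)))//; apply/funext => s; rewrite E1.
Qed.

End Lines.

Section Gauss.
Context {R : realType} {n : nat} {N : topologicalType}.
Variable S : smooth_structure R n N.
Variable M : set N.
Variable phi : N -> 'rV[R]_n -> R.
Hypothesis phi_finsler : finsler_metric S phi.
Variables (X : N -> 'rV[R]_n) (P : N -> R -> N).
Local Notation bd := (mboundary S M).
Hypothesis P_geodesic : forall q, bd q ->
  [/\ exists2 e : R, 0 < e & geodesic S phi `]-oo, e[ (P q),
      P q 0 = q & velocity S (P q) 0 = X q].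
Hypothesis X_unit : forall q, bd q -> phi q (X q) = 1.
Hypothesis P_smooth : forall c, atlas S c ->
  smooth_into S [set z : 'rV[R]_n * R |
     (cmap c @` (cdom c `&` bd)) z.1 /\ z.2 <= 0]
    (fun z => P (cinv c z.1) z.2).
Implicit Types (c : chart R n N) (p q : N).

Lemma P_speed q t : bd q -> t <= 0 -> speed S phi (P q) t = 1.
Proof.
move=> bq t0; have [[e e0 gP] P0 PX] := P_geodesic bq.
rewrite (geodesic_speed phi_finsler gP (le_lt_trans t0 e0) e0).
by rewrite /speed P0 PX X_unit.
Qed.

Variables (q0 : N) (c0 : chart R n N) (i0 : 'I_n).
Hypothesis c0_bd : boundary_chart S M q0 c0 i0.
Let x0 := cmap c0 q0.
Let ac0 : atlas S c0. Proof. by case: c0_bd. Qed.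
Let c0q : cdom c0 q0. Proof. by case: c0_bd. Qed.
Let bq0 : bd q0. Proof. by exists c0, i0. Qed.

Let W := [set z : 'rV[R]_n * R | (cmap c0 @` (cdom c0 `&` bd)) z.1 /\ z.2 <= 0].
Let F (z : 'rV[R]_n * R) := P (cinv c0 z.1) z.2.

Lemma boundary_slice x : cimg c0 x -> x 0 i0 = 0 -> (cmap c0 @` (cdom c0 `&` bd)) x.
Proof.
move=> cx x_0; rewrite image_cdomI; split=> //.
by apply/(mboundary_chartE c0_bd (cdom_cinv cx)); rewrite cinvK.
Qed.

(** Smoothness of the family [P] is known along [W] only, so derivatives are taken on a smooth
    extension [G] of its reading. The neighbourhood is shrunk so that [F] maps its part in [W] into
    the domain of [c1]. *)
Lemma backward_reading c1 t0 : atlas S c1 -> cdom c1 (P q0 t0) -> t0 <= 0 ->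
  exists (U : set ('rV[R]_n * R)) (G : 'rV[R]_n * R -> 'rV[R]_n),
    [/\ open U, U (x0, t0), forall k, Ck k U G &
        forall z, U z -> W z -> cdom c1 (F z) /\ G z = cmap c1 (F z)].
Proof.
move=> ac1 c1t t00; have [Pc Ps] := P_smooth ac0.
have Wz : W (x0, t0) by split=> //; exists q0.
have FE : F (x0, t0) = P q0 t0 by rewrite /F /= cmapK.
have [|U [G [oU Uz Gk GE]]] := Ps c1 ac1 (x0, t0).
  by split=> //; rewrite -/(F _) /= -/(F (x0, t0)) FE.
have near_c1 : \forall z \near (x0, t0), W z -> cdom c1 (F z).
  have nc : nbhs (F (x0, t0)) (cdom c1) by rewrite FE; exact: near_cdom.
  by have /subspace_continuousP/(_ _ Wz) := Pc; apply; exact: nc.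
pose U' := [set z | W z -> cdom c1 (F z)]°.
exists (U `&` U'), G; split.
- by apply: openI => //; exact: open_interior.
- by split=> //; exact: near_c1.
- by move=> k; apply: CkS (Gk k); exact: subIsetl.
- move=> z [Uz' U'z] Wz'; have c1z : cdom c1 (F z) := nbhs_singleton U'z Wz'.
  by split=> //; apply: GE.
Qed.

Variable e : 'rV[R]_n.
Hypothesis e_tangent : e 0 i0 = 0.

Definition boundary_line (s : R) : N := cinv c0 (x0 + s *: e).
Local Notation q := boundary_line.

Lemma boundary_line0 : q 0 = q0.
Proof. by rewrite /boundary_line scale0r addr0 cmapK. Qed.

Let line_cvg : (fun s : R => x0 + s *: e) @ (0 : R) --> x0.
Proof.
have h : is_derive (0 : R) 1 (fun s : R => x0 + s *: e) ('D_e id x0).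
  by apply: (is_derive_line0 (f := id)); apply: ex_diff.
have [d _] := h.
have H : (fun s : R => x0 + s *: e) @ (0 : R) --> x0 + (0 : R) *: e.
  exact: (differentiable_continuous ((derivable1_diffP _ _).1 d)).
by rewrite scale0r addr0 in H.
Qed.

Lemma near_boundary_line : \forall s \near (0 : R), cimg c0 (x0 + s *: e) /\ bd (q s).
Proof.
have H : \forall s \near (0 : R), cimg c0 (x0 + s *: e) := line_cvg (near_cimg (cimg_cmap c0q)).
near=> s; have cs : cimg c0 (x0 + s *: e) by near: s.
split=> //.
apply/(mboundary_chartE c0_bd (cdom_cinv cs)); rewrite cinvK// !mxE e_tangent mulr0 addr0.
by case: c0_bd.
Unshelve. all: by end_near. Qed.

Lemma near_line_W t : t <= 0 -> \forall s \near (0 : R), W (x0 + s *: e, t).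
Proof.
move=> t0'; near=> s; have [cs bs] : cimg c0 (x0 + s *: e) /\ bd (q s).
  by near: s; exact: near_boundary_line.
split; last exact: t0'.
by exists (q s); [split=> //; exact: cdom_cinv|exact: cinvK].
Unshelve. all: by end_near. Qed.

Definition jacobi_field t := velocity S (fun s => P (q s) t) 0.

(** Twice the pairing of the Jacobi field with the dual form of the velocity. No auxiliary chart
    [c1] occurs in it, so that local computations can be joined along the whole geodesic. *)
Definition gauss_form t :=
  'D_(jacobi_field t) (fun v => phi (P q0 t) v ^+ 2) (velocity S (P q0) t).

Section Reading.
Variables (c1 : chart R n N) (U : set ('rV[R]_n * R)) (G : 'rV[R]_n * R -> 'rV[R]_n).
Hypotheses (ac1 : atlas S c1) (oU : open U) (Gk : forall k, Ck k U G).
Hypothesis UG : forall z, U z -> W z -> cdom c1 (F z) /\ G z = cmap c1 (F z).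

Let Gd z : U z -> differentiable G z.
Proof. by move=> Uz; have [+ _] := Gk 1; apply. Qed.

Let DGd v z : U z -> differentiable ('D_v G) z.
Proof. by move=> Uz; have [_ /(_ v)[+ _]] := Gk 2; apply. Qed.

Let nearU z : U z -> \forall w \near z, U w.
Proof. by move=> Uz; exact: open_nbhs_nbhs. Qed.

Let line_pair_cvg (t : R) : (fun s : R => (x0 + s *: e, t)) @ (0 : R) --> (x0, t).
Proof.
have cc : (fun _ : R => t) @ (0 : R) --> t by exact: (@cvg_cst _ _ _ (nbhs (0 : R))).
exact: (cvg_to_pair (nbhs_filter (0 : R)) line_cvg cc).
Qed.

Let W0 t : t <= 0 -> W (x0, t).
Proof. by split=> //; exists q0. Qed.

Let F0 t : F (x0, t) = P q0 t. Proof. by rewrite /F /= cmapK. Qed.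

Lemma jacobi_field_reading t : U (x0, t) -> t <= 0 ->
  jacobi_field t = 'D_(e, 0) G (x0, t) *m to_at S (P q0 t) c1.
Proof.
move=> Ut t0.
have [c1t GE] := UG Ut (W0 t0).
rewrite F0 in c1t GE.
have nE : \forall s \near (0 : R), cdom c1 (P (q s) t) /\ G (x0 + s *: e, t) = cmap c1 (P (q s) t).
  have nU : \forall s \near (0 : R), U (x0 + s *: e, t) := line_pair_cvg (nearU Ut).
  have nW := near_line_W t0.
  by near=> s; apply: (UG (z := (x0 + s *: e, t))); near: s.
have dG := is_derive_fst_line e (Gd Ut).
have Gc : (fun s : R => G (x0 + s *: e, t)) @ (0 : R) --> G (x0, t).
  have [d _] := dG.
  have H : (fun s : R => G (x0 + s *: e, t)) @ (0 : R) --> G (x0 + (0 : R) *: e, t).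
    exact: (differentiable_continuous ((derivable1_diffP _ _).1 d)).
  by rewrite scale0r addr0 in H.
have dx : is_derive (0 : R) 1 (cmap c1 \o (fun s => P (q s) t)) ('D_(e, 0) G (x0, t)).
  by apply: near_eq_is_derive dG; apply: filterS nE => s [_ ->].
have cimgG : cimg c1 (G (x0, t)) by rewrite GE; exact: cimg_cmap.
have yc : {for (0 : R), continuous (fun s => P (q s) t)}.
  have h := continuous_cvg (nbhs_filter (0 : R)) (cinv_continuous cimgG) Gc.
  rewrite /prop_for /continuous_at boundary_line0.
  rewrite GE cmapK// in h.
  by apply: cvg_trans h; apply: near_eq_cvg; apply: filterS nE => s [cs /= ->]; rewrite cmapK.
have [dxd dxE] := dx.
have c1q : cdom c1 (P (q 0) t) by rewrite boundary_line0.
apply: (etrans (velocity_chart ac1 c1q yc dxd)).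
by rewrite derive1E dxE boundary_line0.
Unshelve. all: by end_near. Qed.

Let en t : t <= 0 -> exists2 I : set R, geodesic S phi I (P q0) & I° t.
Proof.
move=> t0; have [[e1 e10 gP] _ _] := P_geodesic bq0; exists `]-oo, e1[%classic => //.
by apply: open_nbhs_nbhs; split; [exact: interval_open|rewrite /= in_itv /= (le_lt_trans t0)].
Qed.

Let x t := cmap c1 (P q0 t).

Lemma gauss_form_reading t : U (x0, t) -> t <= 0 ->
  gauss_form t =
  'D_(0, 'D_(e, 0) G (x0, t)) (energy S phi c1) (x t, derive1 (cmap c1 \o P q0) t).
Proof.
move=> Ut t0; have [c1t _] := UG Ut (W0 t0); rewrite F0 in c1t.
have [I gI It] := en t0.
rewrite /gauss_form (jacobi_field_reading Ut t0) (velocity_smooth gI.1 It ac1 c1t).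
rewrite derive_mulmx derive_snd.
by rewrite /energy /tangent_reading /= /x cmapK.
Qed.

Lemma backward_velocity_neq0 t : U (x0, t) -> t <= 0 -> derive1 (cmap c1 \o P q0) t != 0.
Proof.
move=> Ut t0; have [c1t _] := UG Ut (W0 t0); rewrite F0 in c1t.
have [I gI It] := en t0.
have := P_speed bq0 t0; rewrite (speed_chart phi gI.1 It ac1 c1t).
apply: contra_eqN => /eqP ->; rewrite tangent_reading0//.
by rewrite eq_sym oner_eq0.
Qed.

(** First variation along the Jacobi field. It holds up to [t = 0], since the geodesic continues a
    little beyond and [G] is smooth around [(x0, 0)]; this yields continuity at the boundary. *)
Lemma gauss_reading_derive t : U (x0, t) -> t <= 0 ->
  is_derive t 1
    (fun t => 'D_(0, 'D_(e, 0) G (x0, t)) (energy S phi c1) (x t, derive1 (cmap c1 \o P q0) t))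
    ('D_('D_(e, 0) G (x0, t), 'D_(0, 1) ('D_(e, 0) G) (x0, t)) (energy S phi c1)
       (x t, derive1 (cmap c1 \o P q0) t)).
Proof.
move=> Ut t0; have [c1t _] := UG Ut (W0 t0); rewrite F0 in c1t.
have [I gI It] := en t0.
apply: (first_variation phi_finsler gI It ac1 c1t (J := fun t => 'D_(e, 0) G (x0, t))).
  exact: backward_velocity_neq0.
exact: (is_derive_snd_line (DGd _ Ut)).
Qed.

(* All the backward geodesics have unit speed, so the energy does not vary
   across the family. *)
Lemma gauss_reading_derive0 t : U (x0, t) -> t < 0 ->
  'D_('D_(e, 0) G (x0, t), 'D_(0, 1) ('D_(e, 0) G) (x0, t)) (energy S phi c1)
       (x t, derive1 (cmap c1 \o P q0) t) = 0.
Proof.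
move=> Ut t0; have t0' := ltW t0.
have [c1t GE] := UG Ut (W0 t0'); rewrite F0 in c1t GE.
have nU : \forall z \near (x0, t), differentiable G z.
  by apply: filterS (nearU Ut) => z; exact: Gd.
(* Once the two derivatives are exchanged, the direction is the [s]-derivative of the position and
   velocity of the geodesics, and the whole expression is the [s]-derivative of their energy. *)
rewrite (schwarz_rV nU (DGd (e, 0) Ut) (DGd (0, 1) Ut)).
(* Here [t < 0] matters: the derivative is two-sided and [G] is tied to the geodesics for
   nonpositive times only. *)
have tder s : U (x0 + s *: e, t) -> W (x0 + s *: e, t) ->
    derive1 (cmap c1 \o P (q s)) t = 'D_(0, 1) G (x0 + s *: e, t).
  move=> Us [Ws _]; have [_ <-] := is_derive_snd_line (Gd Us).
  rewrite derive1E; apply: near_eq_derive.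
  have cc : (fun r : R => (x0 + s *: e, r)) @ t --> (x0 + s *: e, t).
    by apply: cvg_to_pair; [exact: (@cvg_cst _ _ _ (nbhs t))|exact: cvg_id].
  have nU' : \forall r \near t, U (x0 + s *: e, r) := cc _ (nearU Us).
  near=> r; rewrite /=; apply/esym.
  have Ur : U (x0 + s *: e, r) by near: r.
  have Wr : W (x0 + s *: e, r).
    by split; [exact: Ws|apply: ltW; near: r; exact: lt_nbhsl].
  by have [_ ->] := UG Ur Wr.
have nUs : \forall s \near (0 : R), U (x0 + s *: e, t) := line_pair_cvg (nearU Ut).
have nWs := near_line_W t0'.
have dE : differentiable (energy S phi c1) (G (x0 + 0 *: e, t), 'D_(0, 1) G (x0 + 0 *: e, t)).
  have U0 := nbhs_singleton nUs; have W0' := nbhs_singleton nWs.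
  rewrite -(tder _ U0 W0') boundary_line0 scale0r addr0.
  apply: energy_differentiable => //; first by rewrite GE; exact: cimg_cmap.
  exact: backward_velocity_neq0.
have d1 := is_derive_fst_line e (Gd Ut).
have d2 := is_derive_fst_line e (DGd (0, 1) Ut).
have [d3 d3E] := is_derive_to_pair d1 d2.
have [_ d4] := derive1_comp_rV d3 dE.
rewrite (etrans (derive1E _ _) d3E) in d4.
have xE : (x t, derive1 (cmap c1 \o P q0) t) = (G (x0 + 0 *: e, t), 'D_(0, 1) G (x0 + 0 *: e, t)).
  have U0 := nbhs_singleton nUs; have W0' := nbhs_singleton nWs.
  by rewrite -(tder _ U0 W0') boundary_line0 scale0r addr0 GE.
rewrite xE; apply: (etrans (esym d4)).
apply: (etrans _ (derive_cst (1 : R) (0 : R) (1 : R))).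
apply: near_eq_derive; near=> s.
have Us : U (x0 + s *: e, t) by near: s.
have Ws : W (x0 + s *: e, t) by near: s.
have bs : bd (q s) by have [] : cimg c0 (x0 + s *: e) /\ bd (q s) by near: s; exact: near_boundary_line.
rewrite /= -(tder _ Us Ws).
have [c1s GEs] := UG Us Ws.
have [[es es0 gs] _ _] := P_geodesic bs.
have Is : (`]-oo, es[%classic)° t.
  by apply: open_nbhs_nbhs; split; [exact: interval_open|rewrite /= in_itv /= (lt_trans t0)].
rewrite GEs /energy /F /= -(speed_chart phi gs.1 Is ac1 c1s) (P_speed bs t0').
by rewrite expr1n.
Unshelve. all: by end_near. Qed.

End Reading.

(** At time [0] the reading agrees with [gauss_form] from the left only. This still gives continuity
    on the closed interval, and the derivative vanishes in its interior. *)
Lemma gauss_form_const t : t <= 0 -> gauss_form t = gauss_form 0.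
Proof.
move=> t0.
have local (r : R) : r <= 0 -> exists (B : R -> R), 
    [/\ \forall s \near r, s <= 0 -> gauss_form s = B s, {for r, continuous B} &
        r < 0 -> is_derive r 1 B 0].
  move=> r0; have ac1 := atlas_chart_at S (P q0 r); have c1r := cdom_chart_at S (P q0 r).
  have [U [G [oU Ur Gk UG]]] := backward_reading ac1 c1r r0.
  set B := fun t : R => 'D_(0, 'D_(e, 0) G (x0, t)) (energy S phi (chart_at S (P q0 r)))
    (cmap (chart_at S (P q0 r)) (P q0 t), derive1 (cmap (chart_at S (P q0 r)) \o P q0) t).
  have dB := gauss_reading_derive ac1 Gk UG Ur r0.
  exists B; split.
  - have cc : (fun s : R => (x0, s)) @ r --> (x0, r).
      by apply: cvg_to_pair; [exact: (@cvg_cst _ _ _ (nbhs r))|exact: cvg_id].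
    have nU : \forall s \near r, U (x0, s) := cc _ (open_nbhs_nbhs (conj oU Ur)).
    by apply: filterS nU => s Us s0; exact: (gauss_form_reading ac1 oU Gk UG Us s0).
  - have [d _] := dB.
    exact: (differentiable_continuous ((derivable1_diffP _ _).1 d)).
  - by move=> r_lt0; move: dB; rewrite (gauss_reading_derive0 ac1 oU Gk UG Ur r_lt0).
apply: derivative0_eq => //.
  apply/subspace_continuousP => r; rewrite /= in_itv /= => /andP[_ r0].
  have [B [BE Bc _]] := local r r0.
  have e1 := nbhs_singleton BE r0.
  suff : gauss_form @ within `[t, 0] (nbhs r) --> B r by rewrite -e1; exact.
  have Bc' : B @ within `[t, 0] (nbhs r) --> B r.
    by apply: cvg_trans Bc; apply: cvg_app; exact: cvg_within.
  apply: cvg_trans Bc'; apply: near_eq_cvg; rewrite near_withinE.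
  by apply: filterS BE => s h; rewrite /= in_itv /= => /andP[_ s0]; exact/esym/h.
move=> r; rewrite in_itv /= => /andP[_ r0].
have [B [BE _ /(_ r0) dB]] := local r (ltW r0).
apply: near_eq_is_derive dB; near=> s.
by apply/esym; have h := near BE s; apply: h => //; apply: ltW; near: s; exact: lt_nbhsl.
Unshelve. all: by end_near. Qed.

End Gauss.

(** * Continuity of the foot and the time at the boundary *)

Section ClosedBall.
Context {R : realType}.

Lemma le_ball_closed (E : normedModType R) (x : E) (d : R) :
  closed [set z | `|z - x| <= d].
Proof.
rewrite (_ : [set z | _] = (fun z => `|z - x|) @^-1` [set r | r <= d])//.
apply: preimage_closed; last exact: closed_le.
move=> z _; apply: (continuous_cvg (nbhs_filter z) (@norm_continuous _ _ _)).
by apply: cvgB; [exact: cvg_id|exact: (@cvg_cst _ _ _ (nbhs z))].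
Qed.

Lemma le_ball_compact n (x : 'rV[R]_n) (d : R) : compact [set z | `|z - x| <= d].
Proof.
apply: bounded_closed_compact; last exact: le_ball_closed.
exists (`|x| + d); split; first exact: num_real.
move=> r xr z /= zx; rewrite -[z](subrK x); apply: le_trans (ler_normD _ _) _.
by apply: ltW; apply: le_lt_trans xr; rewrite addrC lerD2l.
Qed.

Lemma norm_sub_lt_open (E : normedModType R) (x : E) (r : R) :
  open [set z | `|z - x| < r].
Proof.
rewrite openE => z /= zr; apply/nbhs_ballP; exists (r - `|z - x|) => /=.
  by rewrite subr_gt0.
move=> w; rewrite -ball_normE /= => zw.
rewrite (_ : w - x = (w - z) + (z - x)); last by rewrite addrA subrK.
by apply: le_lt_trans (ler_normD _ _) _; rewrite distrC; lra.
Qed.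

Lemma segment_in_ball (E : normedModType R) (x a b : E) (r s : R) :
  `|a - x| < r -> `|b - x| < r -> 0 <= s <= 1 -> `|a + s *: (b - a) - x| < r.
Proof.
move=> ar br /andP[s0 s1].
have -> : a + s *: (b - a) - x = (1 - s) *: (a - x) + s *: (b - x).
  rewrite addrAC (_ : b - a = (b - x) - (a - x)); last by rewrite opprB addrA subrK.
  by rewrite scalerBr scalerBl scale1r addrA addrAC.
apply: le_lt_trans (ler_normD _ _) _; rewrite !normrZ !ger0_norm ?subr_ge0//.
apply: (@le_lt_trans _ _ (Num.max `|a - x| `|b - x|)); last by rewrite gt_max ar.
have : `|a - x| <= Num.max `|a - x| `|b - x| by rewrite le_max lexx.
have : `|b - x| <= Num.max `|a - x| `|b - x| by rewrite le_max lexx orbT.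
move: (Num.max _ _) => m; nra.
Qed.

End ClosedBall.

Section Extension.
Context {R : realType} {n : nat} {N : topologicalType}.
Variable S : smooth_structure R n N.
Hypothesis N_hausdorff : hausdorff_space N.
Variable M : set N.
Hypothesis M_domain : regular_domain S M.
Variable phi : N -> 'rV[R]_n -> R.
Hypothesis phi_finsler : finsler_metric S phi.
Variables (X : N -> 'rV[R]_n) (P : N -> R -> N).
Local Notation bd := (mboundary S M).
Hypothesis P_geodesic : forall q, bd q ->
  [/\ exists2 e : R, 0 < e & geodesic S phi `]-oo, e[ (P q),
      P q 0 = q & velocity S (P q) 0 = X q].
Hypothesis X_unit : forall q, bd q -> phi q (X q) = 1.
Hypothesis P_smooth : forall c, atlas S c ->
  smooth_into S [set z : 'rV[R]_n * R |
     (cmap c @` (cdom c `&` bd)) z.1 /\ z.2 <= 0]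
    (fun z => P (cinv c z.1) z.2).
Variables (foot : N -> N) (time : N -> R).
Hypothesis foot_P : forall q (t : R), bd q -> t < 0 ->
  [/\ ~ M (P q t), foot (P q t) = q & time (P q t) = t].
Hypothesis P_foot : forall p, ~ M p ->
  [/\ bd (foot p), time p < 0 & P (foot p) (time p) = p].
Hypothesis foot_smooth : forall c, atlas S c ->
  smooth_into S (cmap c @` (cdom c `&` ~` M)) (foot \o cinv c).
Hypothesis time_smooth : smooth_from S (~` M) time.
Implicit Types (c : chart R n N) (p q : N).

Lemma M_closed : closed M. Proof. by case: M_domain. Qed.

Lemma outside_open : open (~` M).
Proof. by apply: closed_openC; exact: M_closed. Qed.

Lemma near_outside p : ~ M p -> \forall q \near p, ~ M q.
Proof. by move=> Mp; apply: open_nbhs_nbhs; split=> //; exact: outside_open. Qed.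

Lemma outside_image_interior c p : cdom c p -> ~ M p ->
  (cmap c @` (cdom c `&` ~` M))° (cmap c p).
Proof.
move=> cp Mp; apply: open_nbhs_nbhs; split; last by exists p.
by apply: image_cdomI_open; exact: outside_open.
Qed.

Lemma foot_continuous p : ~ M p -> {for p, continuous foot}.
Proof.
move=> Mp; pose c := chart_at S p.
have cp : cdom c p := cdom_chart_at S p.
have h := smooth_into_continuous (foot_smooth (atlas_chart_at S p)) (outside_image_interior cp Mp).
have h' := continuous_cvg (nbhs_filter p) h (cmap_continuous cp).
rewrite /= cmapK// in h'.
apply: cvg_trans h'; apply: near_eq_cvg; apply: filterS (near_cdom cp) => q cq.
by rewrite /= cmapK.
Qed.

Lemma time_differentiable c p : atlas S c -> cdom c p -> ~ M p ->
  differentiable (time \o cinv c) (cmap c p).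
Proof.
move=> ac cp Mp.
have [+ _] := smooth_on_Ck 1 (image_cdomI_open outside_open) (time_smooth ac).
by apply; exists p.
Qed.

Lemma time_continuous p : ~ M p -> {for p, continuous time}.
Proof.
move=> Mp; have cp := cdom_chart_at S p.
have h := differentiable_continuous (time_differentiable (atlas_chart_at S p) cp Mp).
have h' := continuous_cvg (nbhs_filter p) h (cmap_continuous cp).
rewrite /= cmapK// in h'.
apply: cvg_trans h'; apply: near_eq_cvg; apply: filterS (near_cdom cp) => q cq.
by rewrite /= cmapK.
Qed.

Lemma foot_differentiable c c' p : atlas S c -> atlas S c' -> cdom c p ->
  cdom c' (foot p) -> ~ M p ->
  differentiable (cmap c' \o (foot \o cinv c)) (cmap c p).
Proof.
move=> ac ac' cp c'p Mp.
have [+ _] := smooth_into_Ck 1 (foot_smooth ac) ac'; apply; split.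
  exact: outside_image_interior.
by rewrite /= cmapK.
Qed.

Lemma P_eq_boundary q t p : bd q -> t <= 0 -> M p -> P q t = p -> q = p /\ t = 0.
Proof.
move=> bq; rewrite le_eqVlt => /predU1P[->|t0] Mp e.
  by split=> //; have [_ <- _] := P_geodesic bq.
by have [+ _ _] := foot_P bq t0; rewrite e.
Qed.

Section BoundaryPoint.
Variables (p : N) (c : chart R n N) (i : 'I_n).
Hypothesis c_bd : boundary_chart S M p c i.
Let x0 := cmap c p.
Let ac : atlas S c. Proof. by case: c_bd. Qed.
Let cp : cdom c p. Proof. by case: c_bd. Qed.
Let bp : bd p. Proof. by exists c, i. Qed.

Let W := [set z : 'rV[R]_n * R | (cmap c @` (cdom c `&` bd)) z.1 /\ z.2 <= 0].
Let Q (z : 'rV[R]_n * R) := P (cinv c z.1) z.2.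

Variable d : R.
Hypothesis d0 : 0 < d.
Hypothesis d_cimg : forall x, `|x - x0| <= d -> cimg c x.

Let box := [set x : 'rV[R]_n | `|x - x0| <= d].

(* The part of the boundary of the box [slice * `[- d, 0]] away from the
   slice [t = 0]. *)
Let rim := [set z : 'rV[R]_n * R | box z.1 /\ z.1 0 i = 0 /\ (- d <= z.2 <= 0) /\
  (`|z.1 - x0| = d \/ z.2 = - d)].

Let rim_W : rim `<=` W.
Proof.
move=> z [bz [zi [/andP[_ z0] _]]]; split=> //.
by apply: (boundary_slice c_bd) => //; exact: d_cimg.
Qed.

Let fst_cont : continuous (fst : 'rV[R]_n * R -> 'rV[R]_n).
Proof. by move=> z; exact: (@cvg_fst _ _ (nbhs z.1) (nbhs z.2)). Qed.

Let snd_cont : continuous (snd : 'rV[R]_n * R -> R).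
Proof. by move=> z; exact: (@cvg_snd _ _ (nbhs z.1) (nbhs z.2)). Qed.

Let rim_compact : compact rim.
Proof.
have cb : compact (box `*` `[- d, 0]%classic).
  by apply: compact_setX; [exact: le_ball_compact|exact: segment_compact].
apply: subclosed_compact cb _; last first.
  by move=> z [bz [_ [z2 _]]]; split=> //=; rewrite in_itv.
have cN (r : R) : closed [set z : 'rV[R]_n * R | `|z.1 - x0| = r].
  rewrite (_ : [set z | _] = (fun z : 'rV[R]_n * R => `|z.1 - x0|) @^-1` [set r])//.
  apply: preimage_closed; last exact: closed_eq.
  move=> z _; apply: (continuous_cvg (nbhs_filter z) (@norm_continuous _ _ _)).
  by apply: cvgB; [exact: fst_cont|exact: (@cvg_cst _ _ _ (nbhs z))].
have cS (A : set R) : closed A -> closed [set z : 'rV[R]_n * R | A z.2].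
  by move=> cA; apply: (preimage_closed (f := snd)) => // z _; exact: snd_cont.
have cF (A : set 'rV[R]_n) : closed A -> closed [set z : 'rV[R]_n * R | A z.1].
  by move=> cA; apply: (preimage_closed (f := fst)) => // z _; exact: fst_cont.
rewrite (_ : rim = [set z | box z.1] `&` ([set z | (z.1 : 'rV[R]_n) 0 i = 0] `&`
   ([set z | `[- d, 0]%classic z.2] `&` ([set z | `|z.1 - x0| = d] `|` [set z | z.2 = - d])))); last first.
  by apply/seteqP; split=> z /=; rewrite in_itv.
apply: closedI; first exact: (cF box (@le_ball_closed _ _ x0 d)).
apply: closedI.
  apply: (cF [set x | x 0 i = 0]).
  apply: (preimage_closed (f := fun x : 'rV[R]_n => x 0 i) (D := [set 0])); last exact: closed_eq.
  by move=> x _; exact: coord_continuous.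
apply: closedI; first by apply: cS; exact: interval_closed.
by apply: closedU; [exact: cN|apply: (cS [set - d]); exact: closed_eq].
Qed.

Let rim_image_closed : closed (Q @` rim).
Proof.
apply: (compact_closed N_hausdorff); apply: continuous_compact rim_compact.
by have [+ _] := P_smooth ac; apply: continuous_subspaceW; exact: rim_W.
Qed.

(** A backward geodesic meets [M] at its starting point only, so [p] could only be the image of
    [(x0, 0)], which is not on the rim. *)
Let rim_image_p : ~ (Q @` rim) p.
Proof.
move=> [z zr Qz]; have [bz [zi [/andP[_ z0] zd]]] := zr.
have cz : cimg c z.1 by exact: d_cimg.
have bq : bd (cinv c z.1).
  by have [+ _] := rim_W zr; rewrite image_cdomI => -[].
have [qE tE] := P_eq_boundary bq z0 (mboundary_sub bp) Qz.
have zx : z.1 = x0 by rewrite -[LHS](cinvK cz) qE.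
case: zd => [|]; rewrite ?zx ?tE.
  by rewrite subrr normr0 => d00; move: d0; rewrite -d00 ltxx.
by move/eqP; rewrite eq_sym oppr_eq0 gt_eqF.
Qed.

Let good p' := [/\ cdom c (foot p'), `|cmap c (foot p') - x0| < d & - d < time p'].

Let box_image_closed : closed (cinv c @` box).
Proof.
have cb : compact box by exact: le_ball_compact.
apply: (compact_closed N_hausdorff); apply: continuous_compact cb.
apply/subspace_continuousP => x bx.
have h : cinv c @ x --> cinv c x := cinv_continuous (d_cimg bx).
by apply: cvg_trans h; apply: cvg_app; exact: cvg_within.
Qed.

Let good_open p' : ~ M p' -> good p' -> \forall q \near p', good q.
Proof.
move=> Mp' [g1 g2 g3].
have h1 : \forall q \near p', cdom c (foot q) := foot_continuous Mp' (near_cdom g1).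
have h2 : \forall q \near p', `|cmap c (foot q) - x0| < d.
  have fc := continuous_cvg (nbhs_filter p') (cmap_continuous g1) (foot_continuous Mp').
  exact: (fc _ (open_nbhs_nbhs (conj (norm_sub_lt_open x0 d) g2))).
have h3 : \forall q \near p', - d < time q.
  by have := time_continuous Mp'; move/cvgr_gt; apply.
by near=> q; split; near: q.
Unshelve. all: by end_near. Qed.

(** Off the image of the rim, a point that is not [good] has its time below [- d] or its foot
    outside the closed box, and both conditions are open. *)
Let bad_open p' : ~ M p' -> ~ (Q @` rim) p' -> ~ good p' -> \forall q \near p', ~ good q.
Proof.
move=> Mp' rp' ngood; have [bf t0 Pf] := P_foot Mp'.
have [tlow|tlow] := ltP (time p') (- d).
  have : \forall q \near p', time q < - d.
    by have := time_continuous Mp'; move/cvgr_lt; apply.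
  by apply: filterS => q tq [_ _]; rewrite ltNge (ltW tq).
have nb : ~ (cinv c @` box) (foot p').
  move=> [x bx xf]; have cx := d_cimg bx.
  have fx : cmap c (foot p') = x by rewrite -xf cinvK.
  have cf : cdom c (foot p') by rewrite -xf; exact: cdom_cinv.
  apply: rp'; exists (x, time p'); last by rewrite /Q /= xf.
  split=> //=; split.
    by rewrite -fx; apply/(mboundary_chartE c_bd cf).
  split; first by rewrite tlow ltW.
  have [xd|xd] := eqVneq `|x - x0| d; first by left.
  have [td|td] := eqVneq (time p') (- d); first by right.
  exfalso; apply: ngood; split=> //; first by rewrite fx lt_neqAle xd.
  by rewrite lt_neqAle eq_sym td.
have : \forall q \near p', ~ (cinv c @` box) (foot q).
  have h : nbhs (foot p') (~` (cinv c @` box)).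
    apply: open_nbhs_nbhs; split=> //.
    by apply: closed_openC; exact: box_image_closed.
  exact: (foot_continuous Mp' h).
apply: filterS => q nq [cf fd _]; apply: nq.
by exists (cmap c (foot q)); [exact: ltW|exact: cmapK].
Qed.

(** Near [p] the image of the rim is avoided, so that among points outside [M] being [good] is both
    open and closed. The outer half of a chart ball is convex and contains a good point, hence
    consists of good points. *)
Lemma foot_time_near : \forall p' \near p, ~ M p' -> good p'.
Proof.
have [r r0 Hr] : exists2 r : R, 0 < r & forall x, `|x - x0| < r ->
    cimg c x /\ ~ (Q @` rim) (cinv c x).
  have : \forall x \near x0, cimg c x /\ ~ (Q @` rim) (cinv c x).
    have h1 := near_cimg (cimg_cmap cp).
    have h2 : \forall x \near x0, ~ (Q @` rim) (cinv c x).
      apply: (@near_cinv _ _ _ c x0 (~` (Q @` rim)) (cimg_cmap cp)).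
      rewrite cmapK//; apply: open_nbhs_nbhs; split; last exact: rim_image_p.
      by apply: closed_openC; exact: rim_image_closed.
    by near=> x; split; near: x.
  move=> /nbhs_ballP[r /= r0 Hr]; exists r => // x xr; apply: Hr.
  by rewrite -ball_normE /= distrC.
have [[e e0 gP] P0 _] := P_geodesic bp.
have Pc : P p @ (0 : R) --> p.
  rewrite -[X in _ --> X]P0; apply: smooth_into_continuous gP.1 _.
  by apply: open_nbhs_nbhs; split; [exact: interval_open|rewrite /= in_itv].
(* The point [P p t] serves as the good base point: its foot is [p] and its time [t] exceeds
   [- d]. *)
have [t [t0 td ct xt]] : exists t, [/\ t < 0, - d < t, cdom c (P p t) & `|cmap c (P p t) - x0| < r].
  have h1 : \forall t \near (0 : R), cdom c (P p t) := Pc _ (near_cdom cp).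
  have h2 : \forall t \near (0 : R), `|cmap c (P p t) - x0| < r.
    have h := continuous_cvg (nbhs_filter (0 : R)) (cmap_continuous cp) Pc.
    apply: (h _ (open_nbhs_nbhs (conj (norm_sub_lt_open x0 r) _))).
    by rewrite /= subrr normr0.
  near (0 : R)^'- => t; exists t; split.
  - by near: t; exact: nbhs_left_lt.
  - by near: t; apply: nbhs_left_gt; rewrite oppr_lt0.
  - by near: t; apply: cvg_within; exact: h1.
  - by near: t; apply: cvg_within; exact: h2.
have [nMt ft tt] := foot_P bp t0.
have cM q : cdom c q -> M q <-> 0 <= cmap c q 0 i by case: c_bd => _ _ _; exact.
pose x1 := cmap c (P p t).
have x1i : x1 0 i < 0.
  by rewrite ltNge; apply/negP => x10; apply: nMt; apply/cM.
have nr : \forall q \near p, `|cmap c q - x0| < r.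
  have h : nbhs (cmap c p) [set x | `|x - x0| < r].
    apply: open_nbhs_nbhs; split; first exact: norm_sub_lt_open.
    by rewrite /= subrr normr0.
  exact: (cmap_continuous cp h).
near=> p' => nMp'.
have cp' : cdom c p' by near: p'; exact: near_cdom.
have xr : `|cmap c p' - x0| < r by near: p'.
have x'i : cmap c p' 0 i < 0.
  by rewrite ltNge; apply/negP => x10; apply: nMp'; apply/cM.
(* The segment joins two points with negative transverse coordinate, so it stays outside [M]. *)
pose sg (s : R) := x1 + s *: (cmap c p' - x1).
have sgr s : 0 <= s <= 1 -> `|sg s - x0| < r by exact: segment_in_ball.
have sgM s : 0 <= s <= 1 -> ~ M (cinv c (sg s)).
  move=> s01; have [cs _] := Hr _ (sgr _ s01).
  move=> /(cM _ (cdom_cinv cs)); rewrite cinvK// !mxE.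
  by case/andP: s01 => ? ?; nra.
have sgc s : 0 <= s <= 1 -> {for s, continuous (cinv c \o sg)}.
  move=> s01; have [cs _] := Hr _ (sgr _ s01).
  have sc : {for s, continuous sg}.
    have [|dd _] := @differentiable_line R _ _ id x1 (cmap c p' - x1) s; first by apply: ex_diff.
    exact: (differentiable_continuous ((derivable1_diffP _ _).1 dd)).
  exact: (continuous_cvg (nbhs_filter s) (cinv_continuous cs) sc).
pose Z := [set s : R | good (cinv c (sg s))].
have ZE : `[0, 1]%classic `&` Z = `[0, 1]%classic.
  apply: (@segment_connected R 0 1).
  - exists 0; split; first by rewrite /= in_itv /= lexx ler01.
    by rewrite /Z /= /sg scale0r addr0 cmapK//; split; rewrite ?ft ?tt// subrr normr0.
  - exists (Z°); first exact: open_interior.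
    apply/seteqP; split=> s [s01 Zs]; split=> //; last exact: nbhs_singleton Zs.
    have s01' : 0 <= s <= 1 by move: s01; rewrite /= in_itv.
    exact: (sgc s s01' _ (good_open (sgM _ s01') Zs)).
  - exists (~` (~` Z)°); first by apply: open_closedC; exact: open_interior.
    apply/seteqP; split=> s [s01 Zs]; split=> //.
      by move=> /nbhs_singleton.
    have s01' : 0 <= s <= 1 by move: s01; rewrite /= in_itv.
    apply: contrapT => nZs; apply: Zs.
    have [_ rs] := Hr _ (sgr _ s01').
    exact: (sgc s s01' _ (bad_open (sgM _ s01') rs nZs)).
have : (`[0, 1]%classic `&` Z) 1 by rewrite ZE /= in_itv /= lexx ler01.
by rewrite /Z /= /sg scale1r addrC subrK cmapK// => -[].
Unshelve. all: by end_near. Qed.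

End BoundaryPoint.

End Extension.

(** * The extended solution outside M *)

Section ChartLine.
Context {R : realType} {n : nat} {N : topologicalType}.
Variable S : smooth_structure R n N.
Implicit Types (c : chart R n N) (x v : 'rV[R]_n).

Lemma cinv_smooth c : atlas S c -> smooth_into S (cimg c) (cinv c).
Proof.
move=> ac; split.
  apply/subspace_continuousP => x cx.
  have h : cinv c @ x --> cinv c x := cinv_continuous cx.
  by apply: cvg_trans h; apply: cvg_app; exact: cvg_within.
move=> c' ac'; have := transition_smooth ac ac'.
by rewrite /smooth_transition image_cdomI.
Qed.

Lemma line_differentiable (E : normedModType R) (x v : E) (s : R) :
  differentiable (fun s : R => x + s *: v) s.
Proof.
apply/derivable1_diffP.
by have [] := @differentiable_line R _ _ id x v s; first by apply: ex_diff.
Qed.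

Lemma line_smooth c x v (I : set R) : atlas S c ->
  (forall s, I s -> cimg c (x + s *: v)) ->
  smooth_into S I (fun s => cinv c (x + s *: v)).
Proof.
move=> ac H.
have h := @smooth_into_affine R n N S _ _ (fun s : R => x + s *: v) (fun s => s *: v) _ _ _ (line_differentiable x v) (cinv_smooth ac).
apply: smooth_intoW (h _) => //.
by move=> r a b; rewrite scalerDl addrCA scalerA.
Qed.

Lemma line_derive1 c x v (s : R) : cimg c (x + s *: v) ->
  is_derive s 1 (cmap c \o (fun s => cinv c (x + s *: v))) v.
Proof.
move=> cs.
have h : is_derive s 1 (fun s => x + s *: v) v.
  exact: (is_derive_line (is_derive_id (x + s *: v) v)).
apply: near_eq_is_derive h.
have lc := differentiable_continuous (line_differentiable x v s).
have nc : \forall r \near s, cimg c (x + r *: v) := lc _ (near_cimg cs).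
by apply: filterS nc => r cr; rewrite /= cinvK.
Qed.

Lemma line_velocity c x v (I : set R) s : atlas S c ->
  (forall s, I s -> cimg c (x + s *: v)) -> I° s ->
  velocity S (fun s => cinv c (x + s *: v)) s = v *m to_at S (cinv c (x + s *: v)) c.
Proof.
move=> ac H Is; have cs := H _ (nbhs_singleton Is).
rewrite (velocity_smooth (line_smooth ac H) Is ac (cdom_cinv cs)).
by have [_ e] := line_derive1 cs; rewrite derive1E e.
Qed.

Lemma line_speed phi c x v (I : set R) s : atlas S c ->
  (forall s, I s -> cimg c (x + s *: v)) -> I° s ->
  speed S phi (fun s => cinv c (x + s *: v)) s = tangent_reading S phi c (x + s *: v, v).
Proof. by move=> ac H Is; rewrite /speed (line_velocity ac H Is). Qed.

End ChartLine.

Section Solution.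
Context {R : realType} {n : nat} {N : topologicalType}.
Variable S : smooth_structure R n N.
Hypothesis N_hausdorff : hausdorff_space N.
Variable M : set N.
Hypothesis M_domain : regular_domain S M.
Variable phi : N -> 'rV[R]_n -> R.
Hypothesis phi_finsler : finsler_metric S phi.
Variable g : N -> R.
Local Notation bd := (mboundary S M).
Hypothesis g_smooth : smooth_from S bd g.
Variables (X : N -> 'rV[R]_n) (P : N -> R -> N).
Hypothesis X_char : forall q, bd q -> characteristic_vector S phi M g q (X q).
Hypothesis P_geodesic : forall q, bd q ->
  [/\ exists2 e : R, 0 < e & geodesic S phi `]-oo, e[ (P q),
      P q 0 = q & velocity S (P q) 0 = X q].
Hypothesis P_smooth : forall c, atlas S c ->
  smooth_into S [set z : 'rV[R]_n * R |
     (cmap c @` (cdom c `&` bd)) z.1 /\ z.2 <= 0]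
    (fun z => P (cinv c z.1) z.2).
Variables (foot : N -> N) (time : N -> R).
Hypothesis foot_P : forall q (t : R), bd q -> t < 0 ->
  [/\ ~ M (P q t), foot (P q t) = q & time (P q t) = t].
Hypothesis P_foot : forall p, ~ M p ->
  [/\ bd (foot p), time p < 0 & P (foot p) (time p) = p].
Hypothesis foot_smooth : forall c, atlas S c ->
  smooth_into S (cmap c @` (cdom c `&` ~` M)) (foot \o cinv c).
Hypothesis time_smooth : smooth_from S (~` M) time.
Variables (u ut : N -> R).
Hypothesis u_continuous : {within M, continuous u}.
Hypothesis u_boundary : forall q, bd q -> u q = g q.
Hypothesis u_value : value_function S phi M g u.
Hypothesis ut_M : forall p, M p -> ut p = u p.
Hypothesis ut_P : forall q (t : R), bd q -> t < 0 -> ut (P q t) = g q + t.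
Implicit Types (c : chart R n N) (p q : N).

Let X_unit q : bd q -> phi q (X q) = 1.
Proof. by move=> /X_char[]. Qed.

Lemma ut_outside p : ~ M p -> ut p = g (foot p) + time p.
Proof. by move=> Mp; have [bf t0 e] := P_foot Mp; rewrite -{1}e ut_P. Qed.

Lemma g_reading q c i : boundary_chart S M q c i ->
  exists (U : set 'rV[R]_n) (G : 'rV[R]_n -> R),
    [/\ open U, U (cmap c q), forall k, Ck k U G &
      forall p, bd p -> cdom c p -> U (cmap c p) -> G (cmap c p) = g p].
Proof.
move=> cb; have [ac cq _ _] := cb.
have [|U [G [oU Uq Gk GE]]] := g_smooth ac (x := cmap c q).
  by exists q => //; split=> //; exists c, i.
exists U, G; split=> // p bp cp Up; rewrite GE//= ?cmapK//.
by exists p.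
Qed.

Let footc p := foot_continuous M_domain foot_smooth (p := p).
Let timec p := time_continuous M_domain time_smooth (p := p).

(** At a boundary point, the continuity of [u] controls the approach through [M], and
    [foot_time_near] the approach through the complement, where [ut] is [g] at the foot plus the
    time. *)
Lemma ut_continuous : continuous ut.
Proof.
move=> p; have [Mp|Mp] := pselect (M p); last first.
  have [bf t0 e] := P_foot Mp; have [c [i cb]] := bf; have [ac cf _ _] := cb.
  have [U [G [oU Uf Gk GE]]] := g_reading cb.
  have fc := continuous_cvg (nbhs_filter p) (cmap_continuous cf) (footc Mp).
  have Gc : {for cmap c (foot p), continuous G} by apply: (Gk 0).
  have h1 : (fun q => G (cmap c (foot q)) + time q) @ p --> G (cmap c (foot p)) + time p.
    exact: (cvgD (continuous_cvg (nbhs_filter p) Gc fc) (timec Mp)).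
  have nE : \forall q \near p, G (cmap c (foot q)) + time q = ut q.
    have n1 := near_outside M_domain Mp.
    have n2 : \forall q \near p, cdom c (foot q) := footc Mp (near_cdom cf).
    have n3 : \forall q \near p, U (cmap c (foot q)) := fc _ (open_nbhs_nbhs (conj oU Uf)).
    near=> q; have Mq : ~ M q by near: q.
    rewrite ut_outside// GE//; [|near: q..]; last 2 first.
    - exact: n2.
    - exact: n3.
    by have [] := P_foot Mq.
  rewrite /continuous_at -(nbhs_singleton nE).
  exact: (cvg_trans (near_eq_cvg nE) h1).
have uc : u @ within M (nbhs p) --> u p by have /subspace_continuousP := u_continuous; apply.
have [_ /(_ p Mp)[Mi|bp]] := M_domain.
  rewrite /continuous_at ut_M//.
  rewrite within_interior// in uc.
  by apply: cvg_trans uc; apply: near_eq_cvg; apply: filterS Mi => q Mq; rewrite ut_M.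
have [c [i cb]] := bp; have [ac cp _ _] := cb.
have [U [G [oU Up Gk GE]]] := g_reading cb.
have Gc : {for cmap c p, continuous G} by apply: (Gk 0).
apply/cvgrPdist_lt => e e0; rewrite ut_M//.
have e2 : 0 < e / 2 by rewrite divr_gt0.
have n1 : \forall q \near p, M q -> `|u p - u q| < e.
  by move/cvgrPdist_lt : uc => /(_ e e0); rewrite near_withinE.
have [d1 d10 Hd1] : exists2 d : R, 0 < d & forall x, `|x - cmap c p| < d ->
    [/\ cimg c x, U x & `|G (cmap c p) - G x| < e / 2].
  have h1 := near_cimg (cimg_cmap cp).
  have h2 : \forall x \near cmap c p, U x := open_nbhs_nbhs (conj oU Up).
  have h3 : \forall x \near cmap c p, `|G (cmap c p) - G x| < e / 2.
    by move/cvgrPdist_lt : Gc; apply.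
  have : \forall x \near cmap c p, [/\ cimg c x, U x & `|G (cmap c p) - G x| < e / 2].
    by near=> x; split; near: x.
  move=> /nbhs_ballP[d /= d0 H]; exists d => // x xd; apply: H.
  by rewrite -ball_normE /= distrC.
(* The first bound puts the closed box of radius [d] in the ball where [G] varies by less than
   [e / 2]; the second leaves [e / 2] for the time. *)
pose d := Num.min (d1 / 2) (e / 2).
have d0 : 0 < d by rewrite lt_min divr_gt0.
have dd1 : d < d1 by rewrite gt_min; apply/orP; left; lra.
have de : d <= e / 2 by rewrite ge_min lexx orbT.
have dc x : `|x - cmap c p| <= d -> cimg c x.
  by move=> xd; have [] := Hd1 x (le_lt_trans xd dd1).
have n2 := foot_time_near N_hausdorff M_domain P_geodesic P_smooth foot_P P_foot
  foot_smooth time_smooth cb d0 dc.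
near=> q; have [Mq|Mq] := pselect (M q).
  by rewrite ut_M//; apply: (near n1 q).
have [f1 f2 f3] : [/\ cdom c (foot q), `|cmap c (foot q) - cmap c p| < d & - d < time q].
  by apply: (near n2 q).
have [bf t0 _] := P_foot Mq.
rewrite ut_outside// u_boundary//.
have [_ Uf] := Hd1 _ (lt_trans f2 dd1).
rewrite (GE _ bp cp Up) (GE _ bf f1 Uf) opprD addrA => h.
apply: le_lt_trans (ler_normB _ _) _.
have : `|time q| < e / 2 by rewrite ltr0_norm//; lra.
lra.
Unshelve. all: by end_near. Qed.

(** By Euler's identity, [z - 'D_z (phi q) v *: v] is tangent to the level set of [phi q] at [v], so
    it is killed by [w]. *)
Lemma dual_form_unit q v w z : v != 0 -> phi q v = 1 -> dual_form phi q v w ->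
  (z *m w) 0 0 = 'D_z (phi q) v.
Proof.
move=> v0 v1 [vw kw]; have df := finsler_differentiable phi_finsler q v0.
have := kw (z - 'D_z (phi q) v *: v).
rewrite deriveE// linearB linearZ /= -!deriveE// (finsler_euler phi_finsler)// v1.
rewrite [_ *: 1]mulr1 subrr => /(_ erefl).
rewrite mulmxBl -scalemxAl !mxE.
by move: vw; rewrite mxE v1 expr1n => ->; rewrite mulr1 => /eqP; rewrite subr_eq0 => /eqP.
Qed.

Let X_neq0 q : bd q -> X q != 0.
Proof.
move=> bq; apply/eqP => X0; have := X_unit bq; rewrite X0 (finsler0 phi_finsler).
by move/eqP; rewrite eq_sym oner_eq0.
Qed.

Section AtBoundary.
Variables (q0 : N) (c0 : chart R n N) (i0 : 'I_n) (e : 'rV[R]_n).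
Hypothesis c0_bd : boundary_chart S M q0 c0 i0.
Hypothesis e_tangent : e 0 i0 = 0.
Variables (U : set 'rV[R]_n) (G : 'rV[R]_n -> R).
Hypotheses (oU : open U) (Uq : U (cmap c0 q0)) (Gk : forall k, Ck k U G).
Hypothesis GE : forall p, bd p -> cdom c0 p -> U (cmap c0 p) -> G (cmap c0 p) = g p.
Let x0 := cmap c0 q0.
Let ac0 : atlas S c0. Proof. by case: c0_bd. Qed.
Let c0q : cdom c0 q0. Proof. by case: c0_bd. Qed.
Let bq0 : bd q0. Proof. by exists c0, i0. Qed.
Let T := to_at S q0 c0.

Lemma dual_form_boundary : 'D_(e *m T) (phi q0) (X q0) = 'D_e G x0.
Proof.
have [_ [w dw Hw] _] := X_char bq0.
rewrite -(dual_form_unit _ (X_neq0 bq0) (X_unit bq0) dw).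
have dG : differentiable G x0 by have [+ _] := Gk 1; apply.
have lc : (fun s : R => x0 + s *: e) @ (0 : R) --> x0 + (0 : R) *: e.
  exact: (differentiable_continuous (line_differentiable x0 e (0 : R))).
have lc' : (fun s : R => x0 + s *: e) @ (0 : R) --> x0.
  by rewrite scale0r addr0 in lc.
have nU : \forall s \near (0 : R), U (x0 + s *: e) := lc' _ (open_nbhs_nbhs (conj oU Uq)).
have nb := near_boundary_line c0_bd e_tangent.
have : \forall s \near (0 : R), U (x0 + s *: e) /\ cimg c0 (x0 + s *: e) /\ bd (cinv c0 (x0 + s *: e)).
  by near=> s; split; near: s.
move=> /nbhs_ballP[h /= h0 Hh].
(* [characteristic_vector] tests curves lying in the boundary for all times in []-1, 1[]. The line
   does so near [0] only, so its direction is scaled by [h], a factor cancelled at the end. *)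
have Hs (s : R) : -1 < s < 1 -> U (x0 + s *: (h *: e)) /\ cimg c0 (x0 + s *: (h *: e)) /\ bd (cinv c0 (x0 + s *: (h *: e))).
  move=> s1; rewrite scalerA; apply: Hh.
  rewrite -ball_normE /= sub0r normrN normrM (gtr0_norm h0) -ltr_pdivlMr// divff ?gt_eqF//.
  by rewrite ltr_norml.
have itv (s : R) : s \in `](-1 : R), 1[ -> -1 < s < 1 by rewrite in_itv.
have ci (s : R) : `](-1 : R), 1[%classic s -> cimg c0 (x0 + s *: (h *: e)).
  by move=> /itv /Hs[_ []].
have s0 : (`](-1 : R), 1[%classic)° (0 : R).
  by apply: open_nbhs_nbhs; split; [exact: interval_open|rewrite /= in_itv /= ltr01 ltrN10].
have z0 : cinv c0 (x0 + 0 *: (h *: e)) = q0 by rewrite scale0r addr0 cmapK.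
have := Hw _ (line_smooth ac0 ci) (fun s s1 => (Hs s s1).2.2) z0.
rewrite (line_velocity ac0 ci s0) z0 -/T => EH.
have dgz : derive1 (g \o (fun s => cinv c0 (x0 + s *: (h *: e)))) 0 = h * 'D_e G x0.
  have [_ d1] := is_derive_line0 (h *: e) dG.
  have -> : h * 'D_e G x0 = 'D_(h *: e) G x0 by rewrite !deriveE// linearZ.
  rewrite -d1 derive1E; apply: near_eq_derive; apply: filterS s0 => s /itv /Hs[Us [cs bs]] /=.
  by rewrite -[X in G X](cinvK cs) GE// ?cinvK//; exact: cdom_cinv.
move: EH; rewrite dgz -!scalemxAl mxE => /(mulfI _); apply.
by rewrite gt_eqF.
Unshelve. all: by end_near. Qed.

(** Initial value of the conserved quantity: at time [0] the Jacobi field is [e] itself, on which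
    the dual form of [X q0] is the differential of [g]. The factor 2 comes from the square of
    [phi]. *)
Lemma gauss_form0 : gauss_form S phi P q0 c0 e 0 = 2 * 'D_e G x0.
Proof.
have [[e1 e10 gP] P0 PX] := P_geodesic bq0.
have vE : jacobi_field S P q0 c0 e 0 = e *m T.
  rewrite /jacobi_field.
  have nb := near_boundary_line c0_bd e_tangent.
  rewrite (@near_eq_velocity _ _ _ _ _ (boundary_line q0 c0 e)); last first.
    by apply: filterS nb => s [_ bs]; have [_ + _] := P_geodesic bs.
  have cx : cimg c0 (x0 + 0 *: e) by rewrite scale0r addr0; exact: cimg_cmap.
  have [dl dlE] := line_derive1 cx.
  have qc : {for (0 : R), continuous (boundary_line q0 c0 e)}.
    have lc := differentiable_continuous (line_differentiable x0 e (0 : R)).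
    exact: (continuous_cvg (nbhs_filter (0 : R)) (cinv_continuous cx) lc).
  rewrite (velocity_chart ac0 _ qc dl) (boundary_line0 c0_bd)//.
  by rewrite derive1E dlE.
rewrite /gauss_form vE P0 PX.
rewrite (_ : (fun v => phi q0 v ^+ 2) = phi q0 ^+ 2); last by rewrite exprfctE.
have df := finsler_differentiable phi_finsler q0 (X_neq0 bq0).
rewrite deriveX; last exact: diff_derivable.
by rewrite expr1 (X_unit bq0) mulr1 dual_form_boundary.
Qed.

End AtBoundary.

(** In the coordinates (foot, time) the velocity of [y] is a Jacobi field plus [tau'] times the unit
    characteristic velocity [V]. The differential of [phi] at [V] sends the first to the derivative
    of [g] along the foot (Gauss) and the second to [tau'] (Euler), so it computes the derivative of
    [ut]; the convexity of [phi] bounds it. *)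
Lemma ut_derive_outside (I : set R) y t : smooth_into S I y -> I° t -> ~ M (y t) ->
  exists2 D, is_derive t 1 (ut \o y) D & D <= speed S phi y t.
Proof.
move=> sy It Mt; have [bf time0 Pf] := P_foot Mt; have [c0 [i0 cb]] := bf.
have [ac0 cf fi _] := cb.
have [U [G [oU Uf Gk GE]]] := g_reading cb.
set q0 := foot (y t) in bf Pf cb cf fi U G oU Uf Gk GE *.
set t0 := time (y t) in time0 Pf *.
pose c1 := chart_at S (y t).
have ac1 : atlas S c1 by exact: atlas_chart_at.
have c1t : cdom c1 (y t) by exact: cdom_chart_at.
have yc : y @ t --> y t := smooth_into_continuous sy It.
have dx := curve_derivable sy It ac1 c1t.
have nout : \forall s \near t, ~ M (y s) := yc _ (near_outside M_domain Mt).
have nc1 : \forall s \near t, cdom c1 (y s) := yc _ (near_cdom c1t).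
pose xi s := cmap c0 (foot (y s)); pose tau s := time (y s).
have [e dxi] : exists e, is_derive t 1 xi e.
  have dF := foot_differentiable M_domain foot_smooth ac1 ac0 c1t cf Mt.
  have h := derive1_comp_rV dx dF.
  exists ('D_(derive1 (cmap c1 \o y) t) (cmap c0 \o (foot \o cinv c1)) (cmap c1 (y t))).
  apply: near_eq_is_derive h; apply: filterS nc1 => s cs.
  by rewrite /= cmapK.
have [tau' dtau] : exists tau', is_derive t 1 tau tau'.
  have dT := time_differentiable M_domain time_smooth ac1 c1t Mt.
  have h := derive1_comp_rV dx dT.
  exists ('D_(derive1 (cmap c1 \o y) t) (time \o cinv c1) (cmap c1 (y t))).
  apply: near_eq_is_derive h; apply: filterS nc1 => s cs.
  by rewrite /= cmapK.
have [dxid dxiE] := dxi; have [dtaud dtauE] := dtau.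
have xic : xi @ t --> xi t := differentiable_continuous ((derivable1_diffP _ _).1 dxid).
have tauc : tau @ t --> tau t := differentiable_continuous ((derivable1_diffP _ _).1 dtaud).
have fc := continuous_cvg (nbhs_filter t) (footc Mt) yc.
have nc0 : \forall s \near t, cdom c0 (foot (y s)) := fc _ (near_cdom cf).
have nU : \forall s \near t, U (xi s) := xic _ (open_nbhs_nbhs (conj oU Uf)).
(* The foot stays on the boundary, where the transverse coordinate is identically zero. *)
have e_tangent : e 0 i0 = 0.
  rewrite -dxiE derive_mx// mxE -(derive_cst (0 : R) t 1); apply: near_eq_derive.
  near=> s; rewrite /xi; apply/(mboundary_chartE cb); first by near: s.
  have Ms : ~ M (y s) by near: s.
  by have [] := P_foot Ms.
have dG : differentiable G (xi t) by have [+ _] := Gk 1; apply.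
have hG := derive1_comp_rV dxid dG.
rewrite (etrans (derive1E _ _) dxiE) in hG.
exists ('D_e G (xi t) + tau').
  apply: near_eq_is_derive (is_deriveD hG dtau); near=> s.
  have Ms : ~ M (y s) by near: s.
  have [bs _ _] := P_foot Ms.
  rewrite /= ut_outside//; congr (_ + _); apply: GE => //; first by near: s; exact: nc0.
  by near: s; exact: nU.
have t00 := ltW time0.
have ac1' : atlas S c1 := ac1.
have c1P : cdom c1 (P q0 t0) by rewrite Pf.
have [U1 [G1 [oU1 U1z G1k UG1]]] := backward_reading P_smooth cb ac1 c1P t00.
have dG1 : differentiable G1 (cmap c0 q0, t0) by have [+ _] := G1k 1; apply.
have pairc : (fun s => (xi s, tau s)) @ t --> (xi t, tau t).
  exact: (cvg_to_pair (nbhs_filter t) xic tauc).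
have nU1 : \forall s \near t, U1 (xi s, tau s) := pairc _ (open_nbhs_nbhs (conj oU1 U1z)).
have [dpd dpE] := is_derive_to_pair dxi dtau.
have h1 := derive1_comp_rV dpd dG1.
rewrite (etrans (derive1E _ _) dpE) in h1.
have velE : velocity S y t = 'D_(e, tau') G1 (cmap c0 q0, t0).
  have [_ <-] := h1; rewrite /velocity derive1E; apply: near_eq_derive; near=> s.
  have Ms : ~ M (y s) by near: s.
  have [bs ts Ps] := P_foot Ms.
  have cs : cdom c0 (foot (y s)) by near: s; exact: nc0.
  have Us : U1 (xi s, tau s) by near: s.
  have [|_] := UG1 _ Us.
    by split; [exists (foot (y s))|exact: ltW].
  by rewrite /= /xi cmapK// Ps => ->.
have varE : jacobi_field S P q0 c0 e t0 = 'D_(e, 0) G1 (cmap c0 q0, t0).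
  rewrite (jacobi_field_reading cb e_tangent ac1 oU1 G1k UG1 U1z t00).
  rewrite Pf; exact: to_at_chart_at.
have VE : velocity S (P q0) t0 = 'D_(0, 1) G1 (cmap c0 q0, t0).
  have [_ <-] := is_derive_snd_line dG1.
  rewrite /velocity Pf derive1E; apply: near_eq_derive.
  have cc : (fun r : R => (cmap c0 q0, r)) @ t0 --> (cmap c0 q0, t0).
    exact: (cvg_to_pair (nbhs_filter t0) (@cvg_cst _ _ _ (nbhs t0) _) cvg_id).
  have nUr : \forall r \near t0, U1 (cmap c0 q0, r) := cc _ (open_nbhs_nbhs (conj oU1 U1z)).
  near=> r; have Ur : U1 (cmap c0 q0, r) by near: r.
  have [|_] := UG1 _ Ur.
    split; first by exists q0.
    by apply: ltW; near: r; exact: lt_nbhsl.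
  by rewrite /= cmapK// => ->.
set V := velocity S (P q0) t0 in VE *.
have V1 : phi (y t) V = 1.
  have := P_speed phi_finsler P_geodesic X_unit bf t00.
  by rewrite /speed Pf.
have V0 : V != 0.
  apply/eqP => V0; move: V1; rewrite V0 (finsler0 phi_finsler).
  by move/eqP; rewrite eq_sym oner_eq0.
have dphi := finsler_differentiable phi_finsler (y t) V0.
have gaussE := gauss_form_const phi_finsler P_geodesic X_unit P_smooth cb e_tangent t00.
rewrite (gauss_form0 cb e_tangent oU Uf Gk GE) in gaussE.
have gE : gauss_form S phi P q0 c0 e t0 = 2 * 'D_(jacobi_field S P q0 c0 e t0) (phi (y t)) V.
  rewrite /gauss_form Pf -/V.
  rewrite (_ : (fun v => phi (y t) v ^+ 2) = phi (y t) ^+ 2); last by rewrite exprfctE.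
  rewrite deriveX; last exact: diff_derivable.
  by rewrite expr1 V1 mulr1.
have DE : 'D_(jacobi_field S P q0 c0 e t0) (phi (y t)) V = 'D_e G (xi t).
  by apply: (@mulfI _ 2); [rewrite pnatr_eq0|rewrite -gE gaussE].
have le : 'D_(velocity S y t) (phi (y t)) V <= speed S phi y t.
  exact: (finsler_derive_le phi_finsler (y t) (velocity S y t) V0).
have <- : 'D_(velocity S y t) (phi (y t)) V = 'D_e G (xi t) + tau'; last exact: le.
(* Linearity of the derivative of [G1] separates the motion of the foot from that of the time. *)
have -> : velocity S y t = jacobi_field S P q0 c0 e t0 + tau' *: V.
  rewrite velE varE VE derive_pair//; congr (_ + _).
  exact: derive_snd_scale.
apply: (etrans (derive_linear _ _ _ dphi)).
by rewrite DE (finsler_euler phi_finsler _ V0) V1 [_ *: 1]mulr1.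
Unshelve. all: by end_near. Qed.

End Solution.

(** * Growth of the extended solution along curves *)

Section RealLemmas.
Context {R : realType}.

Lemma is_derive_expansion (E : normedModType R) (f : R -> E) (t e : R) D :
  is_derive t 1 f D -> 0 < e ->
  exists2 d : R, 0 < d & forall h, 0 < h < d -> `|f (t + h) - f t - h *: D| <= e * h.
Proof.
move=> [fd fD] e0; have df := (derivable1_diffP _ _).1 fd.
have /nbhs_ballP[d /= d0 H] := differentiable_eps e0 df.
exists d => // h /andP[h0 hd].
have := H h; rewrite -ball_normE /= sub0r normrN gtr0_norm// => /(_ hd).
have -> // : 'd f t h = h *: D.
by rewrite -fD deriveE// -linearZ; congr ('d f t _); rewrite /GRing.scale /= mulr1.
Qed.

Lemma last_exit (N : topologicalType) (M : set N) (y : R -> N) (a b : R) :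
  closed M -> a <= b -> {within `[a, b], continuous y} -> M (y a) -> ~ M (y b) ->
  exists2 s, a <= s < b & M (y s) /\ forall r, s < r <= b -> ~ M (y r).
Proof.
move=> cM ab /subspace_continuousP yc Ma Mb.
pose A := [set s | a <= s <= b /\ M (y s)].
have Aa : A a by rewrite /A /= lexx ab.
have Aub : ubound A b by move=> s [/andP[]].
have supA : has_sup A by split; [exists a|exists b].
pose s := sup A.
have as_ : a <= s by apply: sup_upper_bound.
have sb : s <= b by apply: sup_le_ub => //; exists a.
have Ms : M (y s).
  apply: contrapT => nMs.
  have sab : `[a, b]%classic s by rewrite /= in_itv /= as_ sb.
  have : nbhs (y s) (~` M) by apply: open_nbhs_nbhs; split=> //; exact: closed_openC.
  move=> /(yc s sab)[d /= d0 H].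
  have [r Ar] := sup_adherent d0 supA; rewrite -/s => sr.
  have rs : r <= s by apply: sup_upper_bound.
  have [/andP[ar rb] Mr] := Ar.
  have bl : `|s - r| < d by rewrite ger0_norm; lra.
  have ir : r \in `[a, b] by rewrite in_itv /= ar.
  exact: (H r bl ir Mr).
exists s.
  by rewrite as_ lt_neqAle sb andbT; apply/eqP => sE; apply: Mb; rewrite -sE.
split=> // r /andP[sr rb] Mr.
suff : r <= s by rewrite leNgt sr.
by apply: sup_upper_bound => //; split=> //; rewrite rb (le_trans as_)// ltW.
Qed.

End RealLemmas.

Section LengthBound.
Context {R : realType} {n : nat} {N : topologicalType}.
Variable S : smooth_structure R n N.
Variable phi : N -> 'rV[R]_n -> R.
Hypothesis phi_finsler : finsler_metric S phi.

Lemma len_le_const y (a b C : R) : a < b -> 0 <= C -> smooth_into S `[a, b] y ->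
  (forall t, a < t < b -> speed S phi y t <= C) ->
  (arc_length S phi y a b <= (C * (b - a))%:E)%E.
Proof.
move=> ab C0 sy yC; have my := speed_measurable_oo phi_finsler sy.
have e := integral_itv_bndoo true false my.
rewrite /arc_length e.
have -> : ((C * (b - a))%:E = \int[lebesgue_measure]_(t in `]a, b[) (cst C%:E t))%E.
  by rewrite integral_cst//= lebesgue_measure_itv /= lte_fin ab EFinM.
apply: ge0_le_integral => //.
by move=> t _; rewrite lee_fin (speed_ge0 phi_finsler).
Qed.

Lemma len_mono y (a b c d : R) : a < b -> b < c -> c < d -> smooth_into S `[a, d] y ->
  (arc_length S phi y b c <= arc_length S phi y a d)%E.
Proof.
move=> ab bc cd sy; apply: ge0_subset_integral => //.
- exact: (speed_measurable_cc phi_finsler sy).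
- by move=> t _; rewrite lee_fin (speed_ge0 phi_finsler).
- by move=> t /=; rewrite !in_itv /= => /andP[bt tc]; apply/andP; split; lra.
Qed.

End LengthBound.

Section LowerBound.
Context {R : realType} {n : nat} {N : topologicalType}.
Variable S : smooth_structure R n N.
Variable M : set N.
Hypothesis M_domain : regular_domain S M.
Variable phi : N -> 'rV[R]_n -> R.
Hypothesis phi_finsler : finsler_metric S phi.
Variables (g u ut : N -> R).
Hypothesis u_value : value_function S phi M g u.
Hypothesis ut_M : forall p, M p -> ut p = u p.
Hypothesis ut_continuous : continuous ut.
Hypothesis ut_outside : forall (I : set R) y t, smooth_into S I y -> I° t -> ~ M (y t) ->
  exists2 D, is_derive t 1 (ut \o y) D & D <= speed S phi y t.
Implicit Types (c : chart R n N) (p q : N) (y : R -> N).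
Local Notation bd := (mboundary S M).
Local Notation speed := (speed S phi).
Local Notation TR := (tangent_reading S phi).

(** In a small chart ball, [M] is the whole ball or its intersection with a half-space, and both are
    convex. *)
Lemma convex_chart p : M p -> exists c (r : R),
  [/\ atlas S c, cdom c p, 0 < r, forall x, `|x - cmap c p| < r -> cimg c x &
      forall x z s, `|x - cmap c p| < r -> `|z - cmap c p| < r ->
        M (cinv c x) -> M (cinv c z) -> 0 <= s <= 1 -> M (cinv c (x + s *: (z - x)))].
Proof.
move=> Mp; have [_ /(_ p Mp)[Mi|[c [i cb]]]] := M_domain.
  pose c := chart_at S p; have cp := cdom_chart_at S p.
  have h1 := near_cimg (cimg_cmap cp).
  have h2 : \forall x \near cmap c p, M (cinv c x).
    by apply: near_cinv (cimg_cmap cp) _; rewrite cmapK.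
  have : \forall x \near cmap c p, cimg c x /\ M (cinv c x) by near=> x; split; near: x.
  move=> /nbhs_ballP[r /= r0 H].
  have H' x : `|x - cmap c p| < r -> cimg c x /\ M (cinv c x).
    by move=> xr; apply: H; rewrite -ball_normE /= distrC.
  exists c, r; split=> //; first exact: atlas_chart_at.
    by move=> x /H'[].
  by move=> x z s xr zr _ _ s01; have [] := H' _ (segment_in_ball xr zr s01).
have [ac cp p0 cM] := cb.
have /nbhs_ballP[r /= r0 H] := near_cimg (cimg_cmap cp).
have H' x : `|x - cmap c p| < r -> cimg c x.
  by move=> xr; apply: H; rewrite -ball_normE /= distrC.
exists c, r; split=> // x z s xr zr Mx Mz s01.
have cs := H' _ (segment_in_ball xr zr s01).
apply/(cM _ (cdom_cinv cs)); rewrite cinvK// !mxE.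
move: Mx Mz => /(cM _ (cdom_cinv (H' _ xr))) + /(cM _ (cdom_cinv (H' _ zr))).
rewrite (cinvK (H' _ xr)) (cinvK (H' _ zr)); case/andP: s01 => s0 s1 x0 z0.
have -> : x 0 i + s * (z 0 i - x 0 i) = (1 - s) * x 0 i + s * z 0 i by ring.
by rewrite addr_ge0// mulr_ge0// subr_ge0.
Unshelve. all: by end_near. Qed.

Lemma u_lipschitz y (a b l : R) : a < b -> pw_smooth S y a b ->
  (forall t, a <= t <= b -> M (y t)) -> (arc_length S phi y a b <= l%:E)%E ->
  u (y b) <= u (y a) + l.
Proof.
move=> ab yab yM yl.
have Ma : M (y a) by apply: yM; rewrite lexx ltW.
have Mb : M (y b) by apply: yM; rewrite lexx ltW.
rewrite -lerBlDr -lee_fin (u_value Ma); apply/ereal_infP => _ [q bq <-].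
rewrite EFinB leeBlDr// (u_value Mb).
apply: (@le_trans _ _ (finsler_dist S phi M q (y b) + (g q)%:E)%E).
  by apply: ereal_inf_lbound; exists q.
rewrite addeAC leeD2r//.
exact: (dist_extend_r phi_finsler).
Qed.

(** Between [t] and [t + h] the curve may leave [M], so it is replaced by its chord in a convex
    chart. The positions and direction of the chord are close to [(x t, v0)], and continuity of the
    metric bounds its length. *)
Lemma dini_inside y (I : set R) t e : smooth_into S I y -> I° t -> M (y t) -> 0 < e ->
  exists2 d : R, 0 < d & forall h, 0 < h < d -> M (y (t + h)) ->
    ut (y (t + h)) <= ut (y t) + (speed y t + e) * h.
Proof.
move=> sy It Mt e0; have [c [r [ac ct r0 rc rM]]] := convex_chart Mt.
pose x := cmap c \o y; pose v0 := derive1 x t.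
have dx : is_derive t 1 x v0.
  rewrite /v0 derive1E; apply: derivableP; exact: curve_derivable sy It ac ct.
have spE : speed y t = TR c (x t, v0) := speed_chart phi sy It ac ct.
have cz : cimg c ((x t, v0) : 'rV[R]_n * 'rV[R]_n).1 by exact: cimg_cmap.
have TRc := tangent_reading_continuous phi_finsler ac cz.
have [d1 d10 Hd1] : exists2 d1 : R, 0 < d1 & forall z v, `|z - x t| < d1 -> `|v - v0| < d1 ->
    TR c (z, v) < speed y t + e.
  have : \forall w \near (x t, v0), TR c w < speed y t + e.
    by move/cvgr_lt : TRc; apply; rewrite -spE ltrDl.
  move=> /nbhs_ballP[d1 /= d10 H]; exists d1 => // z v zd vd; apply: H; split => /=.
    by rewrite -ball_normE /= distrC.
  by rewrite -ball_normE /= distrC.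
(* Half of [d1], because the expansion gives a large inequality while the neighbourhood requires a
   strict one. *)
have d12 : 0 < d1 / 2 by rewrite divr_gt0.
have [d2 d20 Hd2] := is_derive_expansion dx d12.
have [dxd _] := dx.
have xc : x @ t --> x t := differentiable_continuous ((derivable1_diffP _ _).1 dxd).
have yc := smooth_into_continuous sy It.
have [d3 d30 Hd3] : exists2 d3 : R, 0 < d3 & forall h, `|h| < d3 ->
    cdom c (y (t + h)) /\ `|x (t + h) - x t| < Num.min r d1.
  have h1 : \forall s \near t, cdom c (y s) := yc _ (near_cdom ct).
  have m0 : 0 < Num.min r d1 by rewrite lt_min r0.
  have h2 : \forall s \near t, `|x s - x t| < Num.min r d1.
    have hm : nbhs (x t) [set z | `|z - x t| < Num.min r d1].
      by apply: open_nbhs_nbhs; split; [exact: norm_sub_lt_open|rewrite /= subrr normr0].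
    exact: xc _ hm.
  have : \forall s \near t, cdom c (y s) /\ `|x s - x t| < Num.min r d1.
    by near=> s; split; near: s.
  move=> /nbhs_ballP[d3 /= d30 H]; exists d3 => // h hd; apply: H.
  by rewrite -ball_normE /= opprD addNKr normrN.
exists (Num.min d2 d3); first by rewrite lt_min d20.
move=> h /andP[h0]; rewrite lt_min => /andP[hd2 hd3] Mth.
have [cth] := Hd3 h (eq_ind_r (fun a => a < d3) hd3 (gtr0_norm h0)).
rewrite lt_min => /andP[xr xd1].
(* Dividing by [h] parametrizes the chord by [[0, h]], with constant velocity the difference
   quotient, close to [v0]. *)
pose v := h^-1 *: (x (t + h) - x t).
have hn0 : h != 0 by rewrite gt_eqF.
have vE : h *: v = x (t + h) - x t by rewrite /v scalerA divff// scale1r.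
have vd : `|v - v0| < d1.
  have := Hd2 h; rewrite h0 hd2 => /(_ isT).
  rewrite -vE -scalerBr normrZ (gtr0_norm h0) mulrC ler_pM2r// => vd.
  by apply: le_lt_trans vd _; lra.
have xx (k : R) : 0 < k -> `|x t - x t| < k by rewrite subrr normr0.
have sE s : x t + s *: v = x t + (s / h) *: (x (t + h) - x t).
  by rewrite -vE [in RHS]scalerA; congr (_ + _ *: _); field.
have s01 s : 0 <= s <= h -> 0 <= s / h <= 1.
  by move=> /andP[s0 sh]; rewrite (divr_ge0 s0 (ltW h0)) /= ler_pdivrMr// mul1r.
have sr s : 0 <= s <= h -> `|x t + s *: v - x t| < r.
  by move=> /s01 sh; rewrite sE; apply: segment_in_ball => //; exact: xx.
have sd1 s : 0 <= s <= h -> `|x t + s *: v - x t| < d1.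
  by move=> /s01 sh; rewrite sE; apply: segment_in_ball => //; exact: xx.
have ci (s : R) : `[0, h]%classic s -> cimg c (x t + s *: v).
  by rewrite /= in_itv /= => /sr /rc.
pose z (s : R) := cinv c (x t + s *: v).
have sz : smooth_into S `[0, h] z := line_smooth ac ci.
have z0 : z 0 = y t by rewrite /z scale0r addr0 cmapK.
have zh : z h = y (t + h) by rewrite /z vE addrC subrK cmapK.
have zM s : 0 <= s <= h -> M (z s).
  move=> /s01 sh; rewrite /z sE; apply: rM => //; first exact: xx.
    by rewrite cmapK.
  by rewrite cmapK.
have C0 : 0 <= speed y t + e by exact: addr_ge0 (speed_ge0 phi_finsler y t) (ltW e0).
have lz : (arc_length S phi z 0 h <= ((speed y t + e) * (h - 0))%:E)%E.
  apply: (len_le_const phi_finsler h0 C0 sz) => s /andP[s0 sh].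
  have si : (`[0, h]%classic)° s by apply: interior_cc; rewrite s0.
  rewrite (line_speed phi ac ci si); apply: ltW; apply: Hd1 => //.
  by apply: sd1; rewrite (ltW s0) (ltW sh).
rewrite subr0 in lz.
have := u_lipschitz h0 (pw1 h0 sz) zM lz.
by rewrite z0 zh !ut_M.
Unshelve. all: by end_near. Qed.

Lemma dini_ut y (a b t e : R) : smooth_into S `[a, b] y -> a < t < b -> 0 < e ->
  exists2 d : R, 0 < d & forall h, 0 < h < d ->
    ut (y (t + h)) <= ut (y t) + (speed y t + e) * h.
Proof.
move=> sy tab e0; have It := interior_cc tab.
have [Mt|Mt] := pselect (M (y t)); last first.
  have [D dD Dle] := ut_outside sy It Mt.
  have [d d0 H] := is_derive_expansion dD e0.
  exists d => // h hd; have := H h hd; rewrite ler_norml => /andP[_].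
  rewrite /= -[h *: D]/(h * D); have /andP[h0 _] := hd.
  move: (ut (y (t + h))) (ut (y t)) (speed y t) Dle => p q r; nra.
have [d1 d10 Hd1] := dini_inside sy It Mt e0.
have spc := speed_continuous phi_finsler sy It.
have [d2 d20 Hd2] : exists2 d2 : R, 0 < d2 & forall h, 0 <= h < d2 -> speed y (t + h) < speed y t + e.
  have : \forall s \near t, speed y s < speed y t + e.
    by move/cvgr_lt : spc; apply; rewrite ltrDl.
  move=> /nbhs_ballP[d2 /= d20 H]; exists d2 => // h /andP[h0 hd]; apply: H.
  by rewrite -ball_normE /= opprD addNKr normrN ger0_norm.
have /andP[at_ tb] := tab.
(* The bound [b - t] keeps [t + h] strictly inside the piece, where the curve is continuous and
   differentiable from both sides. *)
pose d := Num.min (Num.min d1 d2) (b - t).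
exists d; first by rewrite !lt_min d10 d20 subr_gt0.
move=> h /andP[h0]; rewrite !lt_min => /andP[/andP[hd1 hd2] hb].
have [Mh|Mh] := pselect (M (y (t + h))); first by apply: Hd1; rewrite ?h0.
have yc : {within `[t, t + h], continuous y}.
  apply: continuous_subspaceW sy.1 => s /=; rewrite !in_itv /= => /andP[? ?].
  by apply/andP; split; lra.
have tth : t <= t + h by rewrite lerDl ltW.
have [s /andP[ts sth] [Ms out]] := last_exit M_domain.1 tth yc Mt Mh.
have Is r : t <= r <= t + h -> (`[a, b]%classic)° r.
  by move=> /andP[? ?]; apply: interior_cc; apply/andP; split; lra.
have dD r : r \in `]s, t + h[ -> is_derive r 1 (ut \o y) ('D_1 (ut \o y) r).
  rewrite in_itv /= => /andP[sr rth].
  have Ir : (`[a, b]%classic)° r by apply: Is; apply/andP; split; lra.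
  have Mr : ~ M (y r) by apply: out; rewrite sr ltW.
  by have [D [dr _] _] := ut_outside sy Ir Mr; exact: derivableP.
have uc : {within `[s, t + h], continuous (ut \o y)}.
  apply/subspace_continuousP => r; rewrite /= in_itv /= => /andP[sr rth].
  have Ir : (`[a, b]%classic)° r by apply: Is; apply/andP; split; lra.
  have h1 : ut \o y @ r --> ut (y r).
    exact: (continuous_cvg (nbhs_filter r) (@ut_continuous (y r)) (smooth_into_continuous sy Ir)).
  by apply: cvg_trans h1; apply: cvg_app; exact: cvg_within.
(* On the excursion [ut] is differentiable in the open interval; at the exit point [s] only its
   continuity is used. The speed at the intermediate time is compared with that at [t] by
   continuity. *)
have [r rs rE] := MVT sth dD uc.
have /andP[sr rth] : s < r < t + h by move: rs; rewrite in_itv.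
have Dr : 'D_1 (ut \o y) r <= speed y t + e.
  have Ir : (`[a, b]%classic)° r by apply: Is; apply/andP; split; lra.
  have Mr : ~ M (y r) by apply: out; rewrite sr ltW.
  have [D [_ <-] Dle] := ut_outside sy Ir Mr; apply: (le_trans Dle); apply: ltW.
  have er : t + (r - t) = r by rewrite addrC subrK.
  have := Hd2 (r - t); rewrite er; apply; apply/andP; split; lra.
have us : ut (y s) <= ut (y t) + (speed y t + e) * (s - t).
  have [<-|st] := eqVneq t s; first by rewrite subrr mulr0 addr0.
  have ts' : t < s by rewrite lt_neqAle st.
  have es : t + (s - t) = s by rewrite addrC subrK.
  have := Hd1 (s - t); rewrite es; apply=> //; apply/andP; split; lra.
move: rE Dr us; rewrite /=.
move: (ut (y (t + h))) (ut (y t)) (ut (y s)) ('D_1 _ r) (speed y t + e) => p1 p2 p3 p4 p5.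
nra.
Qed.

End LowerBound.

(** * From the Dini estimate to the bound by the length *)

Section PieceBound.
Context {R : realType} {n : nat} {N : topologicalType}.
Variable S : smooth_structure R n N.
Variable phi : N -> 'rV[R]_n -> R.
Hypothesis phi_finsler : finsler_metric S phi.
Variable f : N -> R.
Hypothesis f_continuous : continuous f.
Hypothesis f_dini : forall (y : R -> N) (a b t e : R), smooth_into S `[a, b] y ->
  a < t < b -> 0 < e ->
  exists2 d : R, 0 < d & forall h, 0 < h < d ->
    f (y (t + h)) <= f (y t) + (speed S phi y t + e) * h.
Implicit Types y : R -> N.
Local Notation speed := (speed S phi).
Local Notation arc_length := (arc_length S phi).

Lemma inner_bound y (a b a1 b1 : R) : smooth_into S `[a, b] y ->
  a < a1 -> a1 < b1 -> b1 < b -> ((f (y b1) - f (y a1))%:E <= arc_length y a1 b1)%E.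
Proof.
move=> sy aa1 ab1 b1b.
(* The length is counted from [a0 < a1] and up to [b0 > b1], so that the speed is continuous on
   [[a0, b0]] and the fundamental theorem of calculus applies at [a1] and [b1], which are
   interior. *)
pose a0 := (a + a1) / 2; pose b0 := (b1 + b) / 2.
have aa0 : a < a0 by rewrite /a0; lra.
have a0a1 : a0 < a1 by rewrite /a0; lra.
have b1b0 : b1 < b0 by rewrite /b0; lra.
have b0b : b0 < b by rewrite /b0; lra.
have Ir r : a0 <= r <= b0 -> (`[a, b]%classic)° r.
  by move=> /andP[? ?]; apply: interior_cc; apply/andP; split; lra.
have spc r : a0 <= r <= b0 -> {for r, continuous (speed y)}.
  by move=> /Ir; exact: speed_continuous.
have int : lebesgue_measure.-integrable `[a0, b0] (EFin \o speed y).
  apply: continuous_compact_integrable; first exact: segment_compact.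
  apply/subspace_continuousP => r; rewrite /= in_itv /= => /spc h1.
  by apply: cvg_trans h1; apply: cvg_app; exact: cvg_within.
pose L (t : R) := (\int[lebesgue_measure]_(x in `[a0, t]) speed y x)%R.
have dL t : a0 < t < b0 -> is_derive t 1 L (speed y t).
  move=> /andP[at_ tb].
  have [|d e] := continuous_FTC1_closed tb int at_ (f := speed y).
    by apply: spc; rewrite !ltW.
  by apply: DeriveDef; [exact: d|rewrite -derive1E; exact: e].
have LE t : a0 < t <= b0 -> (L t)%:E = arc_length y a0 t.
  move=> /andP[at_ tb]; rewrite /L /Rintegral fineK//.
  apply: integrable_fin_num => //.
  by apply: integrableS int => //; apply: subset_itvl; rewrite bnd_simp.
(* The speed in the Dini estimate for [f] is the derivative of [L], so the right Dini derivative of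
   [F] is nonpositive. *)
pose F t := f (y t) - L t.
have FE : F b1 <= F a1.
  apply: dini_le; first exact: ltW.
    apply/subspace_continuousP => r; rewrite /= in_itv /= => /andP[ar rb].
    have r0 : a0 < r < b0 by apply/andP; split; lra.
    have r0' : a0 <= r <= b0 by apply/andP; split; lra.
    have h1 : (fun r => f (y r)) @ r --> f (y r).
      exact: (continuous_cvg (nbhs_filter r) (@f_continuous (y r)) (smooth_into_continuous sy (Ir r r0'))).
    have [dd _] := dL r r0.
    have h2 : L @ r --> L r := differentiable_continuous ((derivable1_diffP _ _).1 dd).
    have h3 : F @ r --> F r by exact: cvgB h1 h2.
    by apply: cvg_trans h3; apply: cvg_app; exact: cvg_within.
  move=> t e /andP[a1t tb1] e0; have e2 : 0 < e / 2 by rewrite divr_gt0.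
  have tab : a < t < b by apply/andP; split; lra.
  have tab0 : a0 < t < b0 by apply/andP; split; lra.
  have [d1 d10 H1] := f_dini sy tab e2.
  have [d2 d20 H2] := is_derive_expansion (dL t tab0) e2.
  exists (Num.min d1 d2); first by rewrite lt_min d10.
  move=> h /andP[h0]; rewrite lt_min => /andP[hd1 hd2] _.
  have := H1 h; rewrite h0 hd1 => /(_ isT).
  have := H2 h; rewrite h0 hd2 => /(_ isT).
  rewrite ler_norml -[h *: speed y t]/(h * speed y t) => /andP[+ _].
  rewrite /F; move: (f _) (f _) (L _) (L _) (speed y t) => p1 p2 p3 p4 p5.
  nra.
have ca : a0 < a1 <= b0 by apply/andP; split; lra.
have cb : a0 < b1 <= b0 by apply/andP; split; lra.
have p1 : pw_smooth S y a0 a1.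
  by apply: pw1 => //; apply: smooth_intoW sy => r /=; rewrite !in_itv /= => /andP[? ?]; apply/andP; split; lra.
have p2 : pw_smooth S y a1 b1.
  by apply: pw1 => //; apply: smooth_intoW sy => r /=; rewrite !in_itv /= => /andP[? ?]; apply/andP; split; lra.
have lc := len_cat phi_finsler a0a1 ab1 p1 p2.
rewrite -(LE _ ca) -(LE _ cb) in lc.
have -> : arc_length y a1 b1 = (L b1 - L a1)%:E.
  by rewrite EFinB lc [X in (X - _)%E]addeC addeK.
by rewrite lee_fin; move: FE; rewrite /F; lra.
Qed.

Lemma piece_bound y (a b : R) : a < b -> smooth_into S `[a, b] y ->
  ((f (y b) - f (y a))%:E <= arc_length y a b)%E.
Proof.
move=> ab sy; rewrite leNgt; apply/negP.
have l0 : (0 <= arc_length y a b)%E.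
  by apply: integral_ge0 => t _; rewrite lee_fin (speed_ge0 phi_finsler).
(* An infinite length cannot be exceeded, so the length is a real [l]. *)
move lE : (arc_length y a b) l0 => l l0; case: l lE l0 => [l| |]// lE _; rewrite lte_fin => lt.
(* Half of the excess over [l]: with a loss below [e] at each end, the increment of [f] from [a1] to
   [b1] still exceeds [l]. *)
pose e := (f (y b) - f (y a) - l) / 2; have e0 : 0 < e by rewrite /e; lra.
pose m := (a + b) / 2; have am : a < m by rewrite /m; lra.
have mb : m < b by rewrite /m; lra.
have yc := sy.1.
have fyc : {within `[a, b], continuous (f \o y)}.
  move/subspace_continuousP : yc => yc; apply/subspace_continuousP => r rab.
  by apply: (continuous_cvg _ (@f_continuous (y r))); exact: yc.
have [_ ca cb] := (continuous_within_itvP (f \o y) ab).1 fyc.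
have [a1 [/andP[aa1 a1m] ha1]] : exists a1, a < a1 < m /\ f (y a1) < f (y a) + e.
  have n1 : \forall r \near a^'+, f (y r) < f (y a) + e.
    by move/cvgr_lt : ca; apply; rewrite /= ltrDl.
  have [r [[h1 h2] h3]] := filter_ex (filterI (filterI (nbhs_right_gt a) (nbhs_right_lt am)) n1).
  by exists r; rewrite h1.
have [b1 [/andP[mb1 b1b] hb1]] : exists b1, m < b1 < b /\ f (y b) - e < f (y b1).
  have n1 : \forall r \near b^'-, f (y b) - e < f (y r).
    by move/cvgr_gt : cb; apply; rewrite /= ltrBlDr ltrDl.
  have [r [[h1 h2] h3]] := filter_ex (filterI (filterI (nbhs_left_gt mb) (nbhs_left_lt b)) n1).
  by exists r; rewrite h1.
have ab1 : a1 < b1 by lra.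
have := inner_bound sy aa1 ab1 b1b.
move=> /le_trans /(_ (len_mono phi_finsler aa1 ab1 b1b sy)).
rewrite lE lee_fin => H.
move: ha1 hb1 lt H; rewrite /e; move: (f _) (f _) (f _) (f _) => p1 p2 p3 p4; lra.
Qed.

Lemma curve_bound y (a b : R) : a < b -> pw_smooth S y a b ->
  ((f (y b) - f (y a))%:E <= arc_length y a b)%E.
Proof.
move=> ab yab.
pose Q (a b : R) := pw_smooth S y a b /\ ((f (y b) - f (y a))%:E <= arc_length y a b)%E.
have [_ h] : Q a b; last exact: h.
apply: (@pw_ind _ _ _ _ y Q a b _ _ ab yab) => [p q pq sy|p q r pq qr [h1 h2] [h3 h4]].
  by split; [exact: pw1|exact: piece_bound].
split; first exact: pw_cat h1 h3.
rewrite (len_cat phi_finsler pq qr h1 h3).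
have -> : f (y r) - f (y p) = (f (y q) - f (y p)) + (f (y r) - f (y q)).
  by move: (f _) (f _) (f _) => *; ring.
by rewrite EFinD; exact: leeD h2 h4.
Qed.

End PieceBound.

(** * Curves made of characteristics, and the identity for the distance *)

Section UpperBound.
Context {R : realType} {n : nat} {N : topologicalType}.
Variable S : smooth_structure R n N.
Variable phi : N -> 'rV[R]_n -> R.
Hypothesis phi_finsler : finsler_metric S phi.
Local Notation dist := (finsler_dist S phi).

(** Covers a point outside [M] that is itself on the level [0], where the characteristic segment
    leading to it degenerates. *)
Lemma dist_refl (A : set N) p : A p -> (dist A p p <= 0)%E.
Proof.
move=> Ap; have sp := constant_smooth S `[(0 : R), 1] p.
have h := dist_le_len phi_finsler ltr01 (pw1 ltr01 sp) (fun _ _ => Ap).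
apply: (le_trans h); have <- : (0 * (1 - 0))%:E = 0 :> \bar R by rewrite mul0r.
apply: (len_le_const phi_finsler ltr01 (lexx 0) sp) => t _.
rewrite /speed /velocity (_ : derive1 _ t = 0) ?(finsler0 phi_finsler)//.
by rewrite derive1_cst.
Qed.

Lemma unit_speed_len (e : R) y (s t : R) : geodesic S phi `]-oo, e[ y ->
  s < t -> t < e -> (forall r, r <= t -> speed S phi y r = 1) ->
  pw_smooth S y s t /\ (arc_length S phi y s t <= (t - s)%:E)%E.
Proof.
move=> gy st te y1.
have sy : smooth_into S `[s, t] y.
  by apply: smooth_intoW gy.1 => r; rewrite /= !in_itv /= => /andP[_ rt]; exact: le_lt_trans te.
split; first exact: pw1.
rewrite -[t - s]mul1r; apply: (len_le_const phi_finsler st ler01 sy) => r /andP[_ rt].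
by rewrite y1// ltW.
Qed.

End UpperBound.

Theorem theorem2p1p6 (R : realType) (n : nat) (N : topologicalType)
    (S : smooth_structure R n N)
    (N_hausdorff : hausdorff_space N)
    (N_second_countable : @second_countable N)
    (M : set N) (M_domain : regular_domain S M)
    (H : N -> 'cV[R]_n -> R) (H_hamiltonian : hamiltonian S M H)
    (phi : N -> 'rV[R]_n -> R) (phi_finsler : finsler_metric S phi)
    (phi_dual : dual_metric M H phi)
    (g : N -> R) (g_data : boundary_data S phi M g)
    (u : N -> R) (u_viscosity : viscosity_solution S M H g u)
    (u_value : value_function S phi M g u)
    (X : N -> 'rV[R]_n)
    (X_characteristic : forall q, mboundary S M q ->
       characteristic_vector S phi M g q (X q))
    (P : N -> R -> N) (P_extension : backward_extension S phi M X P)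
    (ut : N -> R) (ut_extends : extended_solution S M g u P ut) :
  forall p : N, 0 <= ut p ->
    (ut p)%:E = finsler_dist_from S phi setT (ut @^-1` [set 0]) p.
Proof.
move=> p up0.
have [g_smooth _ g_pos] := g_data.
have [u_cont u_bd _ _] := u_viscosity.
have [P_geo P_smooth [foot [time [foot_P P_foot foot_smooth time_smooth]]]] := P_extension.
have [ut_M ut_P] := ut_extends.
have X_unit q : mboundary S M q -> phi q (X q) = 1 by move=> /X_characteristic[].
have ut_c := ut_continuous N_hausdorff M_domain g_smooth P_geo P_smooth foot_P P_foot
  foot_smooth time_smooth u_cont u_bd ut_M ut_P.
have ut_out := ut_derive_outside M_domain phi_finsler g_smooth X_characteristic P_geo
  P_smooth P_foot foot_smooth time_smooth ut_P.
apply/eqP; rewrite eq_le; apply/andP; split.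
  apply/ereal_infP => _ [q /= uq <-]; apply/ereal_infP => _ [y [py y0 y1 _] <-].
  have := curve_bound phi_finsler ut_c (dini_ut M_domain phi_finsler u_value ut_M ut_c ut_out) ltr01 py.
  by rewrite y0 y1 uq subr0.
have ray q t : mboundary S M q -> - g q < t -> t <= 0 ->
    pw_smooth S (P q) (- g q) t /\ (arc_length S phi (P q) (- g q) t <= (t - - g q)%:E)%E.
  move=> bq gt t0; have [[e e0 gP] _ _] := P_geo q bq.
  apply: (unit_speed_len phi_finsler gP gt (le_lt_trans t0 e0)) => r rt.
  exact: (P_speed phi_finsler P_geo X_unit bq (le_trans rt t0)).
(* Positivity of [g] makes the time [- g q] negative, so the level [0] is reached on the backward
   ray, outside [M]. *)
have start q : mboundary S M q -> ut (P q (- g q)) = 0.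
  by move=> bq; rewrite ut_P// ?oppr_lt0 ?g_pos// subrr.
have from q : ut q = 0 -> (finsler_dist_from S phi setT (ut @^-1` [set 0%R]) p <= finsler_dist S phi setT q p)%E.
  by move=> uq; apply: ereal_inf_lbound; exists q.
have [Mp|Mp] := pselect (M p).
  rewrite ut_M// u_value//; apply/ereal_infP => _ [q bq <-].
  have g0 : - g q < 0 by rewrite oppr_lt0 g_pos.
  have [pr lr] := ray q 0 bq g0 (lexx _).
  apply: le_trans (from _ (start q bq)) _.
  apply: le_trans (dist_extend_l phi_finsler p g0 pr (fun _ _ => I) lr) _.
  have [_ -> _] := P_geo q bq.
  by rewrite sub0r opprK addeC leeD2r//; exact: le_dist.
have [bf t0 Pf] := P_foot p Mp.
have up : ut p = g (foot p) + time p by rewrite -{1}Pf ut_P.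
(* Outside [M], the characteristic through [p] already joins the level [0] to [p], in time [ut p];
   the segment is nondegenerate when [ut p] is positive. *)
have [tE|tn] := eqVneq (time p) (- g (foot p)).
  have u0 : ut p = 0 by rewrite up tE subrr.
  by rewrite u0; apply: le_trans (from _ u0) _; exact: dist_refl.
have gt : - g (foot p) < time p.
  by rewrite lt_neqAle eq_sym tn /=; move: up0; rewrite up; lra.
have [pr lr] := ray _ _ bf gt (ltW t0).
apply: le_trans (from _ (start _ bf)) _.
have d := @dist_le_len _ _ _ _ _ phi_finsler setT _ _ _ gt pr (fun _ _ => I).
rewrite Pf in d; apply: (le_trans d).
by apply: (le_trans lr); rewrite lee_fin up opprK addrC.
Qed.
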